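(* $$\sup_{p\in[2,\infty]}\ \sup_{d\in\mathbb{N}}\ \sup_{G\in\mathcal{F}_d}\Big\|\sup_{n\in\mathbb{Z}}|\mathcal{M}_{2^n}^G|\Big\|_{\ell^p(\mathbb{Z}^d)\to\ell^p(\mathbb{Z}^d)}<\infty.$$ That is, there is a constant $C<\infty$ such that for all $p\in[2,\infty]$, $d\in\mathbb{N}$, $G\in\mathcal{F}_d$ and $f\in\ell^p(\mathbb{Z}^d)$ one has $\big\|\sup_{n\in\mathbb{Z}}|\mathcal{M}_{2^n}^Gf|\big\|_{\ell^p(\mathbb{Z}^d)}\le C\|f\|_{\ell^p(\mathbb{Z}^d)}$.
   Context: A convex body in $\mathbb{R}^d$ is a closed, bounded, convex set with non-empty interior. It is 1-symmetric if it is invariant under all coordinate permutations and under all coordinate sign changes $x\mapsto(\epsilon_1x_1,\dots,\epsilon_dx_d)$, $\epsilon\in\{-1,1\}^d$. $\mathcal{F}_d$ is the family of all 1-symmetric convex bodies in $\mathbb{R}^d$. For $t>0$, $tG=\{tx:x\in G\}$. For $f:\mathbb{Z}^d\to\mathbb{C}$, $x\in\mathbb{Z}^d$ and $t>0$, the discrete averaging operator is $$\mathcal{M}_t^Gf(x)=\frac{1}{|tG\cap\mathbb{Z}^d|}\sum_{y\in tG\cap\mathbb{Z}^d}f(x-y).$$ The norm of a maximal operator $\|\cdot\|_{\ell^p\to\ell^p}$ is the least constant $C$ in the corresponding $\ell^p$ inequality for all $f\in\ell^p(\mathbb{Z}^d)$. *)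

(* Defs.v *)
From HB Require Import structures.
From mathcomp Require Import all_boot all_order all_algebra all_fingroup.
From mathcomp Require Import complex finmap.
From mathcomp Require Import all_classical all_reals all_analysis.

Set Implicit Arguments.
Unset Strict Implicit.
Unset Printing Implicit Defensive.

Import Order.TTheory GRing.Theory Num.Theory.
Import numFieldNormedType.Exports.

Local Open Scope classical_set_scope.
Local Open Scope ring_scope.

(* The lattice Z^d carries the discrete sigma-algebra, so that the l^p norms
   on it are the L^p norms of the counting measure. *)
HB.instance Definition _ := isPointed.Build int 0.
HB.instance Definition _ (d : nat) :=
  @isMeasurable.Build default_measure_display 'rV[int]_d
    discrete_measurable discrete_measurable0
    discrete_measurableC discrete_measurableU.

Section defs.
Context {R : realType} {d : nat}.

(* The topology and the norm on 'rV[R]_d are those of the sup norm, hence they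
   give the usual Euclidean notions of closed, bounded and interior. *)
Definition convex_body (G : set 'rV[R]_d) : Prop :=
  [/\ closed G, bounded_set G, convex_set G & interior G !=set0].

Definition one_symmetric (G : set 'rV[R]_d) : Prop :=
  (forall s : 'S_d, [set col_perm s x | x in G] = G) /\
  (forall e : 'I_d -> bool,
     [set \row_i ((-1) ^+ e i * x ord0 i) | x in G] = G).

Definition dilate (t : R) (G : set 'rV[R]_d) : set 'rV[R]_d :=
  [set t *: x | x in G].

Definition lattice_points (A : set 'rV[R]_d) : set 'rV[int]_d :=
  [set y | A (map_mx intr y)].

(* For bounded G the index set is finite, so that [fset_set] lists its elements
   and the sum over it (defined as 0 for infinite supports) is the actual sum. *)
Definition discrete_average (G : set 'rV[R]_d) (t : R)
    (f : 'rV[int]_d -> R[i]) (x : 'rV[int]_d) : R[i] :=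
  (#|` fset_set (lattice_points (dilate t G))|)%fset%:R^-1 *
  \sum_(y \in lattice_points (dilate t G)) f (x - y).

Definition dyadic_maximal (G : set 'rV[R]_d) (f : 'rV[int]_d -> R[i])
    (x : 'rV[int]_d) : \bar R :=
  ereal_sup (range (fun n : int =>
    (Normc.normc (discrete_average G (2 ^ n) f x))%:E)).

Definition lp_norm (p : \bar R) (F : 'rV[int]_d -> \bar R) : \bar R :=
  'N[counting]_p[F].

Definition modulus (f : 'rV[int]_d -> R[i]) (x : 'rV[int]_d) : \bar R :=
  (Normc.normc (f x))%:E.

Definition in_lp (p : \bar R) (f : 'rV[int]_d -> R[i]) : Prop :=
  (lp_norm p (modulus f) < +oo)%E.

End defs.

(* Main.v *)
Require Import Defs.
From mathcomp Require Import all_boot all_order all_algebra all_fingroup.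
From mathcomp Require Import complex finmap.
From mathcomp Require Import all_classical all_reals all_analysis ess_sup_inf.
From mathcomp Require Import zify ring lra.

Set Implicit Arguments.
Unset Strict Implicit.
Unset Printing Implicit Defensive.

Import Order.TTheory GRing.Theory Num.Theory.
Import numFieldNormedType.Exports.

Local Open Scope classical_set_scope.
Local Open Scope ring_scope.

(** Jensen's inequality reduces the case p < oo to l^2, and a large box of Z^d embeds in
    the torus (Z/N)^d, so it is enough to bound, on the torus, the maximal function over
    finitely many scales with a constant independent of d, N and the number of scales.

    Write S for the set of points with nonnegative coordinates of a dilate of G.  The
    average over the dilate is a mixture over a in S of the averages over all sign changes
    of a, whose Fourier multiplier at the frequency t is prod_i cos (a_i t_i).  The only
    facts about S that matter are that it is invariant under permutations, closed downward,
    and closed under moving mass from a larger coordinate to a smaller one.  They imply that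
    on each level |a|_1 = D the coordinates of a are exchangeable and of typical size D/d;
    second moment and resampling arguments then control both 1 - prod_i cos (a_i t_i) and
    the decay of prod_i cos (a_i t_i) on average over the level.

    As a consequence the multiplier of the n-th average differs from that of a mixture of
    Cesaro means of P^k, k <= D + D^2/d, where P is the lazy simple random walk, by a sum
    of six terms psi (u_n), psi u = min (u, 1/u)^(1/8), with u_(n+1) >= 2 u_n.  Hence the square
    function of the differences is bounded on l^2.  For scales with |a|_1 <= d/16 the
    frequencies near (pi, ..., pi) have to be treated separately: there the multiplier is
    (-1)^|a|_1 times the one at t + pi, and P is replaced by 1 - P, whose kernel is dominated
    by that of P.  The maximal function of the Cesaro means is bounded by a T T* argument.

    All functions are kept real by using the Hartley characters prod_i cas (t_i x_i),
    cas = cos + sin, instead of the exponentials. *)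

(** * Exchangeable weights on vectors of natural numbers *)

(** The time [D + D * D %/ d] is a variance match: with [kappa = D / d], a coordinate on the level
    [D] has second moment at most [4 * kappa ^+ 2 + kappa], and the lazy walk needs about
    [d * (kappa + kappa ^+ 2)] steps to spread each coordinate as much. The obstacle is to get decay
    of the level multipliers without loss in [d]. For small [kappa] most nonzero coordinates equal 1
    and the factors [cos (t i)] give it; for large [kappa] many coordinates lie between
    [delta * kappa] and [4 * kappa]. The second argument fails when one frequency is so large that
    [a i * t i] may reach a multiple of pi. A single level then need not decay (for [d = 1] it is
    one point), and the cancellation comes from letting that coordinate run through its whole
    interval, across levels. The comparison kernel must be positive, symmetric and Markov for the T
    T* argument, so [1 - P] enters the maximal estimate only through its domination by P. *)

Section NatVectors.
Context {d M : nat}.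

Definition nvec := {ffun 'I_d -> 'I_M.+1}.
Implicit Types (a b : nvec) (i j : 'I_d) (s : 'S_d).

Definition nsum a : nat := \sum_i (a i : nat).
Definition nperm s a : nvec := [ffun k => a (s k)].
(** Meant for [a i + t <= a j]: then [inord] does not truncate, and both new entries lie between the
    old ones, possibly in the opposite order. *)
Definition xfer i j (t : nat) a : nvec :=
  [ffun k => if k == i then inord (a i + t)
             else if k == j then inord (a j - t) else a k].

Lemma nperm_inj s : injective (nperm s).
Proof.
move=> a b /ffunP ab; apply/ffunP => k.
by have := ab (s^-1%g k); rewrite !ffunE permKV.
Qed.

Lemma nsum_nperm s a : nsum (nperm s a) = nsum a.
Proof.
rewrite /nsum [RHS](reindex_inj (@perm_inj _ s)) /=.
by apply: eq_bigr => k _; rewrite ffunE.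
Qed.

Lemma xferl i j t a : (a i + t <= a j)%N -> xfer i j t a i = (a i + t)%N :> nat.
Proof.
move=> h; rewrite ffunE eqxx inordK //.
exact: (leq_ltn_trans h (ltn_ord _)).
Qed.

Lemma xferr i j t a : i != j -> xfer i j t a j = (a j - t)%N :> nat.
Proof.
move=> ij; rewrite ffunE eq_sym (negbTE ij) eqxx inordK //.
exact: (leq_ltn_trans (leq_subr _ _) (ltn_ord _)).
Qed.

Lemma xfero i j t a k : k != i -> k != j -> xfer i j t a k = a k.
Proof. by move=> ki kj; rewrite ffunE (negbTE ki) (negbTE kj). Qed.

Lemma nvec_eq2 i j a b : a i = b i :> nat -> a j = b j :> nat ->
  (forall k, k != i -> k != j -> a k = b k) -> a = b.
Proof.
move=> hi hj hk; apply/ffunP => k.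
have [->|ki] := eqVneq k i; first exact/val_inj.
have [->|kj] := eqVneq k j; first exact/val_inj.
exact: hk.
Qed.

Lemma xfer_inj i j t a b : i != j -> (a i + t <= a j)%N -> (b i + t <= b j)%N ->
  xfer i j t a = xfer i j t b -> a = b.
Proof.
move=> ij ha hb e; apply: (@nvec_eq2 i j).
- by have := congr1 (fun c : nvec => c i : nat) e; rewrite !xferl //; lia.
- by have := congr1 (fun c : nvec => c j : nat) e; rewrite /= !xferr //; lia.
- move=> k ki kj; have := congr1 (fun c : nvec => c k) e.
  by rewrite /= !xfero.
Qed.

Lemma leq_nsum a i : (a i <= nsum a)%N.
Proof. by rewrite /nsum (bigD1 i) //= leq_addr. Qed.

End NatVectors.
Arguments nvec : clear implicits.

Section ExchangeableWeights.
Context {R : realType} {d M : nat}.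
Implicit Types (v : nvec d M -> R) (a b : nvec d M) (i j : 'I_d).

(** The third field is a discrete Schur concavity: making two coordinates more equal does not lower
    the weight. It is how convexity enters all estimates on a level. *)
Record exch v : Prop := Exch {
  exch_ge0 : forall a, 0 <= v a;
  exch_perm : forall (s : 'S_d) a, v (nperm s a) = v a;
  exch_xfer : forall i j t a, i != j -> (a i + t <= a j)%N ->
    v a <= v (xfer i j t a) }.

Lemma exch_sum v (F : nvec d M -> R) (s : 'S_d) : exch v ->
  \sum_a v a * F a = \sum_a v a * F (nperm s a).
Proof.
move=> ev; rewrite (reindex_inj (@nperm_inj _ _ s)) /=.
by apply: eq_bigr => a _; rewrite exch_perm.
Qed.

Lemma exch_coord v (f : nat -> R) i j : exch v ->
  \sum_a v a * f (a i) = \sum_a v a * f (a j).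
Proof.
move=> ev; rewrite (exch_sum _ (tperm i j) ev).
by apply: eq_bigr => a _; rewrite ffunE tpermL.
Qed.

Lemma exch_pair v (f : nat -> nat -> R) i j i' j' : exch v -> i != j ->
  i' != j' -> \sum_a v a * f (a i) (a j) = \sum_a v a * f (a i') (a j').
Proof.
move=> ev ij ij'.
rewrite (exch_sum _ (tperm i i') ev).
pose j1 := tperm i i' j.
transitivity (\sum_a v a * f (a i') (a j1)).
  by apply: eq_bigr => a _; rewrite !ffunE tpermL.
have j1i : j1 != i'.
  apply: contraNneq ij; rewrite /j1 -[X in _ = X](tpermL i i').
  by move=> /perm_inj ->.
rewrite (exch_sum _ (tperm j1 j') ev).
apply: eq_bigr => a _; rewrite !ffunE tpermL tpermD //.
by rewrite eq_sym.
Qed.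

(** Sending the pair [(a i, a j)] to [(a j - 1, a i + 1)] reverses the sign of [g] and, where [g] is
    positive, does not lower [v]; so [g] has mean at most 0. Adding the inequality with [i] and [j]
    exchanged leaves a quadratic relation. Second moments are thus bounded by correlations, which
    the fixed sum controls. *)
Lemma exch_ffactor2 v i j : exch v -> i != j ->
  \sum_a v a * ((a i)%:R * ((a i)%:R - 1)) <= 2 * \sum_a v a * ((a i)%:R * (a j)%:R).
Proof.
move=> ev ij.
pose g a : R := ((a i)%:R + 1) * (a j)%:R * ((a j)%:R - (a i)%:R - 1).
have key : \sum_a v a * g a <= 0.
  pose P a := ((a i).+2 <= a j)%N.
  pose phi a := xfer i j (a j - (a i).+1) a.
  have hphi a : P a -> [/\ (phi a i = (a j).-1 :> nat), (phi a j = (a i).+1 :> nat) &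
      (forall k, k != i -> k != j -> phi a k = a k)].
    move=> Pa; split; first by rewrite /phi xferl; rewrite /P in Pa; lia.
      by rewrite /phi xferr //; rewrite /P in Pa; lia.
    by move=> k ki kj; rewrite /phi xfero.
  have phi_inj : {in P &, injective phi}.
    move=> a b Pa Pb e; have [a1 a2 a3] := hphi a Pa; have [b1 b2 b3] := hphi b Pb.
    apply: (@nvec_eq2 _ _ i j).
    - by have := congr1 (fun c : nvec d M => c j : nat) e; rewrite /= a2 b2; lia.
    - have := congr1 (fun c : nvec d M => c i : nat) e; rewrite /= a1 b1.
      by move: Pa Pb; rewrite !unfold_in /P; lia.
    - by move=> k ki kj; rewrite -a3 // -b3 // e.
  have gphi a : P a -> g (phi a) = - g a.
    move=> Pa; have [a1 a2 _] := hphi a Pa; rewrite /g a1 a2.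
    have -> : (a j : nat) = (a j).-1.+1 by move: Pa; rewrite /P; lia.
    by rewrite -!natr1 /=; ring.
  have gP a : P a -> 0 <= g a.
    rewrite /P => Pa; rewrite /g mulr_ge0 ?mulr_ge0 //.
    have : ((a i)%:R + 2 <= (a j)%:R :> R) by rewrite -natrD ler_nat; lia.
    lra.
  rewrite (bigID P) /=.
  have h1 : \sum_(a | P a) v a * g a <= \sum_(a | P a) v (phi a) * g a.
    apply: ler_sum => a Pa; rewrite ler_wpM2r ?gP //; apply: (exch_xfer ev) => //.
    by move: Pa; rewrite /P; lia.
  have h2 : \sum_(a | P a) v (phi a) * g a =
      - \sum_(a in [set phi a | a in P]%SET) v a * g a.
    rewrite big_imset //= -sumrN; apply: eq_bigr => a Pa.
    by rewrite gphi // mulrN opprK.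
  (* Outside [P] every term is nonpositive, and the image of [P] under [phi] lies outside [P]. *)
  have h3 : \sum_(a | ~~ P a) v a * g a <= \sum_(a in [set phi a | a in P]%SET) v a * g a.
    rewrite big_mkcond /= [leRHS]big_mkcond /=; apply: ler_sum => a _.
    case: ifP => [nPa|/negbFE Pa]; case: ifP => // /imsetP.
    - move=> _; rewrite mulr_ge0_le0 ?(exch_ge0 ev) //.
      rewrite /g mulr_ge0_le0 ?mulr_ge0 //.
      move: nPa; rewrite /P -ltnNge ltnS => h.
      have : ((a j)%:R <= (a i)%:R + 1 :> R) by rewrite natr1 ler_nat.
      lra.
    - case=> b Pb ab; have [b1 b2 _] := hphi b Pb.
      by move: Pa Pb; rewrite unfold_in /P ab b1 b2; lia.
  lra.
have sym : \sum_a v a * g a =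
    \sum_a v a * (((a j)%:R + 1) * (a i)%:R * ((a i)%:R - (a j)%:R - 1)).
  apply: (@exch_pair v (fun x y : nat => (x%:R + 1) * y%:R * (y%:R - x%:R - 1)) i j j i) => //.
  by rewrite eq_sym.
have e1 : \sum_a v a * ((a i)%:R * ((a i)%:R - 1)) = \sum_a v a * ((a j)%:R * ((a j)%:R - 1)).
  exact: (@exch_coord v (fun x : nat => x%:R * (x%:R - 1)) i j).
have : \sum_a v a * g a + \sum_a v a * (((a j)%:R + 1) * (a i)%:R * ((a i)%:R - (a j)%:R - 1))
  = \sum_a v a * ((a i)%:R * ((a i)%:R - 1)) + \sum_a v a * ((a j)%:R * ((a j)%:R - 1))
    - 4 * \sum_a v a * ((a i)%:R * (a j)%:R).
  rewrite mulr_sumr -sumrN -!big_split /=; apply: eq_bigr => a _; rewrite /g; ring.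
lra.
Qed.

End ExchangeableWeights.

Lemma le_sqrt_sqr {R : rcfType} (x q : R) : 0 <= x -> x ^+ 2 <= q -> x <= Num.sqrt q.
Proof. by move=> x0 h; rewrite -(ger0_norm x0) -sqrtr_sqr ler_wsqrtr. Qed.

(** * Moments and small-coordinate tails on one level *)

Section LevelWeights.
Context {R : realType} {d M : nat}.
Variables (D : nat) (v : nvec d M -> R).
Hypothesis (d_gt0 : (0 < d)%N) (ev : exch v).
Hypothesis (vD : forall a, nsum a != D -> v a = 0).
Implicit Types (a b : nvec d M) (i j : 'I_d).

Let V := \sum_a v a.
Variable kappa : R.
Hypothesis kappaE : kappa * d%:R = D%:R.

Let v0 a : 0 <= v a. Proof. exact: exch_ge0. Qed.
Let V0 : 0 <= V. Proof. exact: sumr_ge0. Qed.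
Let d0 : 0 < d%:R :> R. Proof. by rewrite ltr0n. Qed.

Lemma level_le (F G : nvec d M -> R) :
  (forall a, nsum a = D -> F a <= G a) -> \sum_a v a * F a <= \sum_a v a * G a.
Proof.
move=> FG; apply: ler_sum => a _.
have [aD|aD] := eqVneq (nsum a) D; first by rewrite ler_wpM2l ?FG.
by rewrite vD // !mul0r.
Qed.

Lemma level_le1 (F : nvec d M -> R) (c : R) :
  (forall a, nsum a = D -> F a <= c) -> \sum_a v a * F a <= c * V.
Proof. by move=> Fc; rewrite mulrC /V mulr_suml; exact: (level_le (G := fun=> c)). Qed.

Lemma nsumR a : (nsum a)%:R = \sum_i (a i)%:R :> R.
Proof. by rewrite /nsum natr_sum. Qed.

(** The products over all ordered pairs of distinct indices add up to at most [D ^+ 2], and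
    exchangeability makes the [d * (d - 1)] means equal; the 2 absorbs [d / (d - 1)]. *)
Lemma level_prod2 i j : i != j ->
  \sum_a v a * ((a i)%:R * (a j)%:R) <= 2 * kappa ^+ 2 * V.
Proof.
move=> ij; set E := \sum_a _.
have d2 : (1 < d)%N.
  case: d i j ij {E} => [|[|n]] //; first by case.
  by move=> i j; rewrite (ord1 i) (ord1 j) eqxx.
have dd : 2 <= d%:R :> R by rewrite ler_nat.
have key : d%:R * (d%:R - 1) * E <= D%:R ^+ 2 * V.
  have -> : d%:R * (d%:R - 1) * E =
      \sum_a v a * \sum_(k : 'I_d) \sum_(l : 'I_d | l != k) (a k)%:R * (a l)%:R.
    under [RHS]eq_bigr do rewrite mulr_sumr.
    rewrite exchange_big /=.
    transitivity (\sum_(k : 'I_d) (d%:R - 1) * E); last first.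
      apply: eq_bigr => k _.
      under [RHS]eq_bigr do rewrite mulr_sumr.
      rewrite exchange_big /=.
      transitivity (\sum_(l : 'I_d | l != k) E); last first.
        apply: eq_bigr => l lk.
        by apply: (@exch_pair _ _ _ v (fun x y => x%:R * y%:R)) => //; rewrite eq_sym.
      rewrite sumr_const cardC1 card_ord -[RHS]mulr_natl.
      by congr (_ * _); rewrite -subn1 natrB.
    by rewrite sumr_const card_ord -[RHS]mulr_natl mulrA.
  apply: level_le1 => a aD.
  have -> : D%:R ^+ 2 = \sum_(k : 'I_d) \sum_(l : 'I_d) ((a k)%:R * (a l)%:R) :> R.
    rewrite -aD nsumR expr2 mulr_suml; apply: eq_bigr => k _.
    by rewrite mulr_sumr.
  apply: ler_sum => k _; rewrite [leRHS](bigD1 k) //= lerDr.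
  by rewrite mulr_ge0.
rewrite -kappaE in key.
have : (d%:R - 1) * E <= kappa ^+ 2 * d%:R * V.
  rewrite -(ler_pM2l d0); apply: le_trans (_ : (kappa * d%:R) ^+ 2 * V <= _).
    by rewrite mulrA.
  by rewrite le_eqVlt; apply/orP; left; apply/eqP; ring.
have E0 : 0 <= E by apply: sumr_ge0 => a _; rewrite !mulr_ge0.
have h2 : d%:R / 2 * E <= (d%:R - 1) * E by rewrite ler_wpM2r //; lra.
move=> h3; rewrite -(ler_pM2l d0); have := le_trans h2 h3; lra.
Qed.

Lemma level_ffactor2 :
  \sum_a v a * \sum_i ((a i)%:R * ((a i)%:R - 1)) <= 4 * kappa ^+ 2 * d%:R * V.
Proof.
(* With one coordinate there is no second index to compare with, but then [a i <= D = kappa]. *)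
have [d1|d1] := eqVneq d 1%N.
  apply: level_le1 => a aD.
  have -> : 4 * kappa ^+ 2 * d%:R = 4 * D%:R ^+ 2 by rewrite -kappaE d1 !mulr1.
  have d1' : d%:R = 1 :> R by rewrite d1.
  apply: le_trans (_ : \sum_(i < d) D%:R ^+ 2 <= _); last first.
    by rewrite sumr_const card_ord -[_ *+ d]mulr_natl d1'; have := sqr_ge0 (D%:R : R); lra.
  apply: ler_sum => i _.
  have : (a i)%:R <= D%:R :> R by rewrite ler_nat -aD leq_nsum.
  have : 0 <= (a i)%:R :> R by [].
  nra.
have d2 : (1 < d)%N by lia.
under eq_bigr do rewrite mulr_sumr.
rewrite exchange_big /=.
apply: le_trans (_ : \sum_(i < d) 4 * kappa ^+ 2 * V <= _); last first.
  by rewrite sumr_const card_ord -[_ *+ d]mulr_natl; lra.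
apply: ler_sum => i _.
have [j ji] : exists j : 'I_d, i != j.
  have [i0|i0] := eqVneq (i : nat) 0%N.
    by exists (Ordinal d2); apply/eqP => e; rewrite e in i0.
  exists (Ordinal d_gt0); apply/eqP => e; by rewrite e in i0.
apply: le_trans (exch_ffactor2 ev ji) _.
have := level_prod2 ji; lra.
Qed.

Lemma level_sqr :
  \sum_a v a * \sum_i (a i)%:R ^+ 2 <= (4 * kappa ^+ 2 + kappa) * d%:R * V.
Proof.
have -> : (4 * kappa ^+ 2 + kappa) * d%:R * V =
   4 * kappa ^+ 2 * d%:R * V + D%:R * V.
  by rewrite mulrDl mulrDl kappaE.
apply: le_trans (lerD level_ffactor2 (level_le1 (F := fun a : nvec d M => \sum_i ((a : nvec d M) i)%:R) _)).
  rewrite -big_split /=; apply: ler_sum => a _.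
  rewrite -mulrDr -big_split /= ler_wpM2l // ler_sum // => i _.
  by rewrite le_eqVlt; apply/orP; left; apply/eqP; ring.
by move=> a aD; rewrite -nsumR aD.
Qed.

(** For [c < m], moving [c * h.+1] units from [j] to [i] sends the event injectively into the set
    [a i %/ h.+1 = c] without lowering the weight. These sets are disjoint, so [m] copies of the
    mass fit into [V]. The move is admissible exactly because [c.+1 * h.+1 <= u.+2]. *)
Lemma level_small_large (h u : nat) i j : i != j ->
  \sum_(a : nvec d M | (a i <= h)%N && (u < a j)%N) v a <= 2 * h.+1%:R / u.+1%:R * V.
Proof.
move=> ij; pose m := (u.+2 %/ h.+1)%N.
pose E := [pred a : nvec d M | (a i <= h)%N && (u < a j)%N].
set S := \sum_(a | _) _.
have S0 : 0 <= S by exact: sumr_ge0.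
have SV : S <= V by rewrite /V [leRHS](bigID E) /= lerDl sumr_ge0.
have h0 : 0 < h.+1%:R :> R by [].
have u0 : 0 < u.+1%:R :> R by [].
have key : m%:R * S <= V.
  have -> : m%:R * S = \sum_(c < m) S by rewrite sumr_const card_ord mulr_natl.
  apply: le_trans (_ : \sum_(c < m) \sum_(b : nvec d M | (b i %/ h.+1 == c)%N) v b <= _).
    apply: ler_sum => c _; pose t := (c * h.+1)%N.
    have tE a : a \in E -> (a i + t <= a j)%N.
      rewrite inE => /andP[ah au].
      have : (c.+1 * h.+1 <= u.+2)%N.
        by apply: leq_trans (leq_trunc_div u.+2 h.+1); rewrite leq_mul2r ltn_ord orbT.
      rewrite /t; lia.
    apply: le_trans (_ : \sum_(a in E) v (xfer i j t a) <= _).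
      by apply: ler_sum => a aE; apply: (exch_xfer ev) => //; exact: tE.
    have inj : {in E &, injective (xfer i j t)}.
      by move=> a b aE bE; apply: xfer_inj => //; exact: tE.
    rewrite -(big_imset (fun b => v b) inj) /=.
    rewrite big_mkcond [leRHS]big_mkcond /=; apply: ler_sum => b _.
    case: ifP => [/imsetP[a aE ->]|_]; last by case: ifP.
    rewrite xferl ?tE // /t addnC divnMDl // divn_small ?addn0 ?eqxx //.
    by move: aE; rewrite inE ltnS => /andP[].
  rewrite (exchange_big_dep predT) //=; apply: ler_sum => b _.
  rewrite big_mkcond /=.
  case: (ltnP (b i %/ h.+1) m) => bm.
    rewrite (bigD1 (Ordinal bm)) //= eqxx big1 ?addr0 // => c.
    by rewrite -val_eqE /= eq_sym => /negbTE ->.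
  rewrite big1 // => c _; case: eqP => // e.
  by move: (ltn_ord c); rewrite -e ltnNge bm.
rewrite -mulrA mulrC -mulrA -(ler_pM2l u0).
rewrite [leRHS](_ : _ = 2 * h.+1%:R * V); last by field; rewrite gt_eqF.
have [m0|m0] := posnP m.
  have uh : u.+1%:R <= h.+1%:R :> R.
    by rewrite ler_nat; move: m0; rewrite /m; move/eqP; rewrite -leqn0 leqNgt divn_gt0 // -ltnNge; lia.
  apply: le_trans (_ : h.+1%:R * V <= _); first by apply: ler_pM.
  by rewrite -subr_ge0 (_ : _ - _ = h.+1%:R * V) ?mulr_ge0 //; ring.
have um : u.+1%:R <= 2 * h.+1%:R * m%:R :> R.
  rewrite -!natrM ler_nat; have := ltn_ceil u.+2 (isT : 0 < h.+1)%N.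
  by rewrite -/m; nia.
apply: le_trans (_ : 2 * h.+1%:R * m%:R * S <= _); first by rewrite ler_wpM2r.
by rewrite -!mulrA ler_wpM2l // ler_wpM2l.
Qed.

(** A vector of sum [D] has many coordinates above about [kappa / 2] or a large sum of squares. The
    former is rarely compatible with a small coordinate [i] by [level_small_large], the latter is
    rare by [level_sqr]; [A] balances the two, with costs 16 and 5. *)
Lemma level_coord_small (h : nat) i : 1 <= kappa ->
  \sum_(a : nvec d M | (a i <= h)%N) v a <= 21 * Num.sqrt (h.+1%:R / kappa) * V.
Proof.
move=> k1; have [q qE] : exists q, q = h.+1%:R / kappa by eexists.
rewrite -qE; set S := \sum_(a | _) _.
have k0 : 0 < kappa by lra.
have q0 : 0 < q by rewrite qE divr_gt0.
have SV : S <= V by rewrite /V [leRHS](bigID (fun a : nvec d M => (a i <= h)%N)) /= lerDl sumr_ge0.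
have sq0 : 0 < Num.sqrt q by rewrite sqrtr_gt0.
have sq2 : Num.sqrt q ^+ 2 = q by rewrite sqr_sqrtr // ltW.
have [qbig|qsmall] := leP (4^-1) q.
  apply: le_trans SV _; rewrite ler_peMl //.
  have : 2^-1 <= Num.sqrt q by rewrite le_sqrt_sqr //; lra.
  lra.
have [A AE] : exists A, A = (Num.sqrt q)^-1 by eexists.
have A0 : 0 < A by rewrite AE invr_gt0.
pose u := (D %/ (2 * d))%N.
have DE := esym kappaE.
have D0 : 0 < D%:R :> R by rewrite DE mulr_gt0.
have uk : u%:R <= kappa / 2.
  rewrite -(ler_pM2r d0) mulrAC -DE.
  have : (u * (2 * d))%:R <= D%:R :> R by rewrite ler_nat leq_trunc_div.
  rewrite !natrM; lra.
have ku : kappa / 2 <= u.+1%:R.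
  rewrite -(ler_pM2r d0) mulrAC -DE.
  have : D%:R <= (u.+1 * (2 * d))%:R :> R.
    by rewrite ler_nat ltnW // ltn_ceil // muln_gt0.
  rewrite !natrM; lra.
(* Makes the diagonal term [j = i] in [s2] a sum over the empty event. *)
have hu : (h <= u)%N.
  have : h.+1%:R < u.+1%:R :> R.
    by apply: lt_le_trans ku; move: qsmall; rewrite qE ltr_pdivrMr //; lra.
  by rewrite ltr_nat ltnS; exact: ltnW.
pose n a : R := \sum_j (u < a j)%N%:R.
pose Q a : R := \sum_j (a j)%:R ^+ 2.
have Q0 a : 0 <= Q a by apply: sumr_ge0 => j _; exact: sqr_ge0.
have n0 a : 0 <= n a by apply: sumr_ge0.
(* If [Q a] is below [A * kappa * D], at least [d / (4 * A)] coordinates exceed [u]: sum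
   [2 * x <= l + x ^+ 2 / l] with [l = 2 * A * kappa] over the large coordinates and use
   [2 * x <= kappa] on the others. *)
have pt a : nsum a = D -> 1 <= 4 * A / d%:R * n a + Q a / (A * kappa * D%:R).
  move=> aD.
  have [QA|QA] := leP (A * kappa * D%:R) (Q a).
    have : 1 <= Q a / (A * kappa * D%:R).
      by rewrite ler_pdivlMr ?mul1r // mulr_gt0 // mulr_gt0.
    have : 0 <= 4 * A / d%:R * n a by rewrite !mulr_ge0 ?invr_ge0 // ltW.
    lra.
  have lam0 : 0 < 2 * A * kappa by rewrite mulr_gt0 // mulr_gt0.
  have h1 : D%:R <= 2 * A * kappa * n a + Q a / (2 * A * kappa).
    apply: le_trans (_ : \sum_j ((a j)%:R * 2 - kappa) <= _).
      rewrite big_split /= -mulr_suml -nsumR aD sumr_const card_ord -[_ *+ d]mulr_natl.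
      by rewrite mulrN -[_ * kappa]mulrC -DE; lra.
    rewrite /n /Q mulr_sumr mulr_suml -big_split /=; apply: ler_sum => j _.
    case: ltnP => au.
      have : 2 * (a j)%:R <= 2 * A * kappa * 1 + (a j)%:R ^+ 2 / (2 * A * kappa).
        set l := 2 * A * kappa; have l0 : 0 < l by [].
        rewrite -subr_ge0 (_ : _ - _ = (l - (a j)%:R) ^+ 2 / l).
          by rewrite divr_ge0 ?sqr_ge0 // ltW.
        by field; rewrite gt_eqF.
      by rewrite mulr1; lra.
    rewrite mulr0 add0r.
    have : (a j)%:R <= u%:R :> R by rewrite ler_nat.
    have : 0 <= (a j)%:R ^+ 2 / (2 * A * kappa) by rewrite divr_ge0 ?sqr_ge0 // ltW.
    lra.
  have h2 : Q a / (2 * A * kappa) <= D%:R / 2.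
    rewrite ler_pdivrMr //; lra.
  have h3 : D%:R <= 4 * A * kappa * n a by lra.
  have h4 : 0 <= Q a / (A * kappa * D%:R) by rewrite divr_ge0 // !mulr_ge0 // ltW.
  have h5 : 1 <= 4 * A / d%:R * n a.
    rewrite -(ler_pM2r D0) mul1r {2}DE.
    by rewrite (_ : _ * (kappa * d%:R) = 4 * A * kappa * n a) //; field; rewrite gt_eqF.
  lra.
have s1 : S <= \sum_a v a * ((a i <= h)%N%:R * (4 * A / d%:R * n a) + Q a / (A * kappa * D%:R)).
  rewrite /S big_mkcond /=; apply: le_trans (_ : \sum_a v a * (a i <= h)%N%:R <= _).
    by apply: ler_sum => a _; case: ifP => _; rewrite ?mulr1 ?mulr0.
  apply: level_le => a aD; case: leqP => _; first by rewrite mul1r pt.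
  by rewrite mul0r add0r divr_ge0 // !mulr_ge0 // ltW.
have s2 : \sum_a v a * ((a i <= h)%N%:R * n a) <= d%:R * (4 * q * V).
  rewrite /n.
  have -> : \sum_a v a * ((a i <= h)%N%:R * \sum_j (u < a j)%N%:R) =
     \sum_j \sum_(a : nvec d M | (a i <= h)%N && (u < a j)%N) v a.
    under eq_bigr do rewrite !mulr_sumr.
    rewrite exchange_big /=; apply: eq_bigr => j _.
    rewrite [RHS]big_mkcond /=; apply: eq_bigr => a _.
    by case: leqP => _; case: ltnP => _; rewrite ?mulr1 ?mul1r ?mul0r ?mulr0.
  apply: le_trans (_ : \sum_(j < d) 4 * q * V <= _); last first.
    by rewrite sumr_const card_ord -[_ *+ d]mulr_natl.
  apply: ler_sum => j _.
  have [->|ij] := eqVneq i j.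
    rewrite big1; last by move=> a /andP[ah]; rewrite ltnNge (leq_trans ah hu).
    by apply: mulr_ge0 => //; apply: mulr_ge0 => //; exact: ltW.
  apply: le_trans (level_small_large h u ij) _.
  apply: ler_wpM2r => //; rewrite ler_pdivrMr //.
  have -> : 2 * h.+1%:R = q * (2 * kappa) by rewrite qE; field; rewrite gt_eqF.
  rewrite (mulrC 4) -mulrA; apply: ler_wpM2l; first exact: ltW.
  lra.
have s3 : \sum_a v a * Q a <= 5 * kappa ^+ 2 * d%:R * V.
  apply: le_trans level_sqr _; rewrite ler_wpM2r // ler_wpM2r ?(ltW d0) //.
  have : kappa <= kappa ^+ 2 by rewrite expr2 ler_peMl // ltW.
  lra.
apply: le_trans s1 _.
under eq_bigr do rewrite mulrDr.
rewrite big_split /=.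
have -> : \sum_a v a * ((a i <= h)%N%:R * (4 * A / d%:R * n a)) =
   4 * A / d%:R * \sum_a v a * ((a i <= h)%N%:R * n a).
  by rewrite mulr_sumr; apply: eq_bigr => a _; ring.
have -> : \sum_a v a * (Q a / (A * kappa * D%:R)) = (\sum_a v a * Q a) / (A * kappa * D%:R).
  by rewrite mulr_suml; apply: eq_bigr => a _; rewrite mulrA.
have t1 : 4 * A / d%:R * \sum_a v a * ((a i <= h)%N%:R * n a) <= 16 * Num.sqrt q * V.
  apply: le_trans (ler_wpM2l _ s2) _; first by rewrite !mulr_ge0 ?invr_ge0 // ltW.
  rewrite le_eqVlt; apply/orP; left; apply/eqP.
  rewrite AE [in X in X = _](_ : 4 * q * V = 4 * Num.sqrt q ^+ 2 * V); [field | by rewrite sq2]; rewrite !gt_eqF //.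
have t2 : (\sum_a v a * Q a) / (A * kappa * D%:R) <= 5 * Num.sqrt q * V.
  rewrite ler_pdivrMr ?mulr_gt0 //; apply: le_trans s3 _.
  rewrite le_eqVlt; apply/orP; left; apply/eqP.
  rewrite DE AE; field; rewrite gt_eqF //.
lra.
Qed.

End LevelWeights.

(** * Cosine products over a level *)

Section Trigonometry.
Context {R : realType}.
Implicit Types (t x : R) (n k : nat).

(** The square of sin(t / 2): it measures the distance of [t] to the multiples of 2 pi. *)
Definition hsin2 t : R := (1 - cos t) / 2.

Lemma hsin2_ge0 t : 0 <= hsin2 t.
Proof. by rewrite /hsin2 divr_ge0 // subr_ge0 cos_le1. Qed.

Lemma hsin2_le1 t : hsin2 t <= 1.
Proof. by rewrite /hsin2; have := cos_geN1 t; lra. Qed.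

Lemma hsin2_double x : hsin2 (2 * x) = sin x ^+ 2.
Proof.
by rewrite /hsin2 mulr_natl cos_mulr2n (sin2cos2 x) mulr2n; lra.
Qed.

Lemma sin_natmul_le n x : `|sin (n%:R * x)| <= n%:R * `|sin x|.
Proof.
elim: n => [|n IH]; first by rewrite !mul0r sin0 normr0.
rewrite -natr1 !mulrDl !mul1r sinD; apply: le_trans (ler_normD _ _) _.
rewrite !normrM; apply: lerD.
  by apply: le_trans IH; rewrite ler_piMr // cos_max.
by rewrite ler_piMl // cos_max.
Qed.

Lemma onesub_cos_natmul n t : 1 - cos (n%:R * t) <= n%:R ^+ 2 * (2 * hsin2 t).
Proof.
have e x : 1 - cos x = 2 * hsin2 x by rewrite /hsin2; lra.
rewrite e; have [x ->] : exists x, t = 2 * x by exists (t / 2); lra.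
have -> : n%:R * (2 * x) = 2 * (n%:R * x) by ring.
rewrite !hsin2_double (mulrCA (n%:R ^+ 2)) ler_pM2l // -exprMn.
rewrite -[leLHS]real_normK ?num_real // -[leRHS]real_normK ?num_real //.
by rewrite lerXn2r ?nnegrE // normrM normr_nat sin_natmul_le.
Qed.

Lemma sqr_sin_hsin2 t : sin t ^+ 2 = 4 * (hsin2 t * (1 - hsin2 t)).
Proof. by rewrite /hsin2 sin2cos2; lra. Qed.

(* The Chebyshev recursion sin((n+2)t) = sin(nt) + 2 cos((n+1)t) sin t, with all
   cosines at least 1/2. *)
Lemma sin_natmul_ge n t : 4 * n%:R ^+ 2 * hsin2 t <= 1 ->
  n%:R / 2 * sin t ^+ 2 <= sin t * sin (n%:R * t).
Proof.
have s0 := hsin2_ge0 t.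
have mono k m : (k <= m)%N -> 4 * m%:R ^+ 2 * hsin2 t <= 1 -> 4 * k%:R ^+ 2 * hsin2 t <= 1.
  move=> km; apply: le_trans; rewrite ler_wpM2r // ler_wpM2l //.
  by rewrite lerXn2r ?nnegrE // ler_nat.
suff H m : 4 * m%:R ^+ 2 * hsin2 t <= 1 ->
    (m%:R / 2 * sin t ^+ 2 <= sin t * sin (m%:R * t)) /\
    (m.-1%:R / 2 * sin t ^+ 2 <= sin t * sin (m.-1%:R * t)) by move=> /H[].
elim: m => [|m IH] hm; first by rewrite !mul0r sin0 mulr0.
have [h1 h2] := IH (mono _ _ (leqnSn m) hm); split => //=.
case: m {IH} hm h1 h2 => [|m] hm h1 h2.
  by rewrite !mul1r -expr2; have := sqr_ge0 (sin t); lra.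
have hc : 1 - cos (m.+1%:R * t) <= 1 / 2.
  apply: le_trans (onesub_cos_natmul _ _) _.
  have := mono _ _ (leqnSn m.+1) hm; rewrite [X in _ -> X <= _]mulrCA -mulrA.
  by set q := _ ^+ 2 * _; move: q => q; lra.
have rec : sin (m.+2%:R * t) = sin (m%:R * t) + 2 * cos (m.+1%:R * t) * sin t.
  have -> : m.+2%:R * t = m.+1%:R * t + t by rewrite -natr1; ring.
  have -> : m%:R * t = m.+1%:R * t - t by rewrite -natr1; ring.
  by rewrite sinD sinB; ring.
rewrite rec mulrDr; move: h2 => /=; have := sqr_ge0 (sin t).
move=> q0 h2; have -> : m.+2%:R = m%:R + 2 :> R by rewrite -addn2 natrD.
have : sin t ^+ 2 <= sin t * (2 * cos (m.+1%:R * t) * sin t).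
  by rewrite -subr_ge0 (_ : _ - _ = sin t ^+ 2 * (2 * cos (m.+1%:R * t) - 1)); [rewrite mulr_ge0 //; lra | ring].
lra.
Qed.

Lemma sqr_sin_natmul_ge n t : 4 * n%:R ^+ 2 * hsin2 t <= 1 ->
  n%:R ^+ 2 * hsin2 t / 2 <= sin (n%:R * t) ^+ 2.
Proof.
case: n => [|n] h; first by rewrite !mul0r expr0n /= !mul0r sin0 expr0n.
have s0 := hsin2_ge0 t.
have := sin_natmul_ge h; set N : R := n.+1%:R => h1.
have N1 : 1 <= N by rewrite ler1n.
have N2 : 1 <= N ^+ 2 by rewrite exprn_ege1.
have s14 : hsin2 t <= 4^-1.
  have : 4 * hsin2 t <= 4 * N ^+ 2 * hsin2 t by rewrite ler_wpM2r // ler_peMr.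
  move: h; rewrite -/N; lra.
have [s00|sp] := eqVneq (hsin2 t) 0.
  by rewrite s00 mulr0 mul0r sqr_ge0.
have hs0 : 0 < hsin2 t by rewrite lt_def sp.
have q2 := sqr_sin_hsin2 t.
have qs : 2 * hsin2 t <= sin t ^+ 2.
  rewrite q2; have : hsin2 t * hsin2 t <= 4^-1 * hsin2 t by rewrite ler_wpM2r.
  lra.
have q0 : 0 < sin t ^+ 2 by lra.
have h3 : (N / 2 * sin t ^+ 2) ^+ 2 <= (sin t * sin (N * t)) ^+ 2.
  rewrite lerXn2r ?nnegrE //; first by rewrite mulr_ge0 ?(ltW q0) // divr_ge0.
  by apply: le_trans h1; rewrite mulr_ge0 ?(ltW q0) // divr_ge0.
have h4 : N ^+ 2 / 4 * sin t ^+ 2 <= sin (N * t) ^+ 2.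
  rewrite -(ler_pM2l q0) -exprMn; apply: le_trans h3.
  by rewrite le_eqVlt; apply/orP; left; apply/eqP; field.
apply: le_trans h4.
have := ler_wpM2l (_ : 0 <= N ^+ 2 / 4) qs; rewrite divr_ge0 ?sqr_ge0 // => /(_ isT).
lra.
Qed.

Lemma norm_cos_natmul_le n t (w : R) : 0 <= w <= 1 -> 4 * n%:R ^+ 2 * hsin2 t <= 1 ->
  w <= n%:R ^+ 2 * hsin2 t -> `|cos (n%:R * t)| <= 1 - w / 4.
Proof.
move=> /andP[w0 w1] h hw.
have h1 := sqr_sin_natmul_ge h.
have w40 : 0 <= 1 - w / 4 by lra.
rewrite -(ler_pXn2r (isT : 0 < 2)%N) ?nnegrE // real_normK ?num_real // cos2sin2.
have : 0 <= w ^+ 2 by exact: sqr_ge0.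
lra.
Qed.

Lemma cos_natmul_pi n t : cos (n%:R * (t + pi)) = (-1) ^+ n * cos (n%:R * t).
Proof.
elim: n => [|n IH]; first by rewrite !mul0r mul1r.
have npi : sin (n%:R * pi : R) = 0.
  elim: n {IH} => [|n IH]; first by rewrite mul0r sin0.
  by rewrite -natr1 mulrDl mul1r sinDpi IH oppr0.
have -> : n.+1%:R * (t + pi) = (n%:R * pi + n.+1%:R * t) + pi by rewrite -natr1; ring.
have cn : cos (n%:R * pi : R) = (-1) ^+ n.
  elim: n {IH npi} => [|n IH]; first by rewrite mul0r cos0.
  by rewrite -natr1 mulrDl mul1r cosDpi IH exprS mulN1r.
by rewrite cosDpi cosD npi mul0r subr0 cn exprS mulN1r mulNr.
Qed.

Lemma hsin2Dpi t : hsin2 (t + pi) = 1 - hsin2 t.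
Proof. by rewrite /hsin2 cosDpi; lra. Qed.

(** The number of integers of absolute value [n]. *)
Definition sgnw (n : nat) : R := if n == 0%N then 1 else 2.

Lemma sgnw_ge1 n : 1 <= sgnw n.
Proof. by rewrite /sgnw; case: ifP => _ //; lra. Qed.

(** The weighted sum is the Dirichlet kernel, the sum of cosines over the integers from -k to k;
    multiplied by sin(t / 2) it telescopes to sin((2k + 1) t / 2). *)
Lemma dirichlet_kernel k t :
  `|\sum_(x < k.+1) sgnw x * cos (x%:R * t)| * Num.sqrt (hsin2 t) <= 1.
Proof.
have -> : Num.sqrt (hsin2 t) = `|sin (t / 2)|.
  by rewrite -{1}[t](_ : 2 * (t / 2) = t); [rewrite hsin2_double sqrtr_sqr | lra].
rewrite -normrM.
suff -> : (\sum_(x < k.+1) sgnw x * cos (x%:R * t)) * sin (t / 2) =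
  sin ((2 * k%:R + 1) * (t / 2)) by exact: sin_max.
elim: k => [|k IH].
  by rewrite big_ord1 /sgnw /= mul0r cos0 !mul1r; congr sin; lra.
rewrite big_ord_recr /= mulrDl IH /sgnw /=.
have -> : (2 * k.+1%:R + 1) * (t / 2) = k.+1%:R * t + t / 2 by field.
have -> : (2 * k%:R + 1) * (t / 2) = k.+1%:R * t - t / 2 by rewrite -natr1; field.
by rewrite sinB sinD; ring.
Qed.

End Trigonometry.

Section Products.
Context {R : realType}.

Lemma onesub_prod_le (I : Type) (r : seq I) (x : I -> R) : (forall i, -1 <= x i <= 1) ->
  1 - \prod_(i <- r) x i <= \sum_(i <- r) (1 - x i).
Proof.
move=> hx; elim: r => [|i r IH]; first by rewrite !big_nil subrr.
rewrite !big_cons; have /andP[x1 x2] := hx i.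
have : `|\prod_(j <- r) x j| <= 1.
  elim: r {IH} => [|j r IH]; first by rewrite big_nil normr1.
  rewrite big_cons normrM mulr_ile1 // ler_norml //.
rewrite ler_norml => /andP[p1 p2]; nra.
Qed.

Lemma norm_prod_le1 (I : Type) (r : seq I) (P : pred I) (x : I -> R) :
  (forall i, `|x i| <= 1) -> `|\prod_(i <- r | P i) x i| <= 1.
Proof.
move=> hx; elim/big_ind: _ => [|a b ha hb|i _] //; first by rewrite normr1.
by rewrite normrM mulr_ile1.
Qed.

Lemma prod_onesub_le (I : Type) (r : seq I) (x : I -> R) : (forall i, 0 <= x i <= 1) ->
  \prod_(i <- r) (1 - x i) <= (1 + \sum_(i <- r) x i)^-1.
Proof.
move=> hx; have S0 (r' : seq I) : 0 <= \sum_(i <- r') x i.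
  by apply: sumr_ge0 => i _; case/andP: (hx i).
rewrite -[leRHS]mul1r ler_pdivlMr; last by have := S0 r; lra.
elim: r => [|i r IH]; first by rewrite !big_nil mul1r addr0.
rewrite !big_cons; have /andP[x1 x2] := hx i.
have P0 : 0 <= \prod_(j <- r) (1 - x j).
  by apply: prodr_ge0 => j _; have /andP[_ ?] := hx j; rewrite subr_ge0.
have := S0 r; move: IH P0; set P := \prod_(j <- r) _; set S := \sum_(j <- r) _.
move=> IH P0 S1.
have : 0 <= P * (x i ^+ 2 + S * x i) by rewrite mulr_ge0 // addr_ge0 ?sqr_ge0 // mulr_ge0.
by have -> : (1 - x i) * P * (1 + (x i + S)) = P * (1 + S) - P * (x i ^+ 2 + S * x i); [ring | lra].
Qed.

End Products.

(** * Concentration and decay from exchangeability *)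

Section Chebyshev.
Context {R : realType} {d M : nat}.
Variable v : nvec d M -> R.
Hypothesis ev : exch v.

(* With X_i = 1 - [a_i in J] / mean the sum of all X_i vanishes; by exchangeability
   the X_i are therefore pairwise nonpositively correlated. *)
Lemma exch_chebyshev (J : pred nat) (w : 'I_d -> R) (nu : R) :
  (forall i, 0 <= w i <= 1) -> 0 < nu -> 0 < \sum_i w i ->
  \sum_(a : nvec d M | (nu * d%:R <= \sum_i (J (a i))%:R) &&
     (\sum_i w i * (J (a i))%:R < nu * (\sum_i w i) / 2)) v a
  <= 4 / (nu * \sum_i w i) * \sum_a v a.
Proof.
move=> hw nu0; set W := \sum_i w i => W0.
have w0 i : 0 <= w i by case/andP: (hw i).
have v0 := exch_ge0 ev.
have d0 : 0 < d%:R :> R.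
  rewrite ltr0n lt0n; apply: contraTneq W0 => d0.
  rewrite /W big1 ?ltxx // => i _; exfalso.
  by have := leq_ltn_trans (leq0n i) (ltn_ord i); rewrite d0.
pose n (a : nvec d M) : R := \sum_i (J (a i))%:R.
pose ok a := nu * d%:R <= n a.
pose X i a : R := if ok a then (J (a i))%:R * d%:R / n a - 1 else 0.
have nP a : ok a -> 0 < n a by apply: lt_le_trans; rewrite mulr_gt0.
have n_perm (s : 'S_d) a : n (nperm s a) = n a.
  rewrite /n [RHS](reindex_inj (@perm_inj _ s)) /=.
  by apply: eq_bigr => i _; rewrite ffunE.
have X_perm (s : 'S_d) i a : X i (nperm s a) = X (s i) a.
  by rewrite /X /ok n_perm ffunE.
have sumX a : \sum_i X i a = 0.
  rewrite /X; case oka : (ok a); last exact: big1.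
  rewrite sumrB -!mulr_suml sumr_const card_ord -/(n a) mulrAC divff ?mul1r ?subrr //.
  by rewrite gt_eqF ?nP.
pose E i j := \sum_a v a * (X i a * X j a).
have E_perm (s : 'S_d) i j : E (s i) (s j) = E i j.
  rewrite /E [RHS](exch_sum _ s ev); apply: eq_bigr => a _; by rewrite !X_perm.
have E0 i : 0 <= E i i.
  by apply: sumr_ge0 => a _; rewrite mulr_ge0 // -expr2 sqr_ge0.
have Eneg i j : i != j -> E i j <= 0.
  move=> ij.
  have : \sum_(k | k != i) E i k <= 0.
    have : \sum_k E i k = 0.
      rewrite exchange_big /= big1 // => a _.
      by rewrite -mulr_sumr -mulr_sumr sumX !mulr0.
    by rewrite (bigD1 i) //=; have := E0 i; lra.
  rewrite (eq_bigr (fun=> E i j)).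
    rewrite sumr_const pmulrn_lle0 //; apply/card_gt0P; exists j.
    by move: ij; rewrite eq_sym.
  move=> k ki; rewrite -(E_perm (tperm j k) i j) tpermL tpermD //.
  by rewrite eq_sym.
have Esq : \sum_i w i * E i i <= W / nu * \sum_a v a.
  have Eii i j : E i i = E j j by rewrite -(E_perm (tperm i j)) tpermL.
  have tot : \sum_i E i i <= d%:R / nu * \sum_a v a.
    rewrite /E exchange_big /= mulr_sumr; apply: ler_sum => a _.
    rewrite -mulr_sumr mulrC ler_wpM2r // /X; case oka : (ok a); last first.
      by rewrite big1 ?divr_ge0 ?ltW // => i _; rewrite mulr0.
    have na := nP a oka.
    have -> : \sum_i ((J (a i))%:R * d%:R / n a - 1) * ((J (a i))%:R * d%:R / n a - 1)
        = d%:R ^+ 2 / n a - d%:R.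
      transitivity (\sum_i ((J (a i))%:R * (d%:R ^+ 2 / n a ^+ 2 - 2 * d%:R / n a) + 1)).
        by apply: eq_bigr => i _; case: (J (a i)) => /=; field; rewrite gt_eqF.
      rewrite big_split /= -mulr_suml sumr_const card_ord -/(n a).
      by field; rewrite gt_eqF.
    have : d%:R ^+ 2 / n a <= d%:R / nu.
      rewrite ler_pdivrMr // mulrAC ler_pdivlMr // expr2 -mulrA ler_wpM2l ?(ltW d0) //.
      by rewrite mulrC.
    lra.
  have [i0|] := pickP 'I_d; last first.
    by move=> h; move: W0; rewrite /W big1 ?ltxx // => i; have := h i.
  move=> _; rewrite (eq_bigr (fun i => w i * E i0 i0)); last by move=> i _; rewrite (Eii i i0).
  rewrite -mulr_suml -/W -mulrA; apply: ler_wpM2l; first exact: ltW.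
  move: tot; rewrite (eq_bigr (fun=> E i0 i0)); last by move=> i _; rewrite (Eii i i0).
  rewrite sumr_const card_ord -[_ *+ d]mulr_natl -mulrA ler_pM2l //.
pose Z a := \sum_i w i * X i a.
have EZ : \sum_a v a * Z a ^+ 2 <= W / nu * \sum_a v a.
  have -> : \sum_a v a * Z a ^+ 2 = \sum_i \sum_j w i * w j * E i j.
    rewrite /E /Z; under eq_bigr do rewrite expr2 mulr_suml mulr_sumr.
    rewrite exchange_big /=; apply: eq_bigr => i _.
    under eq_bigr do rewrite mulr_sumr mulr_sumr.
    rewrite exchange_big /=; apply: eq_bigr => j _.
    by rewrite mulr_sumr; apply: eq_bigr => a _; ring.
  apply: le_trans Esq; apply: ler_sum => i _.
  rewrite (bigD1 i) //= -[leRHS]addr0; apply: lerD.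
    by rewrite -mulrA ler_wpM2l // ler_piMl // ?E0 //; case/andP: (hw i).
  by apply: sumr_le0 => j ji; rewrite mulr_ge0_le0 ?mulr_ge0 ?Eneg // eq_sym.
have step : W ^+ 2 / 4 * \sum_(a : nvec d M | (nu * d%:R <= \sum_i (J (a i))%:R) &&
     (\sum_i w i * (J (a i))%:R < nu * W / 2)) v a <= \sum_a v a * Z a ^+ 2.
  rewrite mulr_sumr big_mkcond /=; apply: ler_sum => a _.
  case: ifP => [/andP[oka hlt]|_]; last by rewrite mulr_ge0 ?sqr_ge0.
  rewrite mulrC ler_wpM2l //.
  have na := nP a oka.
  have ZE : Z a = (\sum_i w i * (J (a i))%:R) * d%:R / n a - W.
    have okE : ok a = true by [].
    rewrite /Z /X okE; under eq_bigr do rewrite mulrBr mulr1.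
    rewrite sumrB; congr (_ - _); rewrite !mulr_suml.
    by apply: eq_bigr => i _; rewrite !mulrA.
  have : (\sum_i w i * (J (a i))%:R) * d%:R / n a <= W / 2.
    rewrite ler_pdivrMr //; apply: le_trans (_ : nu * W / 2 * d%:R <= _).
      by rewrite ler_wpM2r // ltW.
    have -> : nu * W / 2 * d%:R = W / 2 * (nu * d%:R) by field.
    by rewrite ler_wpM2l // divr_ge0 // ltW.
  rewrite ZE; move: W0; clear; set x := _ / n a; move: x W => x W; nra.
have W2 : 0 < W ^+ 2 / 4 by rewrite divr_gt0 // exprn_gt0.
rewrite -(ler_pM2l W2); apply: le_trans step _; apply: le_trans EZ _.
by rewrite le_eqVlt; apply/orP; left; apply/eqP; field; rewrite !gt_eqF.
Qed.

End Chebyshev.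

Section Decay.
Context {R : realType} {d M : nat}.
Variable v : nvec d M -> R.
Hypothesis ev : exch v.
Let V := \sum_a v a.

(** Apart from two rare events, too few coordinates in [J] and the failure of [exch_chebyshev], the
    weighted count is at least [nu * W / 2] and the hypothesis makes [F] small. [Y] is a loss in the
    count that is small on average: where it exceeds half of the count, [F] is bounded by 1 and
    Markov's inequality applies. *)
Lemma exch_decay (J : pred nat) (w : 'I_d -> R) (nu eta c y : R) (F Y : nvec d M -> R) :
  (forall i, 0 <= w i <= 1) -> 0 < nu -> 0 < c -> 0 < \sum_i w i ->
  \sum_(a : nvec d M | \sum_i (J (a i))%:R < nu * d%:R) v a <= eta * V ->
  (forall a, F a <= 1) -> (forall a, 0 <= Y a) ->
  (forall a, Y a <= (\sum_i w i * (J (a i))%:R) / 2 ->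
     F a <= (1 + c * \sum_i w i * (J (a i))%:R)^-1) ->
  \sum_a v a * Y a <= y * V ->
  \sum_a v a * F a <=
    (eta + (4 + 2 / c + 4 * y) / (nu * \sum_i w i)) * V.
Proof.
move=> hw nu0 c0; set W := \sum_i w i => W0 heta F1 Y0 hF hY.
have v0 := exch_ge0 ev.
have V0 : 0 <= V by exact: sumr_ge0.
have nW0 : 0 < nu * W by rewrite mulr_gt0.
have cheb := exch_chebyshev ev J hw nu0 W0.
pose T (a : nvec d M) : R := \sum_i w i * (J (a i))%:R.
pose n (a : nvec d M) : R := \sum_i (J (a i))%:R.
rewrite -/W -/V in cheb; clearbody W.
pose Q := 2 / (c * (nu * W)).
have Q0 : 0 <= Q by rewrite divr_ge0 // mulr_ge0 // ltW.
have Z0 : 0 <= 4 / (nu * W) by rewrite divr_ge0 // ltW.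
have pt a : F a <= (n a < nu * d%:R)%R%:R
   + ((nu * d%:R <= n a) && (T a < nu * W / 2))%R%:R + Q + 4 / (nu * W) * Y a.
  have YZ : 0 <= 4 / (nu * W) * Y a by rewrite mulr_ge0.
  case: ltP => /= hn; first by have := F1 a; rewrite addr0; lra.
  case: ltP => /= hT; first by have := F1 a; rewrite add0r; lra.
  have [YT|TY] := leP (Y a) (T a / 2).
    apply: le_trans (hF a YT) _; rewrite -/(T a) !add0r.
    suff : (1 + c * T a)^-1 <= Q by lra.
    rewrite /Q -[2]invrK -invfM lef_pV2 ?posrE.
    - have : c * (nu * W / 2) <= c * T a by rewrite ler_pM2l.
      lra.
    - have : 0 <= c * T a by rewrite mulr_ge0 ?(ltW c0) // (le_trans _ hT) // divr_ge0 // ltW.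
      lra.
    - by rewrite mulr_gt0 ?invr_gt0 // mulr_gt0.
  apply: le_trans (F1 a) _.
  have : 1 <= 4 / (nu * W) * Y a.
    rewrite mulrAC ler_pdivlMr // mul1r; lra.
  lra.
apply: le_trans (_ : \sum_a v a * ((n a < nu * d%:R)%R%:R
   + ((nu * d%:R <= n a) && (T a < nu * W / 2))%R%:R + Q + 4 / (nu * W) * Y a) <= _).
  by apply: ler_sum => a _; rewrite ler_wpM2l.
have e1 : \sum_a v a * (n a < nu * d%:R)%R%:R <= eta * V.
  apply: le_trans heta; rewrite [leRHS]big_mkcond /=; apply: ler_sum => a _.
  by rewrite -/(n a); case: ltP => _; rewrite ?mulr1 ?mulr0.
have e2 : \sum_a v a * ((nu * d%:R <= n a) && (T a < nu * W / 2))%R%:R <= 4 / (nu * W) * V.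
  apply: le_trans cheb; rewrite [leRHS]big_mkcond /=; apply: ler_sum => a _.
  by rewrite -/(n a) -/(T a); case: ifP => _; rewrite ?mulr1 ?mulr0.
have e3 : \sum_a v a * (4 / (nu * W) * Y a) <= 4 / (nu * W) * (y * V).
  have -> : \sum_a v a * (4 / (nu * W) * Y a) = 4 / (nu * W) * \sum_a v a * Y a.
    by rewrite mulr_sumr; apply: eq_bigr => a _; rewrite mulrCA.
  by rewrite ler_wpM2l.
have -> : \sum_a v a * ((n a < nu * d%:R)%R%:R
   + ((nu * d%:R <= n a) && (T a < nu * W / 2))%R%:R + Q + 4 / (nu * W) * Y a) =
   \sum_a v a * (n a < nu * d%:R)%R%:R +
   \sum_a v a * ((nu * d%:R <= n a) && (T a < nu * W / 2))%R%:R + V * Q +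
   \sum_a v a * (4 / (nu * W) * Y a).
  rewrite (_ : V * Q = \sum_a v a * Q); last by rewrite mulr_suml.
  rewrite -!big_split /=. apply: eq_bigr => a _.
  by rewrite !mulrDr.
have -> : (eta + (4 + 2 / c + 4 * y) / (nu * W)) * V =
   eta * V + 4 / (nu * W) * V + V * Q + 4 / (nu * W) * (y * V).
  by rewrite /Q; field; rewrite !gt_eqF.
by rewrite !lerD.
Qed.

Definition pairsym (c : 'I_d -> nat -> R) (q : 'I_d * 'I_d) (a : nvec d M) : R :=
  (c q.1 (a q.1) * c q.2 (a q.2) + c q.1 (a q.2) * c q.2 (a q.1)) / 2.

(** A factor near -1 has modulus near 1, so absolute values alone give no decay. Averaging over the
    swap of its coordinate with that of a factor near 1 lets the two cancel; the pairs are disjoint,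
    so the swaps can be averaged one after another. *)
Lemma exch_pairsym (c : 'I_d -> nat -> R) (ps : seq ('I_d * 'I_d)) :
  uniq (unzip1 ps ++ unzip2 ps) ->
  \sum_a v a * \prod_i c i (a i) =
  \sum_a v a * (\prod_(q <- ps) pairsym c q a *
                \prod_(k | k \notin unzip1 ps ++ unzip2 ps) c k (a k)).
Proof.
elim: ps => [|[i j] ps IH] /=.
  by move=> _; apply: eq_bigr => a _; rewrite big_nil mul1r.
set rest := unzip1 ps ++ unzip2 ps.
have pr : perm_eq (i :: unzip1 ps ++ j :: unzip2 ps) (i :: j :: rest).
  by rewrite perm_cons -cat1s perm_catCA.
rewrite -[_ && _]/(uniq (i :: unzip1 ps ++ j :: unzip2 ps)) (perm_uniq pr) /= inE.
move=> /and3P[]; rewrite negb_or => /andP[ij iR] jR uR.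
rewrite IH //.
pose Y a := \prod_(q <- ps) pairsym c q a *
   \prod_(k | (k \notin rest) && (k != i) && (k != j)) c k (a k).
have Yt a : Y (nperm (tperm i j) a) = Y a.
  rewrite /Y; congr (_ * _).
    apply: eq_big_seq => q qps; rewrite /pairsym !ffunE.
    have q1 : q.1 \in rest by rewrite mem_cat map_f.
    have q2 : q.2 \in rest by rewrite mem_cat (map_f snd qps) orbT.
    have ne k : k \in rest -> tperm i j k = k.
      by move=> kR; rewrite tpermD //; apply: contraTneq kR => <-.
    by rewrite !ne.
  by apply: eq_bigr => k /andP[/andP[_ ki] kj]; rewrite ffunE tpermD // eq_sym.
have E1 a : \prod_(q <- ps) pairsym c q a * \prod_(k | k \notin rest) c k (a k) =
    Y a * (c i (a i) * c j (a j)).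
  rewrite (bigD1 i) //= (bigD1 j) /=; last by rewrite jR eq_sym.
  by rewrite /Y; ring.
have E2 : \sum_a v a * (Y a * (c i (a i) * c j (a j))) =
    \sum_a v a * (Y a * (c i (a j) * c j (a i))).
  rewrite (exch_sum _ (tperm i j) ev); apply: eq_bigr => a _.
  by rewrite Yt !ffunE tpermL tpermR.
transitivity (\sum_a v a * (Y a * (c i (a i) * c j (a j)))).
  by apply: eq_bigr => a _; congr (_ * _); exact: E1.
transitivity (\sum_a v a * (Y a * pairsym c (i, j) a)).
  have -> : \sum_a v a * (Y a * pairsym c (i, j) a) =
     (\sum_a v a * (Y a * (c i (a i) * c j (a j)))
      + \sum_a v a * (Y a * (c i (a j) * c j (a i)))) / 2.
    rewrite -big_split /= mulr_suml; apply: eq_bigr => a _.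
    by rewrite /pairsym /=; field.
  by rewrite -E2; field.
apply: eq_bigr => a _; rewrite big_cons /Y.
rewrite (eq_bigl (fun k => k \notin i :: unzip1 ps ++ j :: unzip2 ps)); first by ring.
move=> k; rewrite (perm_mem pr) !inE !negb_or.
by case: (k == i); case: (k == j); case: (k \in rest).
Qed.

End Decay.

(** * Smoothness of the level multipliers, and decay on sparse levels *)

Section LevelMultipliers.
Context {R : realType} {d M : nat}.
Variables (D : nat) (v : nvec d M -> R) (kappa : R) (t : 'I_d -> R).
Hypotheses (d_gt0 : (0 < d)%N) (ev : exch v).
Hypothesis (vD : forall a, nsum a != D -> v a = 0).
Hypothesis kappaE : kappa * d%:R = D%:R.
Implicit Types (a : nvec d M) (i j : 'I_d).

Let V := \sum_a v a.
Let v0 a : 0 <= v a. Proof. exact: exch_ge0. Qed.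
Let V0 : 0 <= V. Proof. exact: sumr_ge0. Qed.
Let d0 : 0 < d%:R :> R. Proof. by rewrite ltr0n. Qed.
Let S := \sum_i hsin2 (t i).

Definition cosmult a : R := \prod_i cos ((a i)%:R * t i).

Lemma cosmult_le1 a : `|cosmult a| <= 1.
Proof. by apply: norm_prod_le1 => i; exact: cos_max. Qed.

Lemma level_coord_sqr i : \sum_a v a * (a i)%:R ^+ 2 <= (4 * kappa ^+ 2 + kappa) * V.
Proof.
rewrite -(ler_pM2l d0) [leLHS](_ : _ = \sum_a v a * \sum_j (a j)%:R ^+ 2); last first.
  under [RHS]eq_bigr do rewrite mulr_sumr.
  rewrite [RHS]exchange_big /= [RHS](eq_bigr (fun=> \sum_a v a * (a i)%:R ^+ 2)).
    by rewrite sumr_const card_ord -[RHS]mulr_natl.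
  by move=> j _; exact: (@exch_coord _ _ _ v (fun x => x%:R ^+ 2)).
apply: le_trans (level_sqr d_gt0 ev vD kappaE) _.
by rewrite -/V le_eqVlt; apply/orP; left; apply/eqP; ring.
Qed.

Lemma level_smooth :
  \sum_a v a * (1 - cosmult a) <= 2 * (4 * kappa ^+ 2 + kappa) * S * V.
Proof.
apply: le_trans (_ : \sum_a v a * \sum_i (a i)%:R ^+ 2 * (2 * hsin2 (t i)) <= _).
  apply: ler_sum => a _; rewrite ler_wpM2l //.
  apply: le_trans (onesub_prod_le _ _) _.
    by move=> i; rewrite cos_geN1 cos_le1.
  by apply: ler_sum => i _; exact: onesub_cos_natmul.
under eq_bigr do rewrite mulr_sumr.
rewrite exchange_big /= [leRHS](_ : _ =
  \sum_i (4 * kappa ^+ 2 + kappa) * V * (2 * hsin2 (t i))).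
  apply: ler_sum => i _; under eq_bigr do rewrite mulrA.
  rewrite -mulr_suml ler_wpM2r ?level_coord_sqr // mulr_ge0 //; exact: hsin2_ge0.
by rewrite -mulr_sumr -mulr_sumr -/S; ring.
Qed.

(** [D] minus the number of ones is at most the sum of the [a i * (a i - 1)], whose mean is at most
    [4 * kappa * D]; Markov's inequality concludes. *)
Lemma level_ones : 0 < kappa ->
  \sum_(a : nvec d M | \sum_i (a i == 1 :> nat)%:R < kappa / 2 * d%:R) v a <= 8 * kappa * V.
Proof.
move=> k0.
have D0 : 0 < D%:R :> R by rewrite -kappaE mulr_gt0.
apply: le_trans (_ : \sum_a v a * (2 / D%:R * \sum_i ((a i)%:R * ((a i)%:R - 1))) <= _).
  have q0 a : 0 <= \sum_i ((a i)%:R * ((a i)%:R - 1)) :> R.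
    apply: sumr_ge0 => i _; case: (nat_of_ord (a i)) => [|n]; first by rewrite mul0r.
    by rewrite mulr_ge0 // subr_ge0 ler1n.
  rewrite big_mkcond /=; apply: ler_sum => a _; case: ifP => [h|_]; last first.
    by rewrite mulr_ge0 // mulr_ge0 // divr_ge0 // ltW.
  have [aD|aD] := eqVneq (nsum a) D; last by rewrite vD // mul0r.
  rewrite ler_peMr // mulrAC ler_pdivlMr // mul1r.
  have : \sum_i ((a i)%:R - (a i == 1 :> nat)%:R) <= \sum_i ((a i)%:R * ((a i)%:R - 1)) :> R.
    apply: ler_sum => i _; case: (nat_of_ord (a i)) => [|[|n]] /=.
    - by rewrite subr0 mul0r.
    - by rewrite !subrr mulr0.
    - rewrite subr0 ler_peMr // -natr1 addrK ler1n //.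
  move: h; rewrite sumrB -nsumR aD -kappaE mulrAC; lra.
have -> : \sum_a v a * (2 / D%:R * \sum_i ((a i)%:R * ((a i)%:R - 1))) =
   2 / D%:R * \sum_a v a * \sum_i ((a i)%:R * ((a i)%:R - 1)).
  by rewrite mulr_sumr; apply: eq_bigr => a _; rewrite mulrCA.
apply: le_trans (ler_wpM2l _ (level_ffactor2 d_gt0 ev vD kappaE)) _.
  by rewrite divr_ge0 // ltW.
rewrite -/V -kappaE le_eqVlt; apply/orP; left; apply/eqP.
by field; rewrite !gt_eqF.
Qed.

Let I1 := [pred i | 2^-1 < hsin2 (t i)].
Let I0 := [pred i | hsin2 (t i) <= 2^-1].

Let sum_le_abs (F : nvec d M -> R) : `|\sum_a v a * F a| <= \sum_a v a * `|F a|.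
Proof.
apply: le_trans (ler_norm_sum _ _ _) _; apply: ler_sum => a _.
by rewrite normrM ger0_norm.
Qed.

(** If [I0] carries half of [S], each coordinate of [I0] equal to 1 contributes a factor at most
    [1 - hsin2 (t i)]. Otherwise [I1] does: the cardinality hypothesis gives each of its indices its
    own partner in [I0], and at the values (1, 0) the symmetrised pair has modulus at most 1/2, as
    its two cosines have opposite signs. *)
Lemma level_decay_sparse : 0 < kappa -> 0 < S -> (#|I1| <= #|I0|)%N ->
  `|\sum_a v a * cosmult a| <= 48 * (kappa + (kappa * S)^-1) * V.
Proof.
move=> k0 S0 card10.
have kS0 : 0 < kappa * S by rewrite mulr_gt0.
have fin (W eta b : R) : S / 2 <= W -> eta <= 24 * kappa -> 0 <= b <= 12 ->
    (eta + b / (kappa / 2 * W)) * V <= 48 * (kappa + (kappa * S)^-1) * V.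
  move=> SW heta /andP[b0 b12]; rewrite ler_wpM2r //.
  have kW0 : 0 < kappa / 2 * W by rewrite mulr_gt0 ?divr_gt0 //; lra.
  have : b / (kappa / 2 * W) <= 48 * (kappa * S)^-1.
    rewrite ler_pdivrMr // mulrAC ler_pdivlMr //.
    have : kappa * (S / 2) <= kappa * W by rewrite ler_pM2l.
    have : b * (kappa * S) <= 12 * (kappa * S) by rewrite ler_pM2r.
    lra.
  lra.
pose J := [pred x : nat | x == 1%N].
have hones := level_ones k0.
have [caseA|caseB] := leP (S / 2) (\sum_(i in I0) hsin2 (t i)).
  pose w i := if i \in I0 then hsin2 (t i) else 0.
  have hw i : 0 <= w i <= 1.
    rewrite /w; case: ifP => _; last by rewrite lexx ler01.
    by rewrite hsin2_ge0 hsin2_le1.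
  have WE : \sum_i w i = \sum_(i in I0) hsin2 (t i) by rewrite [RHS]big_mkcond.
  apply: le_trans (sum_le_abs _) _.
  have := @exch_decay _ _ _ _ ev J w (kappa / 2) (8 * kappa) 1 0
     (fun a => `|cosmult a|) (fun=> 0) hw.
  rewrite WE; move=> /(_ _ _ _ hones) h; apply: le_trans (h _ _ _ _ _ _ _) _ => {h} //.
  - by rewrite divr_gt0.
  - lra.
  - by move=> a; exact: cosmult_le1.
  - move=> a _; apply: le_trans (_ : \prod_i (1 - w i * (J (a i))%:R) <= _).
      rewrite /cosmult normr_prod; apply: ler_prod => i _; rewrite normr_ge0 /=.
      rewrite /w; case: ifP => [iI|_]; last by rewrite mul0r subr0 cos_max.
      case: eqP => [->|_] /=; last by rewrite mulr0 subr0 cos_max.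
      rewrite mul1r mulr1; move: iI; rewrite inE.
      have := hsin2_ge0 (t i); have -> : cos (t i) = 1 - 2 * hsin2 (t i) by rewrite /hsin2; lra.
      move=> s0 s2; rewrite ger0_norm; lra.
    apply: le_trans (prod_onesub_le _ _) _; last by rewrite mul1r.
    move=> i; have /andP[w0 w1] := hw i.
    by case: (J (a i)); rewrite /= ?mulr1 ?mulr0 ?w0 ?w1 // lexx ler01.
  - by rewrite mul0r big1 // => a _; rewrite mulr0.
  - by apply: fin => //; lra.
pose ps := zip (enum I1) (take #|I1| (enum I0)).
have sz : size (enum I1) = size (take #|I1| (enum I0)).
  by rewrite size_take -!cardE; case: ltnP => // ?; apply/eqP; rewrite eqn_leq card10.
have u1 : unzip1 ps = enum I1 by rewrite unzip1_zip // sz.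
have u2 : unzip2 ps = take #|I1| (enum I0) by rewrite unzip2_zip // sz.
have u2I i : i \in unzip2 ps -> i \in I0 by rewrite u2 => /mem_take; rewrite mem_enum.
have un : uniq (unzip1 ps ++ unzip2 ps).
  rewrite cat_uniq {1}u1 enum_uniq /= {2}u2 take_uniq ?enum_uniq // andbT.
  apply/hasPn => i /u2I; rewrite u1 mem_enum !inE => h; by rewrite -leNgt.
pose c i (x : nat) : R := cos (x%:R * t i).
pose F a := \prod_(q <- ps) pairsym c q a *
  \prod_(k | k \notin unzip1 ps ++ unzip2 ps) c k (a k).
have -> : \sum_a v a * cosmult a = \sum_a v a * F a := exch_pairsym ev c un.
apply: le_trans (sum_le_abs _) _.
pose w i : R := (i \in I1)%:R.
have hw i : 0 <= w i <= 1 by rewrite /w; case: (_ \in _); rewrite ?lexx ?ler01.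
have WE : \sum_i w i = #|I1|%:R.
  have -> : #|I1| = (\sum_i (i \in I1))%N.
    by rewrite -sum1_card big_mkcond /=; apply: eq_bigr => i _; case: (i \in I1).
  by rewrite natr_sum.
have SW : S / 2 <= #|I1|%:R.
  have : S = \sum_(i in I0) hsin2 (t i) + \sum_(i in I1) hsin2 (t i).
    rewrite /S (bigID (mem I0)) /=; congr (_ + _); apply: eq_bigl => i.
    by rewrite !inE -ltNge.
  have : \sum_(i in I1) hsin2 (t i) <= \sum_(i in I1) 1.
    by apply: ler_sum => i _; exact: hsin2_le1.
  rewrite sumr_const => h1 h2; lra.
(* Bounds the number of pairs with [a q.1 = 1] whose partner is nonzero; its mean is of order
   [kappa ^+ 2] per pair by [level_prod2]. *)
pose Y a : R := \sum_(q <- ps) (a q.1)%:R * (a q.2)%:R.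
have sumw a : \sum_i w i * (J (a i))%:R = \sum_(q <- ps) (J (a q.1))%:R.
  rewrite -(big_map fst xpredT (fun i => (J (a i))%:R)) -/(unzip1 ps) u1 big_enum /=.
  rewrite [RHS]big_mkcond /=; apply: eq_bigr => i _.
  by rewrite /w; case: (_ \in _); rewrite ?mul1r ?mul0r.
have := @exch_decay _ _ _ _ ev J w (kappa / 2) (8 * kappa) 4^-1
    (2 * kappa ^+ 2 * #|I1|%:R) (fun a => `|F a|) Y hw.
rewrite WE; move=> /(_ _ _ _ hones) h; apply: le_trans (h _ _ _ _ _ _ _) _ => {h} //.
- by rewrite divr_gt0.
- lra.
- move=> a; rewrite /F normrM mulr_ile1 //; last exact: norm_prod_le1 (fun=> cos_max _).
  apply: norm_prod_le1 => q; rewrite /pairsym.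
  have n1 i j (x y : nat) : `|c i x * c j y| <= 1 by rewrite normrM mulr_ile1 // cos_max.
  rewrite normrM [ `|2^-1|]ger0_norm // ler_pdivrMr //.
  apply: le_trans (ler_normD _ _) _; have := n1 q.1 q.2 (a q.1) (a q.2).
  have := n1 q.1 q.2 (a q.2) (a q.1); lra.
- by move=> a; apply: sumr_ge0 => q _; rewrite mulr_ge0.
- move=> a hY.
  pose X q : R := ((a q.1 == 1%N :> nat) && (a q.2 == 0%N :> nat))%:R.
  have hX q : 0 <= X q / 2 <= 1 by rewrite /X; case: ((a q.1 == 1%N :> nat) && _) => /=; lra.
  apply: le_trans (_ : \prod_(q <- ps) (1 - X q / 2) <= _).
    rewrite /F normrM -[leRHS]mulr1; apply: ler_pM => //; last first.
      exact: norm_prod_le1 (fun=> cos_max _).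
    rewrite normr_prod big_seq [leRHS]big_seq; apply: ler_prod => q qps.
    rewrite normr_ge0 /= /X.
    have q1 : q.1 \in I1 by rewrite -mem_enum -u1 map_f.
    have q2 : q.2 \in I0 by apply: u2I; rewrite map_f.
    rewrite /pairsym /c normrM [ `|2^-1|]ger0_norm // ler_pdivrMr //.
    case: eqP => [->|_] /=; last first.
      apply: le_trans (ler_normD _ _) _; rewrite !normrM.
      have m1 (x y x' y' : R) : `|cos x| * `|cos y| + `|cos x'| * `|cos y'| <= 2.
        have : `|cos x| * `|cos y| <= 1 by rewrite mulr_ile1 // cos_max.
        have : `|cos x'| * `|cos y'| <= 1 by rewrite mulr_ile1 // cos_max.
        lra.
      by apply: le_trans (m1 _ _ _ _) _; lra.
    case: eqP => [->|_] /=; last first.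
      apply: le_trans (ler_normD _ _) _; rewrite !normrM.
      have m1 (x y x' y' : R) : `|cos x| * `|cos y| + `|cos x'| * `|cos y'| <= 2.
        have : `|cos x| * `|cos y| <= 1 by rewrite mulr_ile1 // cos_max.
        have : `|cos x'| * `|cos y'| <= 1 by rewrite mulr_ile1 // cos_max.
        lra.
      by apply: le_trans (m1 _ _ _ _) _; lra.
    rewrite !mul1r !mul0r cos0 mulr1 mul1r.
    have e i : cos (t i) = 1 - 2 * hsin2 (t i) by rewrite /hsin2; lra.
    move: q1 q2; rewrite !inE !e.
    have := hsin2_ge0 (t q.1); have := hsin2_le1 (t q.1).
    have := hsin2_ge0 (t q.2); have := hsin2_le1 (t q.2).
    move=> *; rewrite ler_norml; apply/andP; split; lra.
  apply: le_trans (prod_onesub_le _ hX) _.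
  have T0 : 0 <= \sum_i w i * (J (a i))%:R.
    by apply: sumr_ge0 => i _; rewrite mulr_ge0 //; case/andP: (hw i).
  have TX : \sum_i w i * (J (a i))%:R - Y a <= \sum_(q <- ps) X q.
    rewrite sumw /Y -sumrB; apply: ler_sum => q _; rewrite /X /J /=.
    case: eqP => [->|_] /=; last by rewrite sub0r oppr_le0 mulr_ge0.
    by case: (nat_of_ord (a q.2)) => [|n] /=; rewrite mul1r ?subr0 // subr_le0 ler1n.
  rewrite -mulr_suml lef_pV2 ?posrE; lra.
- have -> : \sum_a v a * Y a = \sum_(q <- ps) \sum_a v a * ((a q.1)%:R * (a q.2)%:R).
    rewrite exchange_big /=; apply: eq_bigr => a _; by rewrite /Y mulr_sumr.
  apply: le_trans (_ : \sum_(q <- ps) 2 * kappa ^+ 2 * V <= _).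
    rewrite big_seq [leRHS]big_seq; apply: ler_sum => q qps.
    apply: (level_prod2 d_gt0 ev vD kappaE).
    have q1 : q.1 \in I1 by rewrite -mem_enum -u1 map_f.
    have q2 : q.2 \in I0 by apply: u2I; rewrite map_f.
    by apply: contraTneq q1 => ->; move: q2; rewrite !inE -leNgt.
  rewrite big_const_seq count_predT iter_addr_0 size_zip -sz minnn -cardE.
  by rewrite -[_ *+ _]mulr_natr -/V le_eqVlt; apply/orP; left; apply/eqP; ring.
- have W0 : 0 < #|I1|%:R :> R by lra.
  have -> : (8 * kappa + (4 + 2 / 4^-1 + 4 * (2 * kappa ^+ 2 * #|I1|%:R)) /
      (kappa / 2 * #|I1|%:R)) * V = (24 * kappa + 12 / (kappa / 2 * #|I1|%:R)) * V.
    by field; rewrite !gt_eqF.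
  by apply: fin => //; lra.
Qed.

End LevelMultipliers.

Lemma sqrt_le_sqr {R : rcfType} (x q : R) : 0 <= x -> q <= x ^+ 2 -> Num.sqrt q <= x.
Proof. by move=> x0 h; rewrite -[leRHS](ger0_norm x0) -sqrtr_sqr ler_wsqrtr. Qed.

(** * Decay on levels with mean coordinate at least 1 *)

Section LargeLevels.
Context {R : realType} {d M : nat}.
Variables (D : nat) (v : nvec d M -> R) (kappa : R).
Hypotheses (d_gt0 : (0 < d)%N) (ev : exch v).
Hypothesis (vD : forall a, nsum a != D -> v a = 0).
Hypothesis kappaE : kappa * d%:R = D%:R.
Hypothesis kappa1 : 1 <= kappa.
Implicit Types (a : nvec d M) (i j : 'I_d).

Let V := \sum_a v a.
Let v0 a : 0 <= v a. Proof. exact: exch_ge0. Qed.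
Let V0 : 0 <= V. Proof. exact: sumr_ge0. Qed.
Let d0 : 0 < d%:R :> R. Proof. by rewrite ltr0n. Qed.
Let k0 : 0 < kappa. Proof. by apply: lt_le_trans kappa1. Qed.

(** The mean is [kappa], so at most a quarter of the coordinates exceed [4 * kappa]; if fewer than
    half are in the window, more than a quarter are below [delta * kappa], which is rare by
    [level_coord_small]. The term [kappa^-1] pays for rounding [delta * kappa] to an integer. *)
Lemma level_few_small (delta z : R) : 0 < delta -> 0 <= z ->
  delta + kappa^-1 <= z ^+ 2 ->
  \sum_(a : nvec d M |
     \sum_i ((delta * kappa <= (a i)%:R) && ((a i)%:R <= 4 * kappa))%R%:R < 2^-1 * d%:R :> R) v a
  <= 84 * z * V.
Proof.
move=> dl0 z0 hz; pose h := Num.truncn (delta * kappa).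
have dk0 : 0 <= delta * kappa by rewrite mulr_ge0 // ltW.
have /andP[h1 h2] : h%:R <= delta * kappa < h.+1%:R by exact: Num.Theory.truncn_itv.
have tail i : \sum_(a : nvec d M | (a i <= h)%N) v a <= 21 * z * V.
  apply: le_trans (level_coord_small d_gt0 ev vD kappaE h i kappa1) _.
  rewrite ler_wpM2r // ler_wpM2l // sqrt_le_sqr //.
  apply: le_trans hz; rewrite ler_pdivrMr // mulrDl mulVf ?gt_eqF // -[h.+1%:R]natr1; lra.
apply: le_trans (_ : \sum_a v a * (4 / d%:R * \sum_i (a i <= h)%N%:R) <= _); last first.
  have -> : \sum_a v a * (4 / d%:R * \sum_i (a i <= h)%N%:R) =
     4 / d%:R * \sum_i \sum_(a : nvec d M | (a i <= h)%N) v a.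
    under eq_bigr do rewrite mulrCA.
    rewrite -mulr_sumr; congr (_ * _); under eq_bigr do rewrite mulr_sumr.
    rewrite exchange_big /=; apply: eq_bigr => i _.
    rewrite [RHS]big_mkcond /=; apply: eq_bigr => a _.
    by case: leqP => _; rewrite ?mulr1 ?mulr0.
  rewrite mulrAC ler_pdivrMr //.
  apply: le_trans (_ : 4 * \sum_(i < d) 21 * z * V <= _).
    by rewrite ler_wpM2l // ler_sum.
  rewrite sumr_const card_ord -[_ *+ d]mulr_natl le_eqVlt; apply/orP; left; apply/eqP.
  by ring.
rewrite big_mkcond /=; apply: ler_sum => a _; case: ifP => [hn|_]; last first.
  by rewrite mulr_ge0 // mulr_ge0 ?sumr_ge0 // divr_ge0 // ltW.
have [aD|aD] := eqVneq (nsum a) D; last by rewrite vD // mul0r.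
rewrite ler_peMr // mulrAC ler_pdivlMr // mul1r.
have c1 : \sum_i (1 - (a i <= h)%N%:R - (a i)%:R / (4 * kappa)) <=
   \sum_i ((delta * kappa <= (a i)%:R) && ((a i)%:R <= 4 * kappa))%R%:R :> R.
  have k4 : 0 < 4 * kappa by rewrite mulr_gt0.
  apply: ler_sum => i _.
  have q0 : 0 <= (a i)%:R / (4 * kappa) by rewrite divr_ge0 // ltW.
  case: leqP => ah; first by case: (_ && _) => /=; lra.
  have -> : delta * kappa <= (a i)%:R.
    by apply: ltW; apply: lt_le_trans h2 _; rewrite ler_nat.
  case: (leP (a i)%:R (4 * kappa)) => /= a4; first by lra.
  have : 1 <= (a i)%:R / (4 * kappa) by rewrite ler_pdivlMr // mul1r; exact: ltW.
  lra.
move: c1; rewrite !sumrB -mulr_suml -nsumR aD -kappaE sumr_const card_ord => c1.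
have e : kappa * d%:R / (4 * kappa) = d%:R / 4 by field; rewrite gt_eqF.
by rewrite e in c1; lra.
Qed.

(** The last hypothesis keeps [a i * t i] in the range of [norm_cos_natmul_le] as long as
    [a i <= 4 * kappa]. With [delta = y ^- 2] the tail of small coordinates costs
    [sqrt delta = y^-1], while the weights [w i] add up to [y ^+ 4], so the product costs even less.
    This choice is the origin of the eighth roots. *)
Lemma level_decay_large (t : 'I_d -> R) (y : R) : 0 < y ->
  y ^+ 8 = kappa ^+ 2 * \sum_i hsin2 (t i) ->
  (forall i, 128 * kappa ^+ 2 * hsin2 (t i) <= 1) ->
  \sum_a v a * `|cosmult t a| <= 108 * (y^-1 + (Num.sqrt kappa)^-1) * V.
Proof.
move=> y0 yE ht; set S := \sum_i _ in yE.
have sk0 : 0 < Num.sqrt kappa by rewrite sqrtr_gt0.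
have iy0 : 0 < y^-1 by rewrite invr_gt0.
have ik0 : 0 < (Num.sqrt kappa)^-1 by rewrite invr_gt0.
have [y1|y1] := ltP y 1.
  apply: le_trans (_ : V <= _).
    by rewrite /V; apply: ler_sum => a _; rewrite ler_piMr // cosmult_le1.
  rewrite ler_peMl //; have : 1 <= y^-1 by rewrite invf_ge1 // ltW.
  lra.
have [delta dE] : exists x, x = (y^-1) ^+ 2 by eexists.
have dl0 : 0 < delta by rewrite dE exprn_gt0.
have dl1 : delta <= 1 by rewrite dE exprn_ile1 ?invf_le1 // ltW.
pose J (x : nat) := (delta * kappa <= x%:R) && (x%:R <= 4 * kappa).
pose w i := delta ^+ 2 * kappa ^+ 2 * hsin2 (t i).
have k2 : 0 <= kappa ^+ 2 by exact: sqr_ge0.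
have d2 : delta ^+ 2 <= 1 by rewrite exprn_ile1 // ltW.
have hw i : 0 <= w i <= 1.
  have s0 := hsin2_ge0 (t i); have q0 : 0 <= kappa ^+ 2 * hsin2 (t i) by rewrite mulr_ge0.
  rewrite /w -mulrA mulr_ge0 ?sqr_ge0 //=.
  have : delta ^+ 2 * (kappa ^+ 2 * hsin2 (t i)) <= kappa ^+ 2 * hsin2 (t i) by rewrite ler_piMl.
  have := ht i; rewrite -mulrA; lra.
have WE : \sum_i w i = y ^+ 4.
  rewrite /w -mulr_sumr -/S -mulrA -yE dE; field; by rewrite gt_eqF.
have few : \sum_(a : nvec d M | \sum_i (J (a i))%:R < 2^-1 * d%:R :> R) v a <=
    84 * (y^-1 + (Num.sqrt kappa)^-1) * V.
  have z0 : 0 <= y^-1 + (Num.sqrt kappa)^-1 by lra.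
  apply: (level_few_small dl0 z0).
  have : (Num.sqrt kappa)^-1 ^+ 2 = kappa^-1 by rewrite exprVn sqr_sqrtr // ltW.
  have : 0 <= y^-1 * (Num.sqrt kappa)^-1 by rewrite mulr_ge0 // ltW.
  rewrite sqrrD -dE; lra.
have := @exch_decay _ _ _ _ ev J w 2^-1 (84 * (y^-1 + (Num.sqrt kappa)^-1)) 4^-1 0
   (fun a => `|cosmult t a|) (fun=> 0) hw.
rewrite WE; move=> /(_ _ _ _ few) h; apply: le_trans (h _ _ _ _ _ _ _) _ => {h} //.
- by rewrite exprn_gt0.
- by move=> a; exact: cosmult_le1.
- move=> a _; apply: le_trans (_ : \prod_i (1 - w i * (J (a i))%:R / 4) <= _).
    rewrite /cosmult normr_prod; apply: ler_prod => i _; rewrite normr_ge0 /=.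
    rewrite /J; case: (boolP (_ && _)) => [/andP[j1 j2]|_] /=; last by rewrite mulr0 mul0r subr0 cos_max.
    rewrite mulr1; apply: norm_cos_natmul_le => //.
      apply: le_trans (ht i).
      have : (a i)%:R ^+ 2 <= (4 * kappa) ^+ 2 :> R by rewrite lerXn2r ?nnegrE // mulr_ge0 // ltW.
      rewrite exprMn => h.
      have : 4 * (a i)%:R ^+ 2 <= 128 * kappa ^+ 2 :> R by lra.
      by move=> h'; rewrite ler_wpM2r // hsin2_ge0.
    rewrite /w ler_wpM2r ?hsin2_ge0 // -exprMn lerXn2r ?nnegrE //.
    by rewrite mulr_ge0 // ltW.
  apply: le_trans (prod_onesub_le _ _) _.
    move=> i; have /andP[w0 w1] := hw i.
    by case: (J (a i)); rewrite /= ?mulr1 ?mulr0 ?mul0r ?lexx ?ler01 //; lra.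
  by rewrite -mulr_suml mulrC.
- by rewrite mul0r big1 // => a _; rewrite mulr0.
- rewrite ler_wpM2r //.
  have -> : (4 + 2 / 4^-1 + 4 * 0) / (2^-1 * y ^+ 4) = 24 * (y^-1 * y^-1 ^+ 3).
    by field; rewrite gt_eqF.
  have : y^-1 * y^-1 ^+ 3 <= y^-1.
    by rewrite ler_piMr ?(ltW iy0) // exprn_ile1 ?invf_le1 // ltW.
  lra.
Qed.

(** Split at [kappa / y ^+ 2]. Smaller values of the coordinate have mass of order [1 / y] by
    [level_coord_small]; above, the second member of the minimum is at most [y ^- 2], because
    [kappa * sqrt s = y ^+ 4]. *)
Lemma level_resample (s y : R) i : 0 < s <= 1 -> 0 < y -> y ^+ 8 = kappa ^+ 2 * s ->
  \sum_a v a * Num.min 1 ((2 * (a i)%:R + 1) * Num.sqrt s)^-1 <= 43 / y * V.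
Proof.
move=> /andP[s0 s1] y0 yE.
have rs0 : 0 < Num.sqrt s by rewrite sqrtr_gt0.
have iy0 : 0 < y^-1 by rewrite invr_gt0.
have [y1|y1] := ltP y 1.
  apply: le_trans (_ : V <= _).
    by rewrite /V; apply: ler_sum => a _; rewrite ler_piMr // ge_min lexx.
  by rewrite ler_peMl //; have : 1 <= y^-1; [rewrite invf_ge1 // ltW | lra].
have ks : kappa * Num.sqrt s = y ^+ 4.
  apply/eqP; rewrite -(@eqrXn2 _ 2) ?mulr_ge0 ?exprn_ge0 //; try exact: ltW.
  by rewrite exprMn sqr_sqrtr ?(ltW s0) // -yE -exprM.
have yk : y ^+ 2 <= kappa.
  apply: le_trans (_ : y ^+ 4 <= _); first exact: ler_weXn2l.
  rewrite -ks ler_piMr // ?(ltW k0) // sqrt_le_sqr // expr1n //.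
have y20 : 0 < y ^+ 2 by rewrite exprn_gt0.
have [x xE] : exists x, x = kappa / y ^+ 2 by eexists.
have x1 : 1 <= x by rewrite xE ler_pdivlMr // mul1r.
pose h := Num.truncn x.
have /andP[h1 h2] : h%:R <= x < h.+1%:R by apply: Num.Theory.truncn_itv; lra.
have hx : h.+1%:R <= 2 * x by rewrite -natr1; lra.
have pt a : Num.min 1 ((2 * (a i)%:R + 1) * Num.sqrt s)^-1 <= (a i <= h)%N%:R + y^-1 ^+ 2.
  have q0 : 0 <= y^-1 ^+ 2 by exact: sqr_ge0.
  case: leqP => /= ah; first by rewrite ge_min lerDl q0.
  rewrite add0r ge_min; apply/orP; right.
  rewrite exprVn lef_pV2 ?posrE //; last first.
    by rewrite mulr_gt0 // ltr_pwDr // mulr_ge0.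
  have xa : x <= (a i)%:R by apply: ltW; apply: lt_le_trans h2 _; rewrite ler_nat.
  have : x * Num.sqrt s = y ^+ 2 by rewrite xE mulrAC ks; field; rewrite gt_eqF.
  have a0 : 0 <= (a i)%:R :> R by [].
  move=> <-; rewrite ler_pM2r //; lra.
apply: le_trans (_ : \sum_a (v a * (a i <= h)%N%:R + v a * y^-1 ^+ 2) <= _).
  by apply: ler_sum => a _; rewrite -mulrDr ler_wpM2l.
rewrite big_split /= -mulr_suml -/V.
have e1 : \sum_a v a * (a i <= h)%N%:R <= 42 * y^-1 * V.
  rewrite (_ : \sum_a _ = \sum_(a : nvec d M | (a i <= h)%N) v a); last first.
    by rewrite [RHS]big_mkcond /=; apply: eq_bigr => a _; case: leqP; rewrite ?mulr1 ?mulr0.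
  apply: le_trans (level_coord_small d_gt0 ev vD kappaE h i kappa1) _.
  rewrite ler_wpM2r // (_ : 42 * y^-1 = 21 * (2 * y^-1)); last by ring.
  rewrite ler_wpM2l // sqrt_le_sqr //; first by rewrite mulr_ge0 // ltW.
  rewrite ler_pdivrMr //; apply: le_trans hx _.
  rewrite xE exprMn exprVn [leRHS](_ : _ = 4 * (kappa / y ^+ 2)); last by field; rewrite gt_eqF.
  have : 0 <= kappa / y ^+ 2 by rewrite divr_ge0 // ltW.
  lra.
have e2 : V * y^-1 ^+ 2 <= y^-1 * V.
  rewrite mulrC ler_wpM2r // expr2 ler_piMr ?(ltW iy0) // invf_le1 //.
lra.
Qed.

End LargeLevels.

(** * Downward closed symmetric sets *)

Section DownSets.
Context {d M : nat}.
Implicit Types (S : pred (nvec d M)) (a b : nvec d M) (i j : 'I_d).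

Record downsym S : Prop := Downsym {
  ds_ex : exists a, S a;
  ds_perm : forall (s : 'S_d) a, S a -> S (nperm s a);
  ds_down : forall a b, S a -> (forall i, (b i <= a i)%N) -> S b;
  ds_xfer : forall i j t a, i != j -> (a i + t <= a j)%N -> S a -> S (xfer i j t a) }.

Definition nmax S := (\max_(a | S a) nsum a)%N.

Lemma nsum_xfer i j t a : i != j -> (a i + t <= a j)%N -> nsum (xfer i j t a) = nsum a.
Proof.
move=> ij h; rewrite /nsum (bigD1 i) //= [RHS](bigD1 i) //=.
rewrite (bigD1 j) 1?eq_sym //= [in RHS](bigD1 j) 1?eq_sym //=.
rewrite xferl // xferr // !addnA; congr addn; first by lia.
by apply: eq_bigr => k /andP[ki kj]; rewrite xfero.
Qed.

Lemma nsum_le_nmax S a : S a -> (nsum a <= nmax S)%N.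
Proof. by move=> Sa; apply: (leq_bigmax_cond (F := @nsum d M)). Qed.

(** Take a point of maximal sum with the least sum of squares: moving one unit across a gap of 2 or
    more would lower the squares. *)
Lemma ds_flat S : downsym S -> exists a, [/\ S a, nsum a = nmax S &
  forall i j, (a j <= (a i).+1)%N].
Proof.
move=> dS; have [a0 Sa0] := ds_ex dS.
have [a1 Sa1 e1] : {a1 | a1 \in S & nmax S = nsum a1}.
  by apply: eq_bigmax_cond; apply/card_gt0P; exists a0.
pose P := [pred a | S a && (nsum a == nmax S)].
have Pa1 : P a1 by rewrite /= e1 eqxx andbT.
case: (arg_minnP (fun a => \sum_i (a i) ^ 2)%N Pa1) => a /andP[Sa /eqP na] amin.
exists a; split => // i j.
have [->|ij] := eqVneq i j; first exact: leqnSn.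
rewrite leqNgt; apply/negP => h.
have hx : (a i + 1 <= a j)%N by rewrite addn1 ltnW.
have := amin (xfer i j 1 a); rewrite /= (ds_xfer dS) // nsum_xfer // na eqxx => /(_ isT).
have sq (b : nvec d M) : (\sum_k (b k) ^ 2 = b i ^ 2 + (b j ^ 2 +
    \sum_(k | (k != i) && (k != j)) (b k) ^ 2))%N.
  by rewrite (bigD1 i) //= (bigD1 j) // eq_sym.
have eo : (\sum_(k | (k != i) && (k != j)) (xfer i j 1 a k) ^ 2 =
    \sum_(k | (k != i) && (k != j)) (a k) ^ 2)%N.
  by apply: eq_bigr => k /andP[ki kj]; rewrite xfero.
rewrite !sq eo xferl // xferr //.
set x := (\sum_(k | _) _)%N; rewrite !addnA leq_add2r.
have [y ye] : exists y, (a j = a i + y.+2 :> nat)%N 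
  by exists (a j - (a i).+2)%N; rewrite -!addSnnS subnKC.
rewrite ye; set z := nat_of_ord (a i).
have -> : (z + y.+2 - 1 = z + y.+1)%N by rewrite addnS subn1.
by rewrite -!mulnn; move: z y {ye} => z y; nia.
Qed.

Lemma perm_of_card (A B : {set 'I_d}) : #|A| = #|B| ->
  exists s : 'S_d, forall i, (s i \in B) = (i \in A).
Proof.
move=> AB.
pose f (A : {set 'I_d}) : d.-tuple bool := [tuple i \in A | i < d].
have cf (X : {set 'I_d}) : count id (f X) = #|X|.
  by rewrite count_map -sum1_count big_enum_cond /= sum1_card cardE; apply: congr1; apply: eq_enum => i.
have : perm_eq (f A) (f B).
  have cpl (X : {set 'I_d}) : count (predC id) (f X) = (d - #|X|)%N.
    have e : (#|X| + count (predC id) (f X))%N = d by rewrite -cf count_predC size_tuple.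
    by apply: (@addnI #|X|); rewrite e subnKC // -[X in (_ <= X)%N]card_ord max_card.
  apply/allP => -[] _ /=; rewrite -!cf in AB.
    by apply/eqP; rewrite !(eq_count (a2 := id)) // => -[].
  apply/eqP; rewrite !(eq_count (a1 := pred1 false) (a2 := predC id)); try by case.
  by rewrite !cpl -!cf AB.
move/tuple_permP => [p pE]; exists p => i.
have := congr1 (fun s => nth false s i) pE.
by rewrite -!tnth_nth !tnth_mktuple.
Qed.

Lemma expn_le_binomial n k : (k <= n)%N -> (n ^ k <= k ^ k * 'C(n, k))%N.
Proof.
elim: k n => [|k IH] [|n] // kn.
have h := IH n kn.
have [->|k0] := posnP k; first by rewrite bin1 !expn1 mul1n.
have : (n.+1 ^ k <= k.+1 ^ k * 'C(n, k))%N.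
  have kk : (0 < k ^ k)%N by rewrite expn_gt0 k0.
  rewrite -(leq_pmul2l kk) -expnMn.
  apply: (@leq_trans ((k.+1 * n) ^ k)); first by rewrite leq_exp2r //; nia.
  by rewrite expnMn mulnCA leq_mul2l h orbT.
move=> h2.
have -> : (k.+1 ^ k.+1 * 'C(n.+1, k.+1) = n.+1 * (k.+1 ^ k * 'C(n, k)))%N.
  by rewrite [RHS]mulnCA (mul_bin_diag n.+1 k) [RHS]mulnCA mulnA -expnS.
by rewrite expnS leq_mul2l h2 orbT.
Qed.

End DownSets.

Lemma sgnw_xfer {R : realType} (x y t : nat) : (x + t <= y)%N ->
  sgnw x * sgnw y <= sgnw (x + t) * sgnw (y - t) :> R.
Proof.
case: t => [|t] h; first by rewrite addn0 subn0.
have xy : (x < y - t)%N by lia.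
rewrite /sgnw addnS /=; have -> : (y == 0%N) = false by case: (y) h => //; rewrite addnS.
by case: eqP => x0; case: eqP => y0; try lra; lia.
Qed.

(** * Counting lattice points, and concentration near the top level *)

Section Weights.
Context {R : realType} {d M : nat}.
Variable S : pred (nvec d M).
Hypotheses (d_gt0 : (0 < d)%N) (dS : downsym S).
Implicit Types (a b : nvec d M) (i j : 'I_d).

Definition signs a : R := \prod_i sgnw (a i).
(** The number of lattice points with absolute values [a] in the sign-symmetric set whose
    nonnegative part is [S]. *)
Definition om a : R := (S a)%:R * signs a.
Definition level (D : nat) a : R := om a * (nsum a == D)%:R.
Let Om := \sum_a om a.
Variable N : nat.
Hypothesis NE : nmax S = N.
Let d0 : 0 < d%:R :> R. Proof. by rewrite ltr0n. Qed.

Lemma sgnw_ge0 (n : nat) : 0 <= sgnw n :> R.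
Proof. exact: le_trans (sgnw_ge1 n). Qed.

Lemma signs_ge1 a : 1 <= signs a.
Proof.
rewrite /signs; elim/big_ind: _ => // [x y x1 y1|i _]; last exact: sgnw_ge1.
by rewrite mulr_ege1.
Qed.

Lemma signs_ge0 a : 0 <= signs a. Proof. exact: le_trans (signs_ge1 a). Qed.

Lemma om_ge0 a : 0 <= om a. Proof. by rewrite mulr_ge0 ?signs_ge0. Qed.

Lemma om_eq0 a : ~~ S a -> om a = 0.
Proof. by rewrite /om => /negbTE ->; rewrite mul0r. Qed.

Lemma Om_ge0 : 0 <= Om. Proof. by apply: sumr_ge0 => a _; exact: om_ge0. Qed.

Lemma signs_xfer i j t a : i != j -> (a i + t <= a j)%N ->
  signs a <= signs (xfer i j t a).
Proof.
move=> ij h; rewrite /signs (bigD1 i) //= [leRHS](bigD1 i) //=.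
rewrite (bigD1 j) 1?eq_sym //= [in leRHS](bigD1 j) 1?eq_sym //=.
rewrite (@eq_bigr _ _ _ _ _ _ (fun k => sgnw (xfer i j t a k)) (fun k => sgnw (a k))); last first.
  by move=> k /andP[ki kj]; rewrite xfero.
rewrite !mulrA ler_wpM2r //; first by apply: prodr_ge0 => k _; exact: sgnw_ge0.
by rewrite xferl // xferr // sgnw_xfer.
Qed.

Lemma level_exch D : exch (level D).
Proof using dS.
split=> [a|s a|i j t a ij h].
- by rewrite mulr_ge0 ?om_ge0.
- rewrite /level nsum_nperm /om /signs; congr (_ * _ * _).
    suff -> : S (nperm s a) = S a by [].
    apply/idP/idP => [h|]; last exact: (ds_perm dS).
    rewrite (_ : a = nperm s^-1%g (nperm s a)); first exact: (ds_perm dS).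
    by apply/ffunP => k; rewrite !ffunE permKV.
  rewrite [RHS](reindex_inj (@perm_inj _ s)) /=.
  by apply: eq_bigr => i _; rewrite ffunE.
- rewrite /level nsum_xfer // ler_wpM2r // /om.
  case Sa : (S a); last by rewrite mul0r mulr_ge0 ?signs_ge0.
  by rewrite (ds_xfer dS) // !mul1r signs_xfer.
Qed.

Lemma level_out D a : nsum a != D -> level D a = 0.
Proof. by rewrite /level => /negbTE ->; rewrite mulr0. Qed.

Lemma sum_level (F : nat -> nvec d M -> R) :
  \sum_a om a * F (nsum a) a = \sum_(D < (nmax S).+1) \sum_a level D a * F D a.
Proof.
rewrite exchange_big /=; apply: eq_bigr => a _.
have [Sa|Sa] := boolP (S a); last first.
  rewrite om_eq0 // mul0r big1 // => D _; by rewrite /level om_eq0 // !mul0r.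
have lt : (nsum a < (nmax S).+1)%N by rewrite ltnS nsum_le_nmax.
rewrite (bigD1 (Ordinal lt)) //= big1 ?addr0; first by rewrite /level eqxx mulr1.
by move=> D; rewrite -val_eqE /= eq_sym => h; rewrite level_out // mul0r.
Qed.

(* Markov bound for the generating function sum_a signs(a) z^|a|, a product of d
   geometric series. *)
Lemma signs_count (z K : R) (P : pred (nvec d M)) : 0 < z < 1 -> 0 <= K ->
  (forall a, P a -> 1 <= K * z ^+ nsum a) ->
  \sum_(a | P a) signs a <= K * ((1 + z) / (1 - z)) ^+ d.
Proof.
move=> /andP[z0 z1] K0 hP.
apply: le_trans (_ : \sum_a K * (signs a * z ^+ nsum a) <= _).
  rewrite big_mkcond /=; apply: ler_sum => a _; case: ifP => [Pa|_].
    by rewrite mulrCA ler_peMr ?signs_ge0 // hP.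
  by rewrite !mulr_ge0 ?signs_ge0 // exprn_ge0 // ltW.
rewrite -mulr_sumr ler_wpM2l //.
have -> : \sum_a signs a * z ^+ nsum a =
     \sum_(a : nvec d M) \prod_i (sgnw (a i) * z ^+ a i).
  by apply: eq_bigr => a _; rewrite big_split /= prodrXr.
rewrite -(bigA_distr_bigA (fun (i : 'I_d) (x : 'I_M.+1) => sgnw x * z ^+ x)) /=.
rewrite prodr_const card_ord lerXn2r ?nnegrE //.
- by apply: sumr_ge0 => x _; rewrite mulr_ge0 ?sgnw_ge0 // exprn_ge0 // ltW.
- by rewrite divr_ge0 //; lra.
- elim: M => [|m IH].
    rewrite big_ord1 /sgnw /= mul1r ler_pdivlMr; lra.
  suff H n : \sum_(x < n.+1) sgnw x * z ^+ x = (1 + z) / (1 - z) - 2 * z ^+ n.+1 / (1 - z).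
    rewrite H lerBlDr lerDl divr_ge0 //; last by lra.
    by rewrite mulr_ge0 // exprn_ge0 // ltW.
  have nz : 1 - z != 0 by rewrite gt_eqF //; lra.
  elim: n {IH} => [|n IH]; first by rewrite big_ord1 /sgnw /= expr1; field.
  by rewrite big_ord_recr /= IH /sgnw /= !exprS; field.
Qed.

(** A flat top point has coordinates at most 1, so the set contains all sign changes of the 0-1
    vectors with [N] ones, at least [(2 * d / N) ^ N] points. The points of sum at most [N / 6]
    number at most about [(d / N) ^ (N / 3) * 2 ^ N], and [d / N >= 16] makes the quotient at most
    [2 ^- N]. *)
Lemma level_tail_small : (16 * N <= d)%N ->
  \sum_(a : nvec d M | (6 * nsum a <= N)%N) om a <= 2 ^- N * Om.
Proof.
move=> Nd; have [N0|N0] := posnP N.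
  rewrite N0 expr0 invr1 mul1r /Om [leRHS](bigID (fun a : nvec d M => (6 * nsum a <= 0)%N)) /=.
  by rewrite lerDl sumr_ge0 // => a _; exact: om_ge0.
have NR : 0 < N%:R :> R by rewrite ltr0n.
have [q qE] : exists q : R, q = d%:R / N%:R by eexists.
have q16 : 16 <= q.
  rewrite qE ler_pdivlMr //.
  by have : (16 * N)%:R <= d%:R :> R; [rewrite ler_nat | rewrite natrM].
have q0 : 0 < q by lra.
pose m := (N %/ 3)%N.
have up : \sum_(a : nvec d M | (6 * nsum a <= N)%N) om a <= q ^+ m * 2 ^+ N.
  have z0 : 0 < (8 * q)^-1 by rewrite invr_gt0 mulr_gt0.
  have z1 : (8 * q)^-1 <= 8^-1 by rewrite lef_pV2 ?posrE //; lra.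
  apply: le_trans (_ : \sum_(a : nvec d M | (6 * nsum a <= N)%N) signs a <= _).
    by apply: ler_sum => a _; rewrite /om; case: (S a); rewrite ?mul1r // mul0r signs_ge0.
  (* With this [z] one has [d * z = N / 8], so the [d] geometric series cost at most exp(4 d z) =
     exp(N / 2), hence at most [2 ^ N]. *)
  apply: le_trans (@signs_count (8 * q)^-1 (q ^+ m) _ _ _ _) _.
  - by rewrite z0 /=; lra.
  - by rewrite exprn_ge0 // ltW.
  - move=> a ha; rewrite exprVn ler_pdivlMr ?exprn_gt0 ?mulr_gt0 // mul1r.
    apply: le_trans (_ : (q ^+ 2) ^+ nsum a <= _).
      by rewrite lerXn2r ?nnegrE ?exprn_ge0 ?mulr_ge0 ?(ltW q0) // expr2 ler_wpM2r ?(ltW q0) //; lra.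
    rewrite -exprM; apply: ler_weXn2l; first by lra.
    by rewrite /m leq_divRL //; lia.
  - rewrite ler_wpM2l ?exprn_ge0 ?(ltW q0) //.
    set z := (8 * q)^-1 in z0 z1 *.
    apply: le_trans (_ : (expR (4 * z)) ^+ d <= _).
      rewrite lerXn2r ?nnegrE ?expR_ge0 //; first by rewrite divr_ge0 //; lra.
      apply: le_trans (expR_ge1Dx _); rewrite ler_pdivrMr; last by lra.
      have : z * z <= 8^-1 * z by rewrite ler_wpM2r // ltW.
      lra.
    have e2 : expR (2^-1) <= 2 :> R.
      have : 1 + - 2^-1 <= expR (- 2^-1) :> R by exact: expR_ge1Dx.
      rewrite expRN => h; rewrite -[leRHS]invrK -[leLHS]invrK lef_pV2 ?posrE ?invr_gt0 ?expR_gt0 //.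
      lra.
    rewrite -expRM_natl (_ : d%:R * (4 * z) = N%:R * 2^-1); last first.
      by rewrite /z qE; field; rewrite !gt_eqF.
    by rewrite expRM_natl lerXn2r ?nnegrE ?expR_ge0.
have low : q ^+ N * 2 ^+ N <= Om.
  have [a [Sa na aflat]] := ds_flat dS.
  have dN : (N < d)%N by lia.
  have a1 i : (a i <= 1)%N.
    rewrite leqNgt; apply/negP => ai.
    have : (\sum_(j < d) 1 <= nsum a)%N.
      by apply: leq_sum => j _; have := aflat j i; lia.
    by rewrite sum_nat_const card_ord muln1 na NE leqNgt dN.
  pose A0 := [set i | a i == 1 :> nat]%SET.
  have aE i : a i = (i \in A0) :> nat.
    by rewrite inE; move: (a1 i); case: (nat_of_ord (a i)) => [|[|n]].
  have cA0 : #|A0| = N.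
    rewrite -NE -na /nsum (eq_bigr (fun i => (i \in A0) : nat)) // -sum1_card big_mkcond /=.
    by apply: eq_bigr => i _; case: (_ \in _).
  have M0 : (0 < M)%N.
    have [i iA] : exists i, i \in A0 by apply/card_gt0P; rewrite cA0.
    by have := ltn_ord (a i); rewrite aE iA.
  pose ind (A : {set 'I_d}) : nvec d M := [ffun i => inord (i \in A)].
  have indE A i : ind A i = (i \in A) :> nat.
    by rewrite ffunE inordK //; case: (_ \in _).
  have ind_inj : injective ind.
    move=> A B AB; apply/setP => i; have := congr1 (fun b : nvec d M => b i : nat) AB.
    by rewrite /= !indE; case: (_ \in _); case: (_ \in _).
  apply: le_trans (_ : \sum_(A : {set 'I_d} | #|A| == N) 2 ^+ N <= _).
    rewrite sumr_const (_ : #|_| = 'C(d, N)); last first.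
      by rewrite -[d in RHS]card_ord -card_draws; apply: eq_card => A; rewrite !inE.
    rewrite -[leRHS]mulr_natl ler_wpM2r ?exprn_ge0 // qE expr_div_n.
    rewrite ler_pdivrMr ?exprn_gt0 // mulrC -!natrX -natrM ler_nat.
    by rewrite expn_le_binomial // ltnW.
  apply: le_trans (_ : \sum_(A : {set 'I_d} | #|A| == N) om (ind A) <= _).
    apply: ler_sum => A /eqP cA.
    have [s sE] : exists s : 'S_d, forall i, (s i \in A0) = (i \in A).
      by apply: perm_of_card; rewrite cA.
    have Si : S (ind A).
      rewrite (_ : ind A = nperm s a); first exact: (ds_perm dS).
      by apply/ffunP => i; apply/val_inj; rewrite /= indE ffunE aE sE.
    rewrite /om Si mul1r /signs (bigID (mem A)) /= [X in _ * X]big1 ?mulr1; last first.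
      by move=> i iA; rewrite indE (negbTE iA).
    rewrite (eq_bigr (fun=> 2)) ?prodr_const ?cA // => i iA.
    by rewrite indE iA.
  rewrite -(big_imset om (in2W ind_inj)) /Om /=.
  rewrite [leRHS](bigID (mem [set ind A | A in [pred A : {set 'I_d} | #|A| == N]]%SET)) /=.
  by rewrite lerDl sumr_ge0 // => b _; exact: om_ge0.
have key : q ^+ m * 2 ^+ N <= q ^+ N.
  have -> : q ^+ N = q ^+ m * q ^+ (N - m) by rewrite -exprD subnKC // leq_div.
  rewrite ler_wpM2l ?exprn_ge0 ?(ltW q0) //.
  apply: le_trans (_ : (2 ^+ 4) ^+ (N - m) <= _); last first.
    by rewrite lerXn2r ?nnegrE ?exprn_ge0 ?(ltW q0) // (le_trans _ q16) // -natrX ler_nat.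
  rewrite -[(2 ^+ 4) ^+ _]exprM; apply: ler_weXn2l; first by rewrite ler1n.
  rewrite /m; lia.
apply: le_trans up _; rewrite [leRHS]mulrC ler_pdivlMr ?exprn_gt0 //.
by apply: le_trans low; rewrite ler_wpM2r ?exprn_ge0.
Qed.

(** All coordinates of the flat top point are at least [N %/ d], so downward closure gives a full
    box with [N %/ d + 1] values in each coordinate. *)
Lemma Om_lower : (N%:R / d%:R) ^+ d <= Om.
Proof.
pose l := (N %/ d)%N.
have [a [Sa na aflat]] := ds_flat dS.
have la i : (l <= a i)%N.
  rewrite leqNgt; apply/negP => ai.
  have h : (nsum a <= \sum_(j < d) l)%N by apply: leq_sum => j _; have := aflat i j; lia.
  have h2 : (nsum a < d * l)%N.
    rewrite /nsum (bigD1 i) //=; apply: (@leq_trans (l + \sum_(j < d | j != i) l)).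
      rewrite -addSn; apply: leq_add => //; apply: leq_sum => j _.
      by have := aflat i j; lia.
    by rewrite sum_nat_const cardC1 card_ord -mulSn prednK.
  by move: h2; rewrite na NE mulnC ltnNge leq_trunc_div.
have lM : (l < M.+1)%N by apply: leq_ltn_trans (la (Ordinal d_gt0)) (ltn_ord _).
pose B := [pred x : 'I_M.+1 | (x <= l)%N].
have cB : #|B| = l.+1.
  rewrite -sum1_card; transitivity (\sum_(i < l.+1) 1)%N; last by rewrite sum1_card card_ord.
  by rewrite (big_ord_widen M.+1 (fun=> 1%N) lM); apply: eq_bigl => i; rewrite inE ltnS.
apply: le_trans (_ : l.+1%:R ^+ d <= _).
  rewrite lerXn2r ?nnegrE // ?divr_ge0 //.
  rewrite ler_pdivrMr // -natrM ler_nat ltnW //; exact: ltn_ceil.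
rewrite -natrX -[d in (_ ^ d)%N]card_ord -cB -card_ffun_on -sum1_card natr_sum.
rewrite /Om [leRHS](bigID (mem (ffun_on B))) /= -[leLHS]addr0; apply: lerD.
  apply: ler_sum => b /ffun_onP bB; rewrite /om (ds_down dS Sa) ?mul1r ?signs_ge1 //.
  by move=> i; have := bB i; rewrite inE => h; exact: leq_trans h (la i).
by apply: sumr_ge0 => b _; exact: om_ge0.
Qed.

(** At [z = 1 - 1 / (2 * u)] the generating function bounds the points of sum at most [u * d] by
    [(8 * u) ^ d], which is [x ^ d] times the bound of [Om_lower]. For [x < 1] one factor [x] is
    kept; for [x >= 1] the claim is trivial. *)
Lemma level_tail_large (u : nat) : (0 < u)%N -> (0 < N)%N ->
  \sum_(a : nvec d M | (nsum a <= u * d)%N) om a <= (8 * u%:R * d%:R / N%:R) * Om.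
Proof.
move=> u0 N0; have NR : 0 < N%:R :> R by rewrite ltr0n.
have uR : 1 <= u%:R :> R by rewrite ler1n.
have [x xE] : exists x : R, x = 8 * u%:R * d%:R / N%:R by eexists.
have x0 : 0 < x by rewrite xE divr_gt0 // mulr_gt0 // mulr_gt0 // ltr0n.
rewrite -xE; have [x1|x1] := leP 1 x.
  apply: le_trans (_ : Om <= _); last by rewrite ler_peMl // Om_ge0.
  rewrite /Om [leRHS](bigID (fun a : nvec d M => (nsum a <= u * d)%N)) /=.
  by rewrite lerDl sumr_ge0 // => a _; exact: om_ge0.
apply: le_trans (_ : (8 * u%:R) ^+ d <= _); last first.
  have -> : 8 * u%:R = x * (N%:R / d%:R) by rewrite xE; field; rewrite !gt_eqF.
  rewrite exprMn; apply: ler_pM; rewrite ?Om_lower // ?exprn_ge0 ?(ltW x0) // ?divr_ge0 //.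
  rewrite -[X in _ ^+ X](prednK d_gt0) exprS ler_piMr ?(ltW x0) //.
  by rewrite exprn_ile1 // ltW.
apply: le_trans (_ : \sum_(a : nvec d M | (nsum a <= u * d)%N) signs a <= _).
  by apply: ler_sum => a _; rewrite /om; case: (S a); rewrite ?mul1r // mul0r signs_ge0.
pose z : R := 1 - (2 * u%:R)^-1.
have u2 : 0 < 2 * u%:R :> R by lra.
have iu0 : (0 : R) < (2 * u%:R)^-1 by rewrite invr_gt0.
have iu1 : (2 * u%:R)^-1 <= 2^-1 :> R by rewrite lef_pV2 ?posrE //; lra.
have zu : 2^-1 <= z ^+ u.
  have bern n : 1 - n%:R * (2 * u%:R)^-1 <= z ^+ n.
    elim: n => [|n IH]; first by rewrite mul0r subr0 expr0.
    rewrite exprS -natr1; apply: le_trans (_ : z * (1 - n%:R * (2 * u%:R)^-1) <= _).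
      rewrite /z -subr_ge0 [leRHS](_ : _ = n%:R * (2 * u%:R)^-1 ^+ 2); last by ring.
      by rewrite mulr_ge0 // sqr_ge0.
    by rewrite ler_wpM2l // /z; lra.
  apply: le_trans (bern u); rewrite (_ : u%:R * _ = 2^-1); first by lra.
  by field; rewrite gt_eqF //; lra.
apply: le_trans (@signs_count z (2 ^+ d) _ _ _ _) _.
- by rewrite /z; lra.
- by rewrite exprn_ge0.
- move=> a ha; apply: le_trans (_ : 2 ^+ d * z ^+ (u * d) <= _).
    rewrite exprM -exprMn exprn_ege1 //; lra.
  rewrite ler_wpM2l ?exprn_ge0 //; apply: ler_wiXn2l => //; rewrite /z; lra.
- rewrite -exprMn; have -> : 1 - z = (2 * u%:R)^-1 by rewrite /z; ring.
  rewrite invrK (_ : 2 * ((1 + z) * (2 * u%:R)) = 8 * u%:R - 2); last first.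
    by rewrite /z; field; rewrite gt_eqF //; lra.
  have h1 : 0 <= 8 * u%:R - 2 :> R by lra.
  have h2 : 0 <= 8 * u%:R :> R by lra.
  rewrite lerXn2r ?nnegrE //; lra.
Qed.

End Weights.

(** * Comparison with Cesaro means of the lazy walk *)

Section Psi.
Context {R : realType}.
Implicit Types (u c x y : R).

Definition root8 u : R := Num.sqrt (Num.sqrt (Num.sqrt u)).
(** At 0 the convention [0^-1 = 0] gives the right value 0. *)
Definition psi u : R := Num.min (root8 u) (root8 u)^-1.

Lemma root8_ge0 u : 0 <= root8 u. Proof. exact: sqrtr_ge0. Qed.

Lemma root8X u : 0 <= u -> root8 u ^+ 8 = u.
Proof. by move=> u0; rewrite -[8%N]/(2 * (2 * 2))%N !exprM !sqr_sqrtr ?sqrtr_ge0. Qed.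

Lemma root8_gt0 u : 0 < u -> 0 < root8 u.
Proof. by move=> u0; rewrite !sqrtr_gt0. Qed.

Lemma psi_ge0 u : 0 <= psi u.
Proof. by rewrite le_min root8_ge0 invr_ge0 root8_ge0. Qed.

Lemma psi0 : psi 0 = 0.
Proof. by rewrite /psi /root8 !sqrtr0 invr0 minxx. Qed.

Lemma le_of_exp8 x y : 0 <= x -> 0 <= y -> x ^+ 8 <= y ^+ 8 -> x <= y.
Proof. by move=> x0 y0; rewrite lerXn2r_iff // || rewrite ler_pXn2r. Qed.

Lemma le_root8 u : 0 <= u <= 1 -> u <= root8 u.
Proof.
move=> /andP[u0 u1]; apply: le_of_exp8; rewrite ?root8_ge0 // root8X //.
by rewrite exprS ler_piMr // exprn_ile1.
Qed.

Lemma root8_le u : 1 <= u -> root8 u <= u.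
Proof.
move=> u1; have u0 : 0 <= u by lra.
apply: le_of_exp8; rewrite ?root8_ge0 // root8X //.
by rewrite exprS ler_peMr // exprn_ege1.
Qed.

Lemma root8_ge1 u : 1 <= u -> 1 <= root8 u.
Proof. by move=> u1; apply: le_of_exp8; rewrite ?root8_ge0 // root8X ?expr1n //; lra. Qed.

Lemma root8_le1 u : 0 <= u <= 1 -> root8 u <= 1.
Proof.
by move=> /andP[u0 u1]; apply: le_of_exp8; rewrite ?root8_ge0 // root8X ?expr1n.
Qed.

Lemma psi_small u : 0 <= u <= 1 -> psi u = root8 u.
Proof.
move=> h; have r1 := root8_le1 h; move: h => /andP[u0 u1].
have [->|un] := eqVneq u 0; first by rewrite psi0 /root8 !sqrtr0.
have r0 : 0 < root8 u by rewrite root8_gt0 // lt_def un.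
by apply: min_l; rewrite (le_trans r1) // invf_ge1.
Qed.

Lemma psi_large u : 1 <= u -> psi u = (root8 u)^-1.
Proof.
move=> h; have r1 := root8_ge1 h; apply: min_r; apply: le_trans (r1).
by rewrite invf_le1 // (lt_le_trans _ r1).
Qed.

Lemma psi_ge_small u : 0 <= u <= 1 -> u <= psi u.
Proof. by move=> h; rewrite psi_small // le_root8. Qed.

Lemma psi_ge_large u : 1 <= u -> u^-1 <= psi u.
Proof.
move=> h; have u0 : 0 < u by lra.
by rewrite psi_large // lef_pV2 ?posrE ?root8_le ?root8_gt0.
Qed.

Lemma psi_ge_away (K : R) u : 1 <= K -> K^-1 <= u <= K -> 1 <= K * psi u.
Proof.
move=> K1 /andP[h1 h2]; have K0 : 0 < K by lra.
have Ki : 0 < K^-1 by rewrite invr_gt0.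
rewrite mulrC -ler_pdivrMr // mul1r.
have [u1|u1] := leP u 1.
  by apply: le_trans (h1) (psi_ge_small _); rewrite u1 andbT; lra.
have u0 : 0 < u by lra.
by apply: le_trans (psi_ge_large (ltW u1)); rewrite lef_pV2 ?posrE.
Qed.

Lemma root8V_le_psi (K : R) u : 1 <= K -> K^-1 <= u -> (root8 u)^-1 <= K ^+ 2 * psi u.
Proof.
move=> K1 Ku; have K0 : 0 < K by lra.
have Ki : 0 < K^-1 by rewrite invr_gt0.
have K2 : 1 <= K ^+ 2 by rewrite exprn_ege1.
have [u1|u1] := leP u 1; last first.
  by rewrite psi_large ?(ltW u1) // ler_peMl // invr_ge0 root8_ge0.
have u01 : 0 <= u <= 1 by rewrite u1 andbT; lra.
have r := le_root8 u01; rewrite psi_small //.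
have r0 : 0 < root8 u by rewrite root8_gt0 //; lra.
have kr : K^-1 <= root8 u by lra.
have kr1 : 1 <= K * root8 u by rewrite mulrC -ler_pdivrMr // mul1r.
apply: le_trans (_ : K <= _).
  by rewrite -[leRHS]invrK lef_pV2 ?posrE.
by rewrite expr2 -mulrA ler_peMr // ltW.
Qed.

(** The two eighth roots differ by the factor (l / k)^(1/4), and [psi] changes by no more. The
    square root is a convenient larger loss, whose average over the levels is bounded by
    [sqrt_ratio]. *)
Lemma psi_scale c k l : 0 <= c -> 0 < k <= l ->
  psi (k ^+ 2 * c) <= Num.sqrt (l / k) * psi (l ^+ 2 * c).
Proof.
move=> c0 /andP[k0 kl]; have l0 : 0 < l by lra.
have [->|cn] := eqVneq c 0; first by rewrite !mulr0 psi0 mulr0.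
have cp : 0 < c by rewrite lt_def cn.
have [q qE] : exists q, q = Num.sqrt (l / k) by eexists.
have q2 : q ^+ 2 = l / k by rewrite qE sqr_sqrtr // divr_ge0 // ltW.
have q1 : 1 <= q by rewrite qE le_sqrt_sqr // expr1n ler_pdivlMr // mul1r.
rewrite -qE /psi; set y1 := root8 _; set y2 := root8 _.
have y10 : 0 < y1 by rewrite root8_gt0 // mulr_gt0 // exprn_gt0.
have y20 : 0 < y2 by rewrite root8_gt0 // mulr_gt0 // exprn_gt0.
have kc : 0 <= k ^+ 2 * c by rewrite mulr_ge0 // sqr_ge0.
have lc : 0 <= l ^+ 2 * c by rewrite mulr_ge0 // sqr_ge0.
have y12 : y1 <= y2.
  apply: le_of_exp8; rewrite ?(ltW y10) ?(ltW y20) // !root8X //.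
  by rewrite ler_wpM2r // lerXn2r ?nnegrE // ltW.
have y21 : y2 <= q * y1.
  apply: le_of_exp8; rewrite ?(ltW y20) //.
    by rewrite mulr_ge0 // ?ltW //; lra.
  rewrite exprMn !root8X // mulrA ler_wpM2r // -[8%N]/(2 * 4)%N exprM q2.
  rewrite -[4%N]/(2 * 2)%N exprM -exprMn lerXn2r ?nnegrE ?(ltW l0) //.
    by rewrite mulr_ge0 ?sqr_ge0 // ltW.
  rewrite (_ : _ * k = l * (l / k)); last by field; rewrite gt_eqF.
  by rewrite ler_peMr ?(ltW l0) // ler_pdivlMr // mul1r.
have q0 : 0 < q by lra.
have b1 : Num.min y1 y1^-1 <= q * y2.
  by rewrite ge_min; apply/orP; left; apply: le_trans (y12) _; rewrite ler_peMl // ltW.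
have b2 : Num.min y1 y1^-1 <= q * y2^-1.
  by rewrite ge_min; apply/orP; right; rewrite ler_pdivlMr // mulrC ler_pdivrMr.
by case: (leP y2 y2^-1).
Qed.

Definition ces (n : nat) (rho : R) : R := n.+1%:R^-1 * \sum_(k < n.+1) rho ^+ k.

Lemma ces_ge0 n (rho : R) : 0 <= rho -> 0 <= ces n rho.
Proof. by move=> r0; rewrite mulr_ge0 ?sumr_ge0 // => k _; exact: exprn_ge0. Qed.

Lemma ces_le1 n (rho : R) : 0 <= rho <= 1 -> ces n rho <= 1.
Proof.
move=> /andP[r0 r1]; rewrite /ces mulrC ler_pdivrMr // mul1r.
apply: le_trans (_ : \sum_(k < n.+1) 1 <= _); last by rewrite sumr_const card_ord.
by apply: ler_sum => k _; exact: exprn_ile1.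
Qed.

Lemma onesub_ces n (rho : R) : 0 <= rho <= 1 -> 1 - ces n rho <= n%:R * (1 - rho).
Proof.
move=> /andP[r0 r1].
have n0 : 0 < n.+1%:R :> R by [].
have -> : 1 - ces n rho = n.+1%:R^-1 * \sum_(k < n.+1) (1 - rho ^+ k).
  rewrite sumrB mulrBr sumr_const card_ord mulVf //.
rewrite mulrC ler_pdivrMr //.
apply: le_trans (_ : \sum_(k < n.+1) n%:R * (1 - rho) <= _); last first.
  by rewrite sumr_const card_ord mulr_natr.
apply: ler_sum => k _.
have kb (m : nat) : 1 - rho ^+ m <= m%:R * (1 - rho).
  elim: m => [|m IH]; first by rewrite expr0 subrr mul0r.
  rewrite exprS -natr1 mulrDl mul1r.
  have : rho * (1 - rho ^+ m) <= 1 - rho ^+ m.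
    by rewrite ler_piMl // subr_ge0 exprn_ile1.
  lra.
apply: le_trans (kb k) _; rewrite ler_wpM2r ?subr_ge0 // ler_nat -ltnS; exact: ltn_ord.
Qed.

Lemma ces_decay n (rho : R) : 0 <= rho <= 1 -> ces n rho * (n.+1%:R * (1 - rho)) <= 1.
Proof.
move=> /andP[r0 r1]; rewrite /ces.
have -> : n.+1%:R^-1 * (\sum_(k < n.+1) rho ^+ k) * (n.+1%:R * (1 - rho)) =
   (1 - rho) * \sum_(k < n.+1) rho ^+ k by field.
by rewrite -opprB mulNr -subrX1 opprB gerBl exprn_ge0.
Qed.

End Psi.

Lemma sum_nat_widen (R : zmodType) (lo L n : nat) (F : nat -> R) : (L <= n)%N ->
  \sum_(lo <= x < L) F x = \sum_(x < n) (if (lo <= x)%N && (x < L)%N then F x else 0).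
Proof.
move=> Ln; transitivity (\sum_(x < L | (lo <= x)%N) F x); first by rewrite big_geq_mkord.
by rewrite (big_ord_widen_cond n (fun x => (lo <= x)%N) F Ln) big_mkcond.
Qed.

(** * Resampling one coordinate across the levels *)

Section Resample.
Context {R : realType} {d M : nat}.
Variable S : pred (nvec d M).
Hypothesis dS : downsym S.
Implicit Types (a b : nvec d M) (i : 'I_d) (x : 'I_M.+1).

Definition upd i x a : nvec d M := [ffun k => if k == i then x else a k].

Lemma sum_upd i (G : nvec d M -> R) :
  \sum_a G a = \sum_(b : nvec d M | b i == ord0) \sum_x G (upd i x b).
Proof.
rewrite (partition_big (upd i ord0) (fun b : nvec d M => b i == ord0)) /=; last first.
  by move=> a _; rewrite ffunE eqxx.
apply: eq_bigr => b /eqP b0.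
rewrite (reindex_onto (fun x => upd i x b) (fun a : nvec d M => a i)) /=; last first.
  move=> a /eqP <-; apply/ffunP => k; rewrite !ffunE.
  by case: eqP => [->|].
apply: eq_bigl => x; rewrite ffunE !eqxx andbT.
apply/eqP/ffunP => k; rewrite !ffunE; case: eqP => // ->; by rewrite b0.
Qed.

Lemma nsum_upd i x b : b i = ord0 -> nsum (upd i x b) = (x + nsum b)%N.
Proof.
move=> b0; rewrite /nsum (bigD1 i) //= [in RHS](bigD1 i) //= b0 add0n ffunE eqxx.
by congr addn; apply: eq_bigr => k ki; rewrite ffunE (negbTE ki).
Qed.

Lemma prod_upd (f : 'I_d -> 'I_M.+1 -> R) i x b :
  \prod_k f k (upd i x b k) = f i x * \prod_(k | k != i) f k (b k).
Proof.
rewrite (bigD1 i) //= ffunE eqxx; congr (_ * _).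
by apply: eq_bigr => k ki; rewrite ffunE (negbTE ki).
Qed.

(** The section is an initial interval of integers, so its cosine sums are Dirichlet kernels. *)
Lemma down_section i b : exists2 L, (L <= M.+1)%N & forall x, S (upd i x b) = (x < L)%N.
Proof.
exists (\max_(x | S (upd i x b)) x.+1)%N.
  by apply/bigmax_leqP => x _; exact: ltn_ord.
move=> x; apply/idP/idP => [Sx|].
  exact: (@leq_bigmax_cond _ (fun x => S (upd i x b)) (fun x => x.+1) x Sx).
have [y Sy|none] := pickP (fun x => S (upd i x b)); last first.
  by rewrite big_pred0.
have [z Sz ->] : {z | z \in [pred x | S (upd i x b)] & (\max_(x | S (upd i x b)) x.+1)%N = z.+1}.
  by apply: eq_bigmax_cond; apply/card_gt0P; exists y.
rewrite ltnS => xz; apply: (ds_down dS Sz) => k; rewrite !ffunE.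
by case: eqP.
Qed.

Lemma dirichlet_interval (lo L : nat) (t : R) : 0 < hsin2 t ->
  `|\sum_(lo <= n < L) sgnw n * cos (n%:R * t)| <= 2 / Num.sqrt (hsin2 t).
Proof.
move=> s0; have r0 : 0 < Num.sqrt (hsin2 t) by rewrite sqrtr_gt0.
have D n : `|\sum_(0 <= m < n) sgnw m * cos (m%:R * t)| <= (Num.sqrt (hsin2 t))^-1.
  case: n => [|n]; first by rewrite big_geq // normr0 invr_ge0 sqrtr_ge0.
  by rewrite big_mkord -[leRHS]mul1r ler_pdivlMr // dirichlet_kernel.
have [loL|Llo] := leqP lo L; last by rewrite big_geq ?normr0 ?divr_ge0 ?sqrtr_ge0 // ltnW.
have -> : \sum_(lo <= n < L) sgnw n * cos (n%:R * t) =
   \sum_(0 <= n < L) sgnw n * cos (n%:R * t) - \sum_(0 <= n < lo) sgnw n * cos (n%:R * t).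
  by rewrite [in RHS](big_cat_nat _ loL) //= addrAC subrr add0r.
apply: le_trans (ler_normB _ _) _; have := D L; have := D lo; lra.
Qed.

(** With [k] the last point of the interval, the left side is at most [2 / sqrt (hsin2 t)] and at
    most [2 * k + 1]. This is spread over the upper half of the interval, where the minimum on the
    right is at least its value at [k]. There [x >= k / 2], which is why the constraint weakens to
    [D0 < 2 * (x + sg)]. *)
Lemma resample1 (L sg D0 : nat) (t : R) : (L <= M.+1)%N -> 0 < hsin2 t ->
  `|\sum_(x < M.+1) (x < L)%N%:R * (D0 < x + sg)%N%:R * (sgnw x * cos (x%:R * t))| <=
  8 * \sum_(x < M.+1) (x < L)%N%:R * (D0 < 2 * (x + sg))%N%:R *
     (sgnw x * Num.min 1 ((2 * x%:R + 1) * Num.sqrt (hsin2 t))^-1).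
Proof.
move=> LM s0; set r := Num.sqrt _; have r0 : 0 < r by rewrite sqrtr_gt0.
have min0 (x : nat) : 0 <= Num.min 1 ((2 * x%:R + 1) * r)^-1.
  by rewrite le_min ler01 invr_ge0 mulr_ge0 ?(ltW r0) // addr_ge0 // mulr_ge0.
have rhs0 : 0 <= 8 * \sum_(x < M.+1) (x < L)%N%:R * (D0 < 2 * (x + sg))%N%:R *
     (sgnw x * Num.min 1 ((2 * x%:R + 1) * r)^-1).
  by rewrite mulr_ge0 // sumr_ge0 // => x _; rewrite !mulr_ge0 ?sgnw_ge0.
have [small|big] := leqP (L + sg) D0.+1.
  rewrite big1 ?normr0 // => x _; case: ltnP => xL; last by rewrite !mul0r.
  by rewrite mul1r ltnNge (_ : (x + sg <= D0)%N) ?mul0r //; lia.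
have [L0|L0] := posnP L.
  by rewrite big1 ?normr0 // => x _; rewrite L0 ltn0 !mul0r.
have lhs1 : `|\sum_(x < M.+1) (x < L)%N%:R * (D0 < x + sg)%N%:R * (sgnw x * cos (x%:R * t))|
    <= 2 / r.
  rewrite (_ : \sum_(x < M.+1) _ = \sum_(D0.+1 - sg <= n < L) sgnw n * cos (n%:R * t)).
    exact: dirichlet_interval.
  rewrite (sum_nat_widen _ _ LM).
  apply: eq_bigr => x _; rewrite leq_subLR addnC.
  by case: ltnP => _; case: ltnP => _ /=; rewrite ?mul1r ?mul0r.
pose k := L.-1; have Lk : L = k.+1 by rewrite prednK.
have lhs2 : `|\sum_(x < M.+1) (x < L)%N%:R * (D0 < x + sg)%N%:R * (sgnw x * cos (x%:R * t))|
    <= 2 * k%:R + 1.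
  apply: le_trans (ler_norm_sum _ _ _) _.
  apply: le_trans (_ : \sum_(x < M.+1) (x < L)%N%:R * sgnw x <= _).
    apply: ler_sum => x _; rewrite !normrM !normr_nat [ `|sgnw x|]ger0_norm ?sgnw_ge0 //.
    have b1 (c : bool) : c%:R <= 1 :> R by case: c.
    by rewrite -mulrA ler_wpM2l // mulrCA ler_piMr ?sgnw_ge0 // mulr_ile1 ?b1 ?cos_max.
  rewrite (_ : \sum_(x < M.+1) _ = \sum_(x < L) sgnw x); last first.
    rewrite -(big_mkord xpredT) (sum_nat_widen _ _ LM); apply: eq_bigr => x _ /=.
    by case: ltnP; rewrite ?mul1r ?mul0r.
  rewrite Lk; elim: (k) => [|n IH]; first by rewrite big_ord1 /sgnw /= mulr0 add0r.
  by rewrite big_ord_recr /= {2}/sgnw /= -natr1; lra.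
have rhs : (k.+1%:R / 2) * Num.min 1 ((2 * k%:R + 1) * r)^-1 <=
   \sum_(x < M.+1) (x < L)%N%:R * (D0 < 2 * (x + sg))%N%:R *
     (sgnw x * Num.min 1 ((2 * x%:R + 1) * r)^-1).
  pose h := (k - k %/ 2)%N.
  apply: le_trans (_ : \sum_(h <= x < L) Num.min 1 ((2 * k%:R + 1) * r)^-1 <= _).
    rewrite big_const_nat iter_addr_0 -[leRHS]mulr_natl ler_wpM2r //.
    rewrite ler_pdivrMr // -natrM ler_nat Lk /h; lia.
  rewrite (sum_nat_widen _ _ LM).
  apply: ler_sum => x _; case: ifP => [/andP[hx xL]|_]; last by rewrite !mulr_ge0 ?sgnw_ge0.
  rewrite xL mul1r (_ : (D0 < _)%N) ?mul1r; last by rewrite /h in hx; lia.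
  apply: le_trans (_ : Num.min 1 ((2 * x%:R + 1) * r)^-1 <= _); last first.
    by rewrite ler_peMl ?sgnw_ge1.
  rewrite le_min2 // lef_pV2 ?posrE ?mulr_gt0 // ?ltr_pwDr ?mulr_ge0 //.
  have : x%:R <= k%:R :> R by rewrite ler_nat -ltnS -Lk.
  by move=> h'; rewrite ler_wpM2r ?(ltW r0) //; lra.
apply: le_trans (_ : 8 * ((k.+1%:R / 2) * Num.min 1 ((2 * k%:R + 1) * r)^-1) <= _); last first.
  by rewrite ler_wpM2l.
rewrite -[k.+1%:R]natr1.
have [m1|m1] := leP 1 (((2 * k%:R + 1) * r)^-1).
  have : 0 <= k%:R :> R by []. 
  lra.
have -> : 8 * ((k%:R + 1) / 2 * ((2 * k%:R + 1) * r)^-1) =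
   4 * (k%:R + 1) / (2 * k%:R + 1) / r.
  by field; rewrite !gt_eqF // ltr_pwDr // mulr_ge0.
apply: le_trans lhs1 _; rewrite ler_wpM2r ?invr_ge0 ?(ltW r0) //.
rewrite ler_pdivlMr; last by rewrite ltr_pwDr // mulr_ge0.
by have : 0 <= k%:R :> R by []; lra.
Qed.

(** All coordinates but [i] are frozen. Letting [i] vary mixes the levels, so the cancellation is
    available for all levels above [D0] together, not for each one. *)
Lemma resample (t : 'I_d -> R) i (D0 : nat) : 0 < hsin2 (t i) ->
  `|\sum_a (D0 < nsum a)%N%:R * (om S a * cosmult t a)| <=
  8 * \sum_a (D0 < 2 * nsum a)%N%:R *
    (om S a * Num.min 1 ((2 * (a i)%:R + 1) * Num.sqrt (hsin2 (t i)))^-1).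
Proof.
move=> s0; rewrite (sum_upd i) [in leRHS](sum_upd i) mulr_sumr.
apply: le_trans (ler_norm_sum _ _ _) _; apply: ler_sum => b /eqP b0.
have [L LM LE] := down_section i b.
pose Q := \prod_(k | k != i) cos ((b k)%:R * t k).
pose P : R := \prod_(k | k != i) sgnw (b k).
have P0 : 0 <= P by apply: prodr_ge0 => k _; exact: sgnw_ge0.
have Q1 : `|Q| <= 1 by apply: norm_prod_le1 => k; exact: cos_max.
have omE x : om S (upd i x b) = (x < L)%N%:R * (sgnw x * P).
  by rewrite /om /signs LE (prod_upd (fun _ (y : 'I_M.+1) => sgnw y)).
have cosE x : cosmult t (upd i x b) = cos (x%:R * t i) * Q.
  by rewrite /cosmult (prod_upd (fun k (y : 'I_M.+1) => cos (y%:R * t k))).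
have -> : \sum_x (D0 < nsum (upd i x b))%N%:R * (om S (upd i x b) * cosmult t (upd i x b))
  = (\sum_(x < M.+1) (x < L)%N%:R * (D0 < x + nsum b)%N%:R * (sgnw x * cos (x%:R * t i)))
    * (P * Q).
  rewrite mulr_suml; apply: eq_bigr => x _; rewrite nsum_upd // omE cosE; ring.
have -> : \sum_x (D0 < 2 * nsum (upd i x b))%N%:R * (om S (upd i x b) *
     Num.min 1 ((2 * (upd i x b i)%:R + 1) * Num.sqrt (hsin2 (t i)))^-1)
  = (\sum_(x < M.+1) (x < L)%N%:R * (D0 < 2 * (x + nsum b))%N%:R *
     (sgnw x * Num.min 1 ((2 * x%:R + 1) * Num.sqrt (hsin2 (t i)))^-1)) * P.
  rewrite mulr_suml; apply: eq_bigr => x _; rewrite nsum_upd // omE ffunE eqxx; ring.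
rewrite normrM mulrA; apply: ler_pM => //; first exact: resample1.
by rewrite normrM (ger0_norm P0) ler_piMr.
Qed.

End Resample.

Section SqrtRatio.
Context {R : realType} {d M : nat}.
Variable S : pred (nvec d M).
Hypotheses (d_gt0 : (0 < d)%N) (dS : downsym S).
Variable N : nat.
Hypotheses (NE : nmax S = N) (N_gt0 : (0 < N)%N).
Let Om : R := \sum_a om S a.

(** Layers by powers of 4: on [4 ^ i * nsum a <= N] the weight is charged [2 ^ i.+1], and
    [level_tail_large] gives relative mass at most [16 / 4 ^ i]. The geometric series adds up to at
    most 64. *)
Lemma sqrt_ratio :
  \sum_a om S a * ((d < nsum a)%N%:R * Num.sqrt (N%:R / (nsum a)%:R)) <= 64 * Om.
Proof.
have NR : 0 < N%:R :> R by rewrite ltr0n.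
have dR : 0 < d%:R :> R by rewrite ltr0n.
have om0 a : 0 <= om S a :> R by exact: om_ge0.
apply: le_trans (_ : \sum_a om S a * \sum_(i < N.+1) 2 ^+ i.+1 *
    ((d < nsum a) && (4 ^ i * nsum a <= N))%N%:R <= _).
  apply: ler_sum => a _; have [Sa|Sa] := boolP (S a); last by rewrite om_eq0 // !mul0r.
  rewrite ler_wpM2l //; case: ltnP => [da|_]; last first.
    by rewrite mul0r sumr_ge0 // => i _; rewrite mulr_ge0 // exprn_ge0.
  have a0 : (0 < nsum a)%N by lia.
  have aN : (nsum a <= N)%N by rewrite -NE nsum_le_nmax.
  have q0 : (0 < N %/ nsum a)%N by rewrite divn_gt0.
  have /andP[p1 p2] := trunc_log_bounds (isT : 1 < 4)%N q0.
  set i := trunc_log 4 _ in p1 p2.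
  have iN : (i < N.+1)%N.
    rewrite ltnS; apply: leq_trans (ltnW (ltn_expl i (isT : 1 < 4)%N)) _.
    by apply: leq_trans p1 _; exact: leq_div.
  rewrite (bigD1 (Ordinal iN)) //= mul1r -[leLHS]addr0; apply: lerD; last first.
    by apply: sumr_ge0 => j _; rewrite mulr_ge0 // exprn_ge0.
  rewrite (_ : (4 ^ i * nsum a <= N)%N) ?mulr1; last by rewrite -leq_divRL.
  rewrite sqrt_le_sqr ?exprn_ge0 // -exprM ler_pdivrMr ?ltr0n //.
  rewrite mulnC exprM -!natrX -natrM ler_nat.
  apply: leq_trans (ltnW (ltn_ceil N a0)) _.
  by rewrite leq_mul2r -[(2 ^ 2)%N]/4%N p2 orbT.
under eq_bigr do rewrite mulr_sumr.
rewrite exchange_big /=.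
apply: le_trans (_ : \sum_(i < N.+1) (32 * 2^-1 ^+ i) * Om <= _).
  apply: ler_sum => i _.
  (* When [4 ^ i * d > N], no level above [d] meets the constraint. *)
  have [hi|hi] := leqP (4 ^ i * d) N; last first.
    rewrite big1 ?mulr_ge0 ?exprn_ge0 ?Om_ge0 //.
    move=> a _; case: (ltnP d) => da /=; last by rewrite !mulr0.
    case: leqP; rewrite ?mulr0 // => h2.
    by exfalso; have := leq_mul (leqnn (4 ^ i)) (ltnW da); lia.
  pose u := (N %/ (4 ^ i * d)).+1.
  have c0 : (0 < 4 ^ i * d)%N by rewrite muln_gt0 expn_gt0.
  apply: le_trans (_ : 2 ^+ i.+1 * \sum_(a : nvec d M | (nsum a <= u * d)%N) om S a <= _).
    rewrite mulr_sumr [leRHS]big_mkcond /=; apply: ler_sum => a _.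
    case: (ltnP d) => da /=; last by rewrite !mulr0; case: ifP => _ //; rewrite mulr_ge0 // exprn_ge0.
    case: leqP => h2; last by rewrite !mulr0; case: ifP => _ //; rewrite mulr_ge0 // exprn_ge0.
    rewrite mulr1 ifT; first by rewrite mulrC.
    have := ltn_ceil N c0; rewrite -/u => h3.
    have p4 : (0 < 4 ^ i)%N by rewrite expn_gt0.
    by rewrite -(leq_pmul2l p4); apply: leq_trans h2 _; lia.
  apply: le_trans (ler_wpM2l _ (level_tail_large d_gt0 dS NE _ N_gt0)) _ => //.
  rewrite mulrA ler_wpM2r ?Om_ge0 //.
  have uE : u%:R * (4 ^+ i * d%:R) <= 2 * N%:R :> R.
    rewrite -natrX -!natrM ler_nat /u mulSn.
    by have := leq_trunc_div N (4 ^ i * d); lia.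
  rewrite mulrA ler_pdivrMr //.
  have p4 : 0 < 2 ^+ i :> R by rewrite exprn_gt0.
  rewrite exprVn -(ler_pM2l p4).
  have -> : 2 ^+ i * (2 ^+ i.+1 * (8 * u%:R * d%:R)) = 16 * (u%:R * (4 ^+ i * d%:R)) :> R.
    have -> : 4 ^+ i = 2 ^+ i * 2 ^+ i :> R by rewrite -exprMn -natrM.
    by rewrite exprS; ring.
  rewrite (_ : 2 ^+ i * _ = 32 * N%:R); first by lra.
  by field; rewrite gt_eqF.
rewrite -mulr_suml ler_wpM2r ?Om_ge0 // -mulr_sumr.
have : \sum_(i < N.+1) 2^-1 ^+ i <= 2 :> R.
  suff -> : \sum_(i < N.+1) 2^-1 ^+ i = 2 - 2 * 2^-1 ^+ N.+1 :> R.
    by rewrite gerBl mulr_ge0 // exprn_ge0 // invr_ge0.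
  elim: (N) => [|n IH]; first by rewrite big_ord1 expr0 expr1; field.
  by rewrite big_ord_recr /= IH [2^-1 ^+ n.+2]exprS; field.
lra.
Qed.

End SqrtRatio.

(** At most half of the frequencies are nearer to pi than to 0, so each of those can be given its
    own partner near 0. *)
Definition low_frequency {R : realType} {d : nat} (t : 'I_d -> R) : bool :=
  (#|[pred i | (2^-1 < hsin2 (t i))%R]| <= #|[pred i | (hsin2 (t i) <= 2^-1)%R]|)%N.

(** * Multiplier errors at one scale: sparse and intermediate ranges *)

Section Assembly.
Context {R : realType} {d M : nat}.
Variables (S : pred (nvec d M)) (N : nat) (t : 'I_d -> R).
Hypotheses (d_gt0 : (0 < d)%N) (dS : downsym S) (NE : nmax S = N).
Implicit Types (a : nvec d M) (D : nat).

Let Om : R := \sum_a om S a.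
Let Ss := \sum_i hsin2 (t i).
Let rho : R := 1 - Ss / d%:R.
Let d0 : 0 < d%:R :> R. Proof. by rewrite ltr0n. Qed.
Let om0 a : 0 <= om S a :> R. Proof. exact: om_ge0. Qed.
Let Om0 : 0 <= Om. Proof. exact: sumr_ge0. Qed.

Definition ctime D : nat := (D + D * D %/ d)%N.
Definition cmp D : R := ces (ctime D) rho.

Lemma hsum_ge0 : 0 <= Ss. Proof. by apply: sumr_ge0 => i _; exact: hsin2_ge0. Qed.

Lemma rho01 : 0 <= rho <= 1.
Proof.
have S0 := hsum_ge0; have h : Ss <= d%:R.
  apply: le_trans (_ : \sum_(i < d) 1 <= _); last by rewrite sumr_const card_ord.
  by apply: ler_sum => i _; exact: hsin2_le1.
have : Ss / d%:R <= 1 by rewrite ler_pdivrMr // mul1r.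
have : 0 <= Ss / d%:R by rewrite divr_ge0 // ltW.
by rewrite /rho; lra.
Qed.

Lemma cmp_ge0 D : 0 <= cmp D.
Proof. by case/andP: rho01 => ? _; exact: ces_ge0. Qed.

Lemma cmp_le1 D : cmp D <= 1. Proof. exact: ces_le1 rho01. Qed.

Section Level.
Variables (D : nat) (kappa : R).
Hypothesis kE : kappa * d%:R = D%:R.
Let V : R := \sum_a level S D a.

Let V0 : 0 <= V. Proof. by apply: sumr_ge0 => a _; exact: (exch_ge0 (level_exch dS D) a). Qed.
Let k0 : 0 <= kappa. Proof. by rewrite -(pmulr_lge0 _ d0) kE. Qed.

Lemma onesub_cmp : 1 - cmp D <= (kappa ^+ 2 + kappa) * Ss.
Proof.
have S0 := hsum_ge0.
apply: le_trans (onesub_ces _ rho01) _.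
have -> : 1 - rho = Ss / d%:R by rewrite /rho; ring.
rewrite mulrA ler_pdivrMr // mulrAC ler_wpM2r // natrD.
have : (D * D %/ d)%:R <= kappa ^+ 2 * d%:R.
  rewrite -(ler_pM2r d0) -natrM; apply: le_trans (_ : (D * D)%:R <= _).
    by rewrite ler_nat leq_trunc_div.
  by rewrite natrM -kE le_eqVlt; apply/orP; left; apply/eqP; ring.
by rewrite mulrDl kE; lra.
Qed.

Lemma cmp_decay1 : cmp D * (kappa * Ss) <= 1.
Proof.
have S0 := hsum_ge0.
apply: le_trans (ces_decay (ctime D) rho01); rewrite ler_wpM2l ?cmp_ge0 //.
have -> : 1 - rho = Ss / d%:R by rewrite /rho; ring.
rewrite mulrA ler_pdivlMr // mulrAC ler_wpM2r // kE ler_nat.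
by rewrite /ctime -addnS leq_addr.
Qed.

Lemma cmp_decay2 : cmp D * (kappa ^+ 2 * Ss) <= 1.
Proof.
have S0 := hsum_ge0.
apply: le_trans (ces_decay (ctime D) rho01); rewrite ler_wpM2l ?cmp_ge0 //.
have -> : 1 - rho = Ss / d%:R by rewrite /rho; ring.
rewrite mulrA ler_pdivlMr // mulrAC ler_wpM2r // -(ler_pM2r d0).
have -> : kappa ^+ 2 * d%:R * d%:R = (D * D)%:R by rewrite natrM -kE; ring.
rewrite -natrM ler_nat; apply: leq_trans (ltnW (ltn_ceil (D * D) d_gt0)) _.
by rewrite leq_mul2r ltnS leq_addl orbT.
Qed.

Let D1 a : nsum a != D -> level S D a = 0 :> R. Proof. exact: level_out. Qed.

(** Both multipliers are close to 1, by [level_smooth] and [onesub_cmp]. *)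
Lemma level_low_freq :
  `|\sum_a level S D a * (cosmult t a - cmp D)| <= 11 * (kappa ^+ 2 + kappa) * Ss * V.
Proof.
have sm := level_smooth t d_gt0 (level_exch dS D) D1 kE.
have S0 := hsum_ge0.
have -> : \sum_a level S D a * (cosmult t a - cmp D) =
   (1 - cmp D) * V - \sum_a level S D a * (1 - cosmult t a).
  rewrite /V mulr_sumr -sumrB; apply: eq_bigr => a _; ring.
have A0 : 0 <= \sum_a level S D a * (1 - cosmult t a).
  apply: sumr_ge0 => a _; rewrite mulr_ge0 ?(exch_ge0 (level_exch dS D)) // subr_ge0.
  by apply: le_trans (cosmult_le1 t a); exact: ler_norm.
have B0 : 0 <= (1 - cmp D) * V by rewrite mulr_ge0 // subr_ge0 cmp_le1.
have B1 : (1 - cmp D) * V <= (kappa ^+ 2 + kappa) * Ss * V.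
  by rewrite ler_wpM2r // onesub_cmp.
have k2 : 0 <= kappa ^+ 2 * Ss * V by rewrite !mulr_ge0 // sqr_ge0.
have k1 : 0 <= kappa * Ss * V by rewrite !mulr_ge0.
move: sm; rewrite -/Ss -/V => sm.
rewrite ler_norml; apply/andP; split; lra.
Qed.

Lemma level_sparse : (0 < D)%N -> kappa <= 1 ->
  low_frequency t ->
  `|\sum_a level S D a * (cosmult t a - cmp D)| <=
  49 * (kappa + Num.min (kappa * Ss) (kappa * Ss)^-1) * V.
Proof.
move=> D0 k1 low; have S0 := hsum_ge0.
have kp : 0 < kappa by rewrite -(pmulr_lgt0 _ d0) kE ltr0n.
case: (leP (kappa * Ss) (kappa * Ss)^-1) => hmin.
  apply: le_trans level_low_freq _; rewrite ler_wpM2r //.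
  have : kappa ^+ 2 * Ss <= kappa * Ss by rewrite ler_wpM2r // expr2 ler_piMl.
  have : 0 <= kappa * Ss by rewrite mulr_ge0.
  lra.
have kS : 0 < kappa * Ss.
  by rewrite lt_def mulr_ge0 // andbT; apply: contraTneq hmin => ->; rewrite invr0 ltxx.
have Sp : 0 < Ss by rewrite -(pmulr_rgt0 _ kp).
have dec := level_decay_sparse d_gt0 (level_exch dS D) D1 kE kp Sp low.
have -> : \sum_a level S D a * (cosmult t a - cmp D) =
   \sum_a level S D a * cosmult t a - cmp D * V.
  by rewrite /V mulr_sumr -sumrB; apply: eq_bigr => a _; ring.
apply: le_trans (ler_normB _ _) _.
have c1 : cmp D <= (kappa * Ss)^-1 by rewrite -[leRHS]mul1r ler_pdivlMr // cmp_decay1.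
have cV0 : 0 <= cmp D * V by apply: mulr_ge0 => //; exact: cmp_ge0.
rewrite [ `|cmp D * V|]ger0_norm //.
have c2 : cmp D * V <= (kappa * Ss)^-1 * V by rewrite ler_wpM2r.
have kV : 0 <= kappa * V by rewrite mulr_ge0.
move: dec; rewrite -/Ss -/V; lra.
Qed.

Lemma level_large : 1 <= kappa -> (forall i, 128 * kappa ^+ 2 * hsin2 (t i) <= 1) ->
  `|\sum_a level S D a * (cosmult t a - cmp D)| <=
  110 * (psi (kappa ^+ 2 * Ss) + (Num.sqrt kappa)^-1) * V.
Proof.
move=> k1 hs; have S0 := hsum_ge0.
have kp : 0 < kappa by lra.
have sk0 : 0 <= (Num.sqrt kappa)^-1 by rewrite invr_ge0 sqrtr_ge0.
have u0 : 0 <= kappa ^+ 2 * Ss by rewrite mulr_ge0 // sqr_ge0.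
have [u1|u1] := leP (kappa ^+ 2 * Ss) 1.
  apply: le_trans level_low_freq _; rewrite ler_wpM2r //.
  have : kappa ^+ 2 * Ss <= psi (kappa ^+ 2 * Ss) by rewrite psi_ge_small // u0 u1.
  have : kappa * Ss <= kappa ^+ 2 * Ss by rewrite ler_wpM2r // expr2 ler_peMl // ltW.
  lra.
have y0 : 0 < root8 (kappa ^+ 2 * Ss) by rewrite root8_gt0 //; lra.
have yE := root8X u0.
have dec := level_decay_large d_gt0 (level_exch dS D) D1 kE k1 y0 yE hs.
have -> : \sum_a level S D a * (cosmult t a - cmp D) =
   \sum_a level S D a * cosmult t a - cmp D * V.
  by rewrite /V mulr_sumr -sumrB; apply: eq_bigr => a _; ring.
apply: le_trans (ler_normB _ _) _.
have up : 0 < kappa ^+ 2 * Ss by lra.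
have c1 : cmp D <= (kappa ^+ 2 * Ss)^-1 by rewrite -[leRHS]mul1r ler_pdivlMr // cmp_decay2.
have c3 := psi_ge_large (ltW u1).
have cV0 : 0 <= cmp D * V by apply: mulr_ge0 => //; exact: cmp_ge0.
rewrite [ `|cmp D * V|]ger0_norm //.
have c2 : cmp D * V <= psi (kappa ^+ 2 * Ss) * V by rewrite ler_wpM2r // (le_trans c1).
have e1 : `|\sum_a level S D a * cosmult t a| <=
    108 * (psi (kappa ^+ 2 * Ss) + (Num.sqrt kappa)^-1) * V.
  rewrite psi_large ?(ltW u1) //; apply: le_trans dec.
  apply: le_trans (ler_norm_sum _ _ _) _; apply: ler_sum => a _.
  by rewrite normrM ger0_norm // (exch_ge0 (level_exch dS D)).
have p0 : 0 <= psi (kappa ^+ 2 * Ss) * V by rewrite mulr_ge0 // psi_ge0.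
have q0 : 0 <= (Num.sqrt kappa)^-1 * V by rewrite mulr_ge0.
lra.
Qed.

End Level.

Lemma sum_level_le (F : nat -> nvec d M -> R) (B : nat -> R) :
  (forall D, (D <= N)%N ->
     `|\sum_a level S D a * F D a| <= B D * \sum_a level S D a) ->
  `|\sum_a om S a * F (nsum a) a| <= \sum_a om S a * B (nsum a).
Proof.
move=> hB; rewrite (sum_level S F) (sum_level S (fun D _ => B D)) NE.
apply: le_trans (ler_norm_sum _ _ _) _; apply: ler_sum => D _.
apply: le_trans (hB _ _) _; first by rewrite -ltnS ltn_ord.
by rewrite mulrC mulr_suml.
Qed.

Lemma level_trivial D (F : nvec d M -> R) (c : R) : (forall a, `|F a| <= c) ->
  `|\sum_a level S D a * F a| <= c * \sum_a level S D a.
Proof.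
move=> Fc; apply: le_trans (ler_norm_sum _ _ _) _.
rewrite [leRHS]mulrC mulr_suml; apply: ler_sum => a _.
have v0 : 0 <= level S D a :> R := exch_ge0 (level_exch dS D) a.
by rewrite normrM (ger0_norm v0) ler_wpM2l.
Qed.

Lemma diff_le2 D a : `|cosmult t a - cmp D| <= 2.
Proof.
apply: le_trans (ler_normB _ _) _; have := cosmult_le1 t a.
by rewrite [ `|cmp D|]ger0_norm ?cmp_ge0 //; have := cmp_le1 D; lra.
Qed.

(** [eps] will be 1, or the sign [(-1) ^+ D] after a shift of the frequencies by pi. Levels up to
    [N / 6] have relative mass at most [2 ^- N]; on the others [kappa] is within a factor 6 of
    [N / d], so every level bound can be expressed through [N]. *)
Lemma sparse_error (eps : nat -> R) : (forall D, `|eps D| <= 1) -> (16 * N <= d)%N ->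
  low_frequency t ->
  `|\sum_a om S a * (eps (nsum a) * (cosmult t a - cmp (nsum a)))| <=
  294 * (psi N%:R + psi (N%:R / d%:R) + psi (N%:R / d%:R * Ss)) * Om.
Proof.
move=> heps Nd low; have S0 := hsum_ge0.
(* Here the right side is 0, so the error must vanish exactly: [S] holds only the zero vector, and
   both multipliers are 1. *)
have [N0|N0] := posnP N.
  rewrite big1 ?normr0 => [|a _].
    apply: mulr_ge0 Om0; apply: mulr_ge0; first exact: ler0n.
    by rewrite !addr_ge0 ?psi_ge0.
  have [Sa|Sa] := boolP (S a); last by rewrite om_eq0 // mul0r.
  have na : nsum a = 0%N by apply/eqP; rewrite -leqn0 -N0 -NE nsum_le_nmax.
  have -> : cosmult t a = 1.
    rewrite /cosmult big1 // => i _.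
    have -> : a i = 0%N :> nat by apply/eqP; rewrite -leqn0 -na leq_nsum.
    by rewrite mul0r cos0.
  have -> : cmp (nsum a) = 1.
    by rewrite na /cmp /ctime mul0n div0n /ces big_ord1 expr0 invr1 mulr1.
  by rewrite subrr !mulr0.
have NR : 0 < N%:R :> R by rewrite ltr0n.
have [k kE] : exists k, k = N%:R / d%:R :> R by eexists.
have k0 : 0 < k by rewrite kE divr_gt0.
have k1 : k <= 1 by rewrite kE ler_pdivrMr // mul1r ler_nat; lia.
pose m := k + 6 * psi (k * Ss).
have ps0 (u : R) : 0 <= psi u by exact: psi_ge0.
apply: le_trans (@sum_level_le (fun D a => eps D * (cosmult t a - cmp D))
   (fun D => 2 * (6 * D <= N)%N%:R + 49 * m) _) _.
  move=> D DN.
  have -> : \sum_a level S D a * (eps D * (cosmult t a - cmp D)) =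
     eps D * \sum_a level S D a * (cosmult t a - cmp D).
    by rewrite mulr_sumr; apply: eq_bigr => a _; ring.
  rewrite normrM; apply: le_trans (_ : `|\sum_a level S D a * (cosmult t a - cmp D)| <= _).
    by rewrite ler_piMl.
  have V0 : 0 <= \sum_a level S D a :> R.
    by apply: sumr_ge0 => a _; exact: (exch_ge0 (level_exch dS D) a).
  have m0 : 0 <= m by rewrite addr_ge0 ?mulr_ge0 // ltW.
  case: leqP => D6.
    apply: le_trans (level_trivial D (diff_le2 D)) _.
    by rewrite ler_wpM2r //= mulr1; lra.
  have [q qE] : exists q, q = D%:R / d%:R :> R by eexists.
  have qd : q * d%:R = D%:R by rewrite qE divfK // gt_eqF.
  have D0 : (0 < D)%N by lia.
  have qk : q <= k by rewrite qE kE ler_wpM2r ?invr_ge0 ?(ltW d0) ?ler_nat.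
  have kq : k <= 6 * q.
    by rewrite qE kE mulrA ler_wpM2r ?invr_ge0 ?(ltW d0) // -natrM ler_nat ltnW.
  have q0 : 0 < q by lra.
  apply: le_trans (level_sparse qd D0 (le_trans qk k1) low) _.
  rewrite mulr0 add0r ler_wpM2r // ler_wpM2l // /m lerD //.
  have [SZ|SN] := eqVneq Ss 0.
    by rewrite SZ !mulr0 invr0 minxx mulr_ge0.
  have Sp : 0 < Ss by rewrite lt_def SN.
  have kS : 0 < k * Ss by rewrite mulr_gt0.
  have qS : 0 < q * Ss by rewrite mulr_gt0.
  have [u1|u1] := leP (k * Ss) 1.
    apply: le_trans (_ : k * Ss <= _).
      by rewrite ge_min ler_wpM2r.
    have := @psi_ge_small _ (k * Ss); rewrite (ltW kS) u1 => /(_ isT).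
    by have := ps0 (k * Ss); lra.
  apply: le_trans (_ : 6 * (k * Ss)^-1 <= _).
    rewrite ge_min; apply/orP; right.
    rewrite -[6]invrK -invfM lef_pV2 ?posrE //; last by rewrite mulr_gt0 // invr_gt0.
    by rewrite -(ler_pM2l (_ : 0 < 6)) // mulrA divff // mul1r mulrA ler_wpM2r.
  by rewrite ler_wpM2l // psi_ge_large // ltW.
have -> : \sum_a om S a * (2 * (6 * nsum a <= N)%N%:R + 49 * m) =
   2 * \sum_(a : nvec d M | (6 * nsum a <= N)%N) om S a + 49 * m * Om.
  rewrite mulr_sumr [X in _ = X + _]big_mkcond /= /Om mulr_sumr -big_split /=.
  by apply: eq_bigr => a _; case: leqP => _ /=; ring.
have tail : \sum_(a : nvec d M | (6 * nsum a <= N)%N) om S a <= 2 ^- N * Om.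
  exact: (level_tail_small d_gt0 dS NE Nd).
have p1 : 2 ^- N <= psi N%:R :> R.
  apply: le_trans (_ : N%:R^-1 <= _); last by rewrite psi_ge_large // ler1n.
  by rewrite lef_pV2 ?posrE ?exprn_gt0 // -natrX ler_nat ltnW // ltn_expl.
have p2 : k <= psi k by rewrite psi_ge_small // k1 ltW.
have t2 : \sum_(a : nvec d M | (6 * nsum a <= N)%N) om S a <= psi N%:R * Om.
  by apply: le_trans tail _; rewrite ler_wpM2r.
have t3 : m * Om <= (psi k + 6 * psi (k * Ss)) * Om by rewrite ler_wpM2r // lerD2r.
rewrite -kE.
have z1 : 0 <= psi N%:R * Om by rewrite mulr_ge0.
have z2 : 0 <= psi k * Om by rewrite mulr_ge0.
have z3 : 0 <= psi (k * Ss) * Om by rewrite mulr_ge0.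
lra.
Qed.

(** No cancellation is used: [psi (N / d)] is at least 1/16 in this range. *)
Lemma mid_error : (d < 16 * N)%N -> (N < 16 * d)%N ->
  `|\sum_a om S a * (cosmult t a - cmp (nsum a))| <= 32 * psi (N%:R / d%:R) * Om.
Proof.
move=> h1 h2.
apply: le_trans (@sum_level_le (fun D a => cosmult t a - cmp D) (fun=> 2) _) _.
  by move=> D _; exact: (level_trivial D (diff_le2 D)).
rewrite -mulr_suml mulrC ler_wpM2r //.
have : 1 <= 16 * psi (N%:R / d%:R) :> R.
  apply: psi_ge_away => //; rewrite ?ler1n //; apply/andP; split.
    by rewrite ler_pdivlMr // mulrC ler_pdivrMr // mulrC -natrM ler_nat ltnW.
  by rewrite ler_pdivrMr // -natrM ler_nat ltnW.
lra.
Qed.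

End Assembly.

(** * Multiplier errors at one scale: dense range and resonances *)

Section LargeError.
Context {R : realType} {d M : nat}.
Variables (S : pred (nvec d M)) (N : nat) (t : 'I_d -> R) (i0 : 'I_d).
Hypotheses (d_gt0 : (0 < d)%N) (dS : downsym S) (NE : nmax S = N).
Hypothesis i0max : forall i, hsin2 (t i) <= hsin2 (t i0).
Implicit Types (a : nvec d M) (D : nat).

Let Om : R := \sum_a om S a.
Let Ss := \sum_i hsin2 (t i).
Let s0 := hsin2 (t i0).
Let d0 : 0 < d%:R :> R. Proof. by rewrite ltr0n. Qed.
Let om0 a : 0 <= om S a :> R. Proof. exact: om_ge0. Qed.
Let Om0 : 0 <= Om. Proof. exact: sumr_ge0. Qed.
Let s00 : 0 <= s0. Proof. exact: hsin2_ge0. Qed.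
Let ps0 (u : R) : 0 <= psi u. Proof. exact: psi_ge0. Qed.

Let kap D : R := D%:R / d%:R.
Let kapE D : kap D * d%:R = D%:R. Proof. by rewrite /kap divfK // gt_eqF. Qed.

Let kap_ge1 D : (d <= D)%N -> 1 <= kap D.
Proof. by move=> dD; rewrite /kap ler_pdivlMr // mul1r ler_nat. Qed.

Let kap_le D E : (D <= E)%N -> kap D <= kap E.
Proof. by move=> DE; rewrite /kap ler_wpM2r ?invr_ge0 ?(ltW d0) ?ler_nat. Qed.

Let kap0 D : 0 <= kap D. Proof. by rewrite /kap divr_ge0. Qed.

(** The 43 comes from [level_resample]; [2 ^+ 9 = 128 * 2 ^+ 2] because resonance will be known only
    at the level [2 * D]. *)
Definition Kres : R := locked (43 * (2 ^+ 9) ^+ 2).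

Lemma Kres_ge0 : 0 <= Kres.
Proof. by rewrite /Kres -lock mulr_ge0 // exprn_ge0 // exprn_ge0. Qed.

(** The levels above [d] where the frequency condition of [level_decay_large] fails. They are closed
    upwards, hence of the form that [resample] handles. *)
Definition resonant D : bool := (d < D)%N && (1 < 128 * (D%:R / d%:R) ^+ 2 * s0).

Let resonant_up D E : (D <= E)%N -> resonant D -> resonant E.
Proof.
move=> DE /andP[h1 h2]; rewrite /resonant (leq_trans h1 DE) /=.
apply: lt_le_trans h2 _; rewrite ler_wpM2r // ler_wpM2l // lerXn2r ?nnegrE ?kap0 //.
exact: kap_le.
Qed.

Let SsS : s0 <= Ss.
Proof.
rewrite /Ss (bigD1 i0) //= lerDl sumr_ge0 // => i _; exact: hsin2_ge0.
Qed.

(** Resample the coordinate of the largest frequency over all levels from the first resonant one,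
    [D1], on. The new weight lives on levels of at least [D1 / 2]; those up to [d] are bounded
    trivially, the others by [level_resample]. *)
Lemma resonant_cosine :
  `|\sum_a (resonant (nsum a))%:R * (om S a * cosmult t a)| <=
  8 * \sum_a om S a * ((nsum a <= d)%N%:R +
     (d < nsum a)%N%:R * (Kres * psi (kap (nsum a) ^+ 2 * s0))).
Proof.
have rhs0 : 0 <= 8 * \sum_a om S a * ((nsum a <= d)%N%:R +
     (d < nsum a)%N%:R * (Kres * psi (kap (nsum a) ^+ 2 * s0))).
  apply: mulr_ge0 => //; apply: sumr_ge0 => a _; apply: mulr_ge0 => //.
  by apply: addr_ge0 => //; apply: mulr_ge0 => //; apply: mulr_ge0 => //; exact: Kres_ge0.
have [sz|snz] := eqVneq s0 0.
  rewrite big1 ?normr0 // => a _; rewrite /resonant sz mulr0 ltNge ler01 andbF.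
  by rewrite mul0r.
have sp : 0 < s0 by rewrite lt_def snz.
have ex : exists D, resonant D.
  pose K := (Num.truncn (128 * s0)^-1).+1.
  have iK : (128 * s0)^-1 < K%:R.
    have h : 0 <= (128 * s0)^-1 by rewrite invr_ge0 mulr_ge0.
    by have /andP[] := Num.Theory.truncn_itv h.
  have K1 : 1 <= K%:R :> R by rewrite ler1n.
  exists (d * K.+1)%N; rewrite /resonant.
  have -> : (d * K.+1)%:R / d%:R = K.+1%:R :> R by rewrite natrM mulrAC divff ?mul1r // gt_eqF.
  rewrite -[X in (X < _)%N]muln1 ltn_pmul2l // ltnS ltn0Sn /=.
  have s1 : 1 < 128 * s0 * K%:R.
    have p : 0 < 128 * s0 by rewrite mulr_gt0.
    by rewrite -(ltr_pM2l p) mulfV ?gt_eqF // in iK.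
  apply: lt_le_trans s1 _; rewrite -mulrA [leRHS]mulrAC -mulrA ler_wpM2l //.
  rewrite mulrC [leRHS]mulrC mulrC [leRHS]mulrC ler_wpM2l //.
  have : K%:R <= K.+1%:R :> R by rewrite ler_nat.
  have : K.+1%:R <= K.+1%:R ^+ 2 :> R by rewrite expr2 ler_peMr // ler1n.
  by move=> h1 h2; exact: le_trans h2 h1.
pose D1 := ex_minn ex.
have [r1 rmin] : resonant D1 /\ (forall D, resonant D -> (D1 <= D)%N).
  by rewrite /D1; case: ex_minnP.
have dD1 : (d < D1)%N by case/andP: r1.
have rE D : resonant D = (D1.-1 < D)%N.
  apply/idP/idP => [/rmin|h]; first by rewrite prednK //; apply: leq_ltn_trans dD1.
  apply: resonant_up r1; move: h; rewrite prednK //; exact: leq_ltn_trans dD1.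
have -> : \sum_a (resonant (nsum a))%:R * (om S a * cosmult t a) =
   \sum_a (D1.-1 < nsum a)%N%:R * (om S a * cosmult t a).
  by apply: eq_bigr => a _; rewrite rE.
apply: le_trans (resample dS (i := i0) D1.-1 sp) _; rewrite ler_wpM2l //.
have rs0 : 0 < Num.sqrt s0 by rewrite sqrtr_gt0.
have min0 (x : nat) : 0 <= Num.min 1 ((2 * x%:R + 1) * Num.sqrt s0)^-1.
  by rewrite le_min ler01 invr_ge0 mulr_ge0 ?(ltW rs0) // addr_ge0 // mulr_ge0.
have min1 (x : nat) : Num.min 1 ((2 * x%:R + 1) * Num.sqrt s0)^-1 <= 1.
  by rewrite ge_min lexx.
apply: le_trans (_ : `|\sum_a om S a * ((D1.-1 < 2 * nsum a)%N%:R *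
    Num.min 1 ((2 * (a i0)%:R + 1) * Num.sqrt s0)^-1)| <= _).
  apply: le_trans (ler_norm _); apply: ler_sum => a _.
  by rewrite le_eqVlt; apply/orP; left; apply/eqP; ring.
apply: (@sum_level_le _ _ _ S N NE (fun D a => (D1.-1 < 2 * D)%N%:R *
   Num.min 1 ((2 * (a i0)%:R + 1) * Num.sqrt s0)^-1)
   (fun D => (D <= d)%N%:R + (d < D)%N%:R * (Kres * psi (kap D ^+ 2 * s0)))).
move=> D DN.
have V0 : 0 <= \sum_a level S D a :> R.
  by apply: sumr_ge0 => a _; exact: (exch_ge0 (level_exch dS D) a).
case: (leqP D d) => dD /=.
  rewrite mul0r addr0; apply: (level_trivial dS D) => a.
  rewrite normrM normr_nat ger0_norm // mulr_ile1 //.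
  by case: ltnP.
rewrite add0r mul1r.
case: (ltnP D1.-1 (2 * D)) => h2 /=; last first.
  rewrite big1 ?normr0 => [|a _]; last by rewrite mul0r mulr0.
  by apply: mulr_ge0 => //; apply: mulr_ge0 => //; exact: Kres_ge0.
rewrite ger0_norm; last first.
  apply: sumr_ge0 => a _; apply: mulr_ge0; last by rewrite mul1r.
  exact: (exch_ge0 (level_exch dS D) a).
under eq_bigr do rewrite mul1r.
have k1 : 1 <= kap D by apply: kap_ge1; exact: ltnW.
have k0 : 0 < kap D by lra.
have u0 : 0 < kap D ^+ 2 * s0 by rewrite mulr_gt0 // exprn_gt0.
have s01 : 0 < s0 <= 1 by rewrite sp hsin2_le1.
apply: le_trans (level_resample d_gt0 (level_exch dS D) (@level_out _ _ _ S D)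
  (kapE D) k1 i0 s01 (root8_gt0 u0) (root8X (ltW u0))) _.
rewrite ler_wpM2r // /Kres -lock -mulrA ler_wpM2l //.
(* This bounds [kap D ^+ 2 * s0] below by [2 ^- 9], so the inverse eighth root is at most a constant
   times [psi]. *)
have : resonant (2 * D)%N by rewrite rE.
have e2 : (2 * D)%:R / d%:R = 2 * kap D by rewrite natrM -mulrA.
case/andP => _; rewrite e2 exprMn => h3.
have [K KE] : exists K : R, K = 2 ^+ 9 by eexists.
rewrite -KE; have K4 : K = 128 * 2 ^+ 2 by rewrite KE; ring.
have K1 : 1 <= K by rewrite KE exprn_ege1 // ler1n.
apply: root8V_le_psi K1 _.
by rewrite -div1r ler_pdivrMr ?(lt_le_trans ltr01 K1) // K4; move: h3; lra.
Qed.

(** Three pieces: on nonresonant levels the multipliers are compared level by level; on resonant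
    ones the comparison term is small by its own decay, and the cosine term by resampling. Each
    bound at a level [D > d] is moved to [N] at the cost [sqrt (N / D)], which [sqrt_ratio]
    averages; the levels up to [d] are rare by [level_tail_large]. *)
Lemma large_error : (16 * d <= N)%N ->
  `|\sum_a om S a * (cosmult t a - cmp t (nsum a))| <=
  (160 + 64 * (500 + 8 * Kres)) *
  (psi (N%:R / d%:R) + psi ((N%:R / d%:R) ^+ 2 * Ss) + psi ((N%:R / d%:R) ^+ 2 * s0)) * Om.
Proof.
move=> dN; set Q := Kres; have Q0 : 0 <= Q := Kres_ge0.
have N0 : (0 < N)%N by lia.
have NR : 0 < N%:R :> R by rewrite ltr0n.
have [l lE] : exists l, l = N%:R / d%:R :> R by eexists.
have l16 : 16 <= l.
  rewrite lE ler_pdivlMr //.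
  by have : (16 * d)%:R <= N%:R :> R; [rewrite ler_nat | rewrite natrM].
have l0 : 0 < l by lra.
have S0 : 0 <= Ss := hsum_ge0 t.
have S0' : 0 <= s0 := s00.
pose sq D : R := Num.sqrt (N%:R / D%:R).
pose A := psi l; pose B := psi (l ^+ 2 * Ss); pose C := psi (l ^+ 2 * s0).
have A0 : 0 <= A := ps0 _. have B0 : 0 <= B := ps0 _. have C0 : 0 <= C := ps0 _.
have sq0 D : 0 <= sq D := sqrtr_ge0 _.
have scale D (c : R) : (d < D)%N -> (D <= N)%N -> 0 <= c ->
    psi (kap D ^+ 2 * c) <= sq D * psi (l ^+ 2 * c).
  move=> dD DN c0.
  have DR : 0 < D%:R :> R by rewrite ltr0n (leq_ltn_trans _ dD).
  have kD : 0 < kap D by rewrite /kap divr_gt0.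
  have -> : sq D = Num.sqrt (l / kap D).
    by rewrite /sq lE /kap; congr Num.sqrt; field; rewrite !gt_eqF.
  by apply: psi_scale; rewrite // kD lE kap_le.
have invs D : (d < D)%N -> (D <= N)%N -> (Num.sqrt (kap D))^-1 <= sq D * A.
  move=> dD DN.
  have DR : 0 < D%:R :> R by rewrite ltr0n (leq_ltn_trans _ dD).
  have kD : 0 < kap D by rewrite /kap divr_gt0.
  have sl0 : 0 < Num.sqrt l by rewrite sqrtr_gt0.
  have sk0 : 0 < Num.sqrt (kap D) by rewrite sqrtr_gt0.
  have -> : sq D = Num.sqrt l / Num.sqrt (kap D).
    rewrite -sqrtrV ?ltW // -sqrtrM ?ltW //; congr Num.sqrt.
    by rewrite lE /kap; field; rewrite !gt_eqF.
  rewrite mulrAC ler_pdivlMr // mulVf ?gt_eqF // /A psi_large; last by lra.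
  rewrite ler_pdivlMr ?mul1r ?root8_gt0 //.
  apply: le_of_exp8; rewrite ?root8_ge0 ?sqrtr_ge0 // root8X ?(ltW l0) //.
  rewrite -[8%N]/(2 * 4)%N exprM sqr_sqrtr ?(ltW l0) //.
  by rewrite exprS ler_peMr ?(ltW l0) // exprn_ege1 //; lra.
have sumE : \sum_a om S a * (cosmult t a - cmp t (nsum a)) =
    \sum_a om S a * ((~~ resonant (nsum a))%:R * (cosmult t a - cmp t (nsum a)))
    - \sum_a om S a * ((resonant (nsum a))%:R * cmp t (nsum a))
    + \sum_a (resonant (nsum a))%:R * (om S a * cosmult t a).
  rewrite -sumrB -big_split /=; apply: eq_bigr => a _.
  by case: (resonant (nsum a)) => /=; ring.
pose E0 : R := \sum_a om S a * (nsum a <= d)%N%:R.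
pose E1 : R := \sum_a om S a * ((d < nsum a)%N%:R * sq (nsum a)).
have E0b : E0 <= 8 * A * Om.
  have : E0 <= 8 * 1%:R * d%:R / N%:R * Om.
    apply: le_trans (level_tail_large d_gt0 dS NE (isT : 0 < 1)%N N0).
    rewrite /E0 [leRHS]big_mkcond /=; apply: ler_sum => a _.
    by rewrite mul1n; case: leqP; rewrite ?mulr1 ?mulr0.
  move=> h; apply: le_trans h _; rewrite ler_wpM2r // mulr1 -mulrA ler_wpM2l //.
  rewrite (_ : d%:R / N%:R = l^-1); last by rewrite lE invfM invrK mulrC.
  by apply: psi_ge_large; lra.
have E1b : E1 <= 64 * Om := sqrt_ratio d_gt0 dS NE N0.
have E00 : 0 <= E0 by apply: sumr_ge0 => a _; rewrite mulr_ge0.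
have E10 : 0 <= E1 by apply: sumr_ge0 => a _; rewrite mulr_ge0 // mulr_ge0.
have comb (c1 c2 : R) (F : nat -> R) : 0 <= c1 ->
   (forall D, (D <= d)%N -> F D <= c1) -> (forall D, (d < D)%N -> (D <= N)%N -> F D <= c2 * sq D) ->
   \sum_a om S a * F (nsum a) <= c1 * E0 + c2 * E1.
  move=> c10 h1 h2; rewrite /E0 /E1 !mulr_sumr -big_split /=; apply: ler_sum => a _.
  have [Sa|Sa] := boolP (S a); last by rewrite om_eq0 // !mul0r !mulr0 addr0.
  have aN : (nsum a <= N)%N by rewrite -NE nsum_le_nmax.
  rewrite [leRHS](_ : _ = om S a * (c1 * (nsum a <= d)%N%:R +
     c2 * ((d < nsum a)%N%:R * sq (nsum a)))); last by ring.
  rewrite ler_wpM2l //; case: leqP => da /=.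
    by rewrite mul0r mulr0 addr0 mulr1; exact: h1.
  by rewrite mulr0 add0r mul1r; exact: h2.
have T1 : `|\sum_a om S a * ((~~ resonant (nsum a))%:R * (cosmult t a - cmp t (nsum a)))| <=
    2 * E0 + 110 * (B + A) * E1.
  apply: le_trans (@sum_level_le _ _ _ S N NE
    (fun D a => (~~ resonant D)%:R * (cosmult t a - cmp t D))
    (fun D => if (D <= d)%N then 2 else
       110 * (psi (kap D ^+ 2 * Ss) + (Num.sqrt (kap D))^-1)) _) _.
    move=> D DN; case: leqP => dD.
      apply: (level_trivial dS D) => a; rewrite normrM normr_nat.
      apply: le_trans (diff_le2 t d_gt0 D a); rewrite ler_piMl //.
      by case: (~~ _).
    have k1 : 1 <= kap D by apply: kap_ge1; exact: ltnW.
    have V0 : 0 <= \sum_a level S D a :> R.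
      by apply: sumr_ge0 => a _; exact: (exch_ge0 (level_exch dS D) a).
    have [rD|nD] := boolP (resonant D).
      rewrite big1 ?normr0 => [|a _]; last by rewrite mul0r mulr0.
      apply: mulr_ge0 => //; apply: mulr_ge0 => //; by apply: addr_ge0; rewrite ?psi_ge0 ?invr_ge0 ?sqrtr_ge0.
    rewrite /=; under eq_bigr do rewrite mul1r.
    apply: (level_large d_gt0 dS (kapE D) k1) => i.
    move: nD; rewrite /resonant dD /= -leNgt; apply: le_trans.
    by rewrite ler_wpM2l // mulr_ge0 // exprn_ge0.
  apply: (comb _ _ (fun D => if (D <= d)%N then 2 else
       110 * (psi (kap D ^+ 2 * Ss) + (Num.sqrt (kap D))^-1))) => //.
  - by move=> D ->.
  - move=> D dD DN; rewrite leqNgt dD /=.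
    have := scale D Ss dD DN S0; have := invs D dD DN; rewrite -/B => h1 h2.
    apply: le_trans (_ : 110 * (sq D * B + sq D * A) <= _).
      by rewrite ler_wpM2l // lerD.
    by rewrite le_eqVlt; apply/orP; left; apply/eqP; ring.
have T2 : `|\sum_a om S a * ((resonant (nsum a))%:R * cmp t (nsum a))| <=
    0 * E0 + 128 * B * E1.
  rewrite ger0_norm; last first.
    by apply: sumr_ge0 => a _; rewrite mulr_ge0 // mulr_ge0 // cmp_ge0.
  apply: (comb _ _ (fun D => (resonant D)%:R * cmp t D)) => //.
  - by move=> D dD; rewrite /resonant ltnNge dD /= mul0r.
  - move=> D dD DN.
    have [rD|_] := boolP (resonant D); last first.
      by rewrite mul0r mulr_ge0 // mulr_ge0.
    rewrite mul1r; apply: le_trans (_ : 128 * psi (kap D ^+ 2 * Ss) <= _); last first.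
      have := scale D Ss dD DN S0; rewrite -/B => h.
      by rewrite -mulrA ler_wpM2l // [leRHS]mulrC.
    have k1 : 1 <= kap D by apply: kap_ge1; exact: ltnW.
    case/andP: rD => _; rewrite -/(kap D) => h.
    have hS : 1 < 128 * (kap D ^+ 2 * Ss).
      by rewrite mulrA; apply: (lt_le_trans h); rewrite ler_wpM2l // mulr_ge0 // sqr_ge0.
    have [u1|u1] := leP (kap D ^+ 2 * Ss) 1.
      have : kap D ^+ 2 * Ss <= psi (kap D ^+ 2 * Ss).
        by apply: psi_ge_small; rewrite u1 andbT; lra.
      by have := cmp_le1 t d_gt0 D; lra.
    have c1 : cmp t D <= (kap D ^+ 2 * Ss)^-1.
      have up : 0 < kap D ^+ 2 * Ss by lra.
      by rewrite -[leRHS]mul1r ler_pdivlMr // cmp_decay2.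
    have := psi_ge_large (ltW u1); have := ps0 (kap D ^+ 2 * Ss); lra.
have T3 : `|\sum_a (resonant (nsum a))%:R * (om S a * cosmult t a)| <=
    8 * (1 * E0 + Q * C * E1).
  apply: le_trans resonant_cosine _; rewrite ler_wpM2l //.
  apply: (comb _ _ (fun D => (D <= d)%N%:R + (d < D)%N%:R * (Q * psi (kap D ^+ 2 * s0)))) => //.
  - by move=> D dD; rewrite dD ltnNge dD /= mul0r addr0.
  - move=> D dD DN; rewrite leqNgt dD /= add0r mul1r.
    have := scale D s0 dD DN S0'; rewrite -/C => h.
    by rewrite -mulrA ler_wpM2l // [leRHS]mulrC.
rewrite sumE -lE -/A -/B -/C.
apply: le_trans (ler_normD _ _) _.
apply: le_trans (lerD (ler_normB _ _) T3) _.
apply: le_trans (lerD (lerD T1 T2) (lexx _)) _.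
have BA : 0 <= B + A by rewrite addr_ge0.
have f1 : 110 * (B + A) * E1 <= 110 * (B + A) * (64 * Om) by rewrite ler_wpM2l // mulr_ge0.
have f2 : 128 * B * E1 <= 128 * B * (64 * Om) by rewrite ler_wpM2l // mulr_ge0.
have f3 : Q * C * E1 <= Q * C * (64 * Om) by rewrite ler_wpM2l // mulr_ge0.
have a1 : 0 <= A * Om by rewrite mulr_ge0.
have a2 : 0 <= B * Om by rewrite mulr_ge0.
have a3 : 0 <= C * Om by rewrite mulr_ge0.
have q1 : 0 <= Q * (A * Om) by rewrite mulr_ge0.
have q2 : 0 <= Q * (B * Om) by rewrite mulr_ge0.
have q3 : 0 <= Q * (C * Om) by rewrite mulr_ge0.
clearbody Q A B C E0 E1.
rewrite [leRHS](_ : _ = 160 * (A * Om + B * Om + C * Om) + 64 * (500 * (A * Om + B * Om + C * Om)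
   + 8 * (Q * (A * Om) + Q * (B * Om) + Q * (C * Om)))); last by ring.
lra.
Qed.

End LargeError.

(** * Square sums and the Cesaro maximal function *)

Section FiniteSums.
Context {R : realType}.

Lemma cauchy_schwarz_sum (I : finType) (x y : I -> R) :
  (\sum_i x i * y i) ^+ 2 <= (\sum_i x i ^+ 2) * (\sum_i y i ^+ 2).
Proof.
have : 0 <= \sum_i \sum_j (x i * y j - x j * y i) ^+ 2.
  by apply: sumr_ge0 => i _; apply: sumr_ge0 => j _; exact: sqr_ge0.
have -> : \sum_i \sum_j (x i * y j - x j * y i) ^+ 2 =
    (\sum_i x i ^+ 2) * (\sum_i y i ^+ 2) + (\sum_i x i ^+ 2) * (\sum_i y i ^+ 2)
    - 2 * (\sum_i x i * y i) ^+ 2.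
  have -> : (\sum_i x i * y i) ^+ 2 = \sum_i \sum_j x i * y i * (x j * y j).
    by rewrite expr2 mulr_suml; apply: eq_bigr => i _; rewrite mulr_sumr.
  have E : (\sum_i x i ^+ 2) * (\sum_i y i ^+ 2) = \sum_i \sum_j x i ^+ 2 * y j ^+ 2.
    by rewrite mulr_suml; apply: eq_bigr => i _; rewrite mulr_sumr.
  have E' : (\sum_i x i ^+ 2) * (\sum_i y i ^+ 2) = \sum_i \sum_j x j ^+ 2 * y i ^+ 2.
    by rewrite E exchange_big.
  rewrite [X in X + _ - _]E [X in _ + X - _]E' mulr_sumr -sumrN -!big_split /=.
  apply: eq_bigr => i _; rewrite mulr_sumr -sumrN -!big_split /=.
  by apply: eq_bigr => j _; ring.
lra.
Qed.

(** By Bernoulli's inequality the powers of a ratio above 1 exceed every [b]. It will remove a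
    constant that depends on the size of the torus. *)
Lemma le_of_exp_pow2 (b x y : R) : 0 <= x -> 0 <= y ->
  (forall j, x ^+ (2 ^ j) <= b * y ^+ (2 ^ j)) -> x <= y.
Proof.
move=> x0 y0 h; rewrite leNgt; apply/negP => yx.
have [y00|yn] := eqVneq y 0.
  have := h 0%N; rewrite expn0 !expr1 y00 mulr0; lra.
have yp : 0 < y by rewrite lt_def yn.
pose r := x / y - 1; have r0 : 0 < r by rewrite subr_gt0 ltr_pdivlMr // mul1r.
have bern (n : nat) : 1 + n%:R * r <= (x / y) ^+ n.
  elim: n => [|n IH]; first by rewrite mul0r addr0 expr0.
  have xy : x / y = 1 + r by rewrite /r; ring.
  rewrite exprS {1}xy; apply: le_trans (_ : (1 + r) * (1 + n%:R * r) <= _).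
    rewrite -natr1 -subr_ge0 [leRHS](_ : _ = n%:R * r ^+ 2); last by ring.
    by rewrite mulr_ge0 // sqr_ge0.
  by rewrite ler_wpM2l //; lra.
pose j := (Num.truncn (`|b| / r)).+1.
have jb : `|b| < j%:R * r.
  rewrite -ltr_pdivrMr //; have := @Num.Theory.truncn_itv R (`|b| / r).
  by rewrite divr_ge0 ?(ltW r0) // => /(_ isT) /andP[].
have hj : (x / y) ^+ (2 ^ j) <= b.
  by rewrite expr_div_n ler_pdivrMr ?exprn_gt0.
have : j%:R * r <= (2 ^ j)%:R * r by rewrite ler_wpM2r ?(ltW r0) // ler_nat ltnW // ltn_expl.
have := bern (2 ^ j)%N; have := ler_norm b; lra.
Qed.

(* Each term is at most the increment of the bounded nondecreasing potential
   min(z, q) / (q - 1) - q / ((q - 1) max(z, 1)). *)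
Lemma lacunary_sum (q : R) (z : nat -> R) (I : nat) : 1 < q -> (forall n, 0 <= z n) ->
  (forall n, (n.+1 < I)%N -> q * z n <= z n.+1) ->
  \sum_(n < I) Num.min (z n) (z n)^-1 <= 2 * q / (q - 1).
Proof.
move=> q1 z0 hz; have qm : 0 < q - 1 by lra.
have q0 : 0 < q by lra.
pose Phi (x : R) : R := Num.min x q / (q - 1) - q / (q - 1) / Num.max x 1.
have mx (x : R) : 1 <= Num.max x 1 by rewrite le_max lexx orbT.
have mx0 (x : R) : 0 < Num.max x 1 by apply: lt_le_trans (mx x).
have mono (x y : R) : x <= y -> Phi x <= Phi y.
  move=> xy; apply: lerB.
    by rewrite ler_wpM2r ?invr_ge0 ?(ltW qm) // le_min !ge_min xy lexx orbT.
  have mxy : Num.max x 1 <= Num.max y 1 by rewrite ge_max mx le_max xy.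
  by rewrite ler_wpM2l ?divr_ge0 ?(ltW qm) ?(ltW q0) // lef_pV2 ?posrE.
have step (x : R) : 0 <= x -> Num.min x x^-1 <= Phi (q * x) - Phi x.
  move=> x0; have [x1|x1] := leP x 1.
    apply: le_trans (_ : x <= _); first by rewrite ge_min lexx.
    have m1 : Num.min x q = x by apply: min_l; lra.
    have m2 : Num.min (q * x) q = q * x by apply: min_l; rewrite ler_piMr // ltW.
    have : q / (q - 1) / Num.max (q * x) 1 <= q / (q - 1) / Num.max x 1.
      rewrite ler_wpM2l ?divr_ge0 ?(ltW qm) ?(ltW q0) // lef_pV2 ?posrE //.
      rewrite (max_r x1) //.
    rewrite /Phi m1 m2; have : q * x / (q - 1) - x / (q - 1) = x by field; rewrite gt_eqF.
    lra.
  have xp : 0 < x by lra.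
  have qx : 1 < q * x by apply: (lt_trans x1); rewrite ltr_pMl.
  apply: le_trans (_ : x^-1 <= _); first by rewrite ge_min lexx orbT.
  have : Num.min x q / (q - 1) <= Num.min (q * x) q / (q - 1).
    rewrite ler_wpM2r ?invr_ge0 ?(ltW qm) // le_min !ge_min lexx orbT andbT.
    by rewrite ler_peMl ?(ltW xp) ?(ltW q1).
  rewrite /Phi (max_l (ltW x1)) (max_l (ltW qx)).
  have : q / (q - 1) / x - q / (q - 1) / (q * x) = x^-1 by field; rewrite !gt_eqF.
  lra.
have lo (x : R) : 0 <= x -> - (q / (q - 1)) <= Phi x.
  move=> x0; have : 0 <= Num.min x q / (q - 1).
    by rewrite divr_ge0 ?(ltW qm) // le_min x0 ltW.
  have : q / (q - 1) / Num.max x 1 <= q / (q - 1).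
    by rewrite ler_pdivrMr // ler_peMr // divr_ge0 // ltW.
  rewrite /Phi; lra.
have hi (x : R) : Phi x <= q / (q - 1).
  have : Num.min x q / (q - 1) <= q / (q - 1).
    by rewrite ler_wpM2r ?invr_ge0 ?(ltW qm) // ge_min lexx orbT.
  have : 0 <= q / (q - 1) / Num.max x 1.
    by rewrite divr_ge0 ?(ltW (mx0 x)) // divr_ge0 // ltW.
  rewrite /Phi; lra.
case: I hz => [|I] hz.
  by rewrite big_ord0 divr_ge0 ?(ltW qm) // mulr_ge0 // ltW.
have tel n : (n <= I)%N -> \sum_(k < n) Num.min (z k) (z k)^-1 <= Phi (z n) - Phi (z 0%N).
  elim: n => [|n IH] nI; first by rewrite big_ord0 subrr.
  rewrite big_ord_recr /=; have := IH (ltnW nI).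
  have := step _ (z0 n); have := mono _ _ (hz n nI); lra.
rewrite big_ord_recr /=; have := tel I (leqnn I); have := step _ (z0 I).
have := hi (q * z I); have := lo _ (z0 0%N); rewrite -mulrA; lra.
Qed.

End FiniteSums.

(** * Cesaro means of a symmetric Markov kernel *)

Section MarkovKernel.
Context {R : realType} {T : finType}.
Variable p : T -> T -> R.

Fixpoint pw (k : nat) (x y : T) : R :=
  if k is k'.+1 then \sum_z p x z * pw k' z y else (x == y)%:R.

Definition cesk (n : nat) (x y : T) : R := n.+1%:R^-1 * \sum_(k < n.+1) pw k x y.

Definition kapp (c : T -> T -> R) (f : T -> R) (x : T) : R := \sum_y c x y * f y.

Lemma pwD j k x y : pw (j + k) x y = \sum_z pw j x z * pw k z y.
Proof.
elim: j x => [|j IH] x /=.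
  rewrite (bigD1 x) //= eqxx mul1r big1 ?addr0 // => z zx.
  by rewrite eq_sym (negbTE zx) mul0r.
transitivity (\sum_w p x w * \sum_z pw j w z * pw k z y).
  by apply: eq_bigr => w _; rewrite IH.
transitivity (\sum_w \sum_z p x w * (pw j w z * pw k z y)).
  by apply: eq_bigr => w _; rewrite mulr_sumr.
rewrite exchange_big /=; apply: eq_bigr => z _.
by rewrite mulr_suml; apply: eq_bigr => w _; rewrite mulrA.
Qed.

Lemma pw1 x y : pw 1 x y = p x y.
Proof.
rewrite /= (bigD1 y) //= eqxx mulr1 big1 ?addr0 // => z zy.
by rewrite (negbTE zy) mulr0.
Qed.

Hypotheses (p_ge0 : forall x y, 0 <= p x y) (p_sym : forall x y, p x y = p y x).
Hypothesis (p_sum : forall x, \sum_y p x y = 1).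

Lemma pw_ge0 k x y : 0 <= pw k x y.
Proof.
elim: k x y => [|k IH] x y //=; apply: sumr_ge0 => z _; exact: mulr_ge0.
Qed.

Lemma pw_sym k x y : pw k x y = pw k y x.
Proof.
elim: k x y => [|k IH] x y; first by rewrite /= eq_sym.
rewrite -[in RHS]addn1 pwD [LHS]/=; apply: eq_bigr => z _.
by rewrite pw1 IH mulrC p_sym.
Qed.

Lemma pw_sum k x : \sum_y pw k x y = 1.
Proof.
elim: k x => [|k IH] x /=.
  rewrite (bigD1 x) //= eqxx big1 ?addr0 // => z zx.
  by rewrite eq_sym (negbTE zx).
rewrite exchange_big /= -[RHS](p_sum x); apply: eq_bigr => z _.
by rewrite -mulr_sumr IH mulr1.
Qed.

Lemma cesk_ge0 n x y : 0 <= cesk n x y.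
Proof. by rewrite mulr_ge0 // sumr_ge0 // => k _; exact: pw_ge0. Qed.

Lemma cesk_sym n x y : cesk n x y = cesk n y x.
Proof. by rewrite /cesk; congr (_ * _); apply: eq_bigr => k _; exact: pw_sym. Qed.

Lemma cesk_le1 n x y : cesk n x y <= 1.
Proof.
rewrite /cesk mulrC ler_pdivrMr // mul1r.
apply: le_trans (_ : \sum_(k < n.+1) 1 <= _); last by rewrite sumr_const card_ord.
apply: ler_sum => k _; rewrite -(pw_sum k x) (bigD1 y) //= lerDl sumr_ge0 // => z _.
exact: pw_ge0.
Qed.

(** The composition averages [pw (i + j)] over [i <= n] and [j <= m]. For fixed [j] the exponents
    are distinct and at most [2 * n], and [2 * n + 1 <= 2 * (n + 1)]. *)
Lemma cesk_comp n m x y : (m <= n)%N ->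
  \sum_z cesk n x z * cesk m z y <= 2 * cesk (2 * n) x y.
Proof.
move=> mn.
have -> : \sum_z cesk n x z * cesk m z y =
    n.+1%:R^-1 * (m.+1%:R^-1 * \sum_(j < m.+1) \sum_(i < n.+1) pw (i + j) x y).
  transitivity (\sum_z \sum_(j < m.+1) \sum_(i < n.+1)
     n.+1%:R^-1 * (m.+1%:R^-1 * (pw i x z * pw j z y))).
    apply: eq_bigr => z _.
    rewrite /cesk mulrACA mulrC mulr_suml exchange_big /= mulr_suml.
    apply: eq_bigr => i _; rewrite mulr_sumr mulr_suml.
    by apply: eq_bigr => j _; ring.
  rewrite exchange_big /= mulr_sumr mulr_sumr; apply: eq_bigr => j _.
  rewrite exchange_big /= mulr_sumr mulr_sumr; apply: eq_bigr => i _.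
  by rewrite -mulr_sumr -mulr_sumr pwD.
have inner (j : 'I_m.+1) : \sum_(i < n.+1) pw (i + j) x y <= \sum_(l < (2 * n).+1) pw l x y.
  rewrite -(big_mkord xpredT (fun i => pw (i + j) x y)).
  have -> : \sum_(0 <= i < n.+1) pw (i + j) x y = \sum_(0 + j <= l < n.+1 + j) pw l x y.
    by rewrite big_addn addnK.
  rewrite add0n.
  rewrite -(big_mkord xpredT (fun l => pw l x y)).
  have jm : (j <= m)%N by rewrite -ltnS ltn_ord.
  rewrite [leRHS](@big_cat_nat _ _ _ j) //=; last by lia.
  rewrite [in leRHS](@big_cat_nat _ _ _ (n.+1 + j) j) //=; [|lia|lia].
  rewrite addrCA lerDl addr_ge0 // sumr_ge0 // => l _; exact: pw_ge0.
apply: le_trans (_ : n.+1%:R^-1 * (m.+1%:R^-1 *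
   \sum_(j < m.+1) \sum_(l < (2 * n).+1) pw l x y) <= _).
  by rewrite ler_wpM2l // ler_wpM2l // ler_sum.
rewrite sumr_const card_ord -[X in _ * (_ * X) <= _]mulr_natl mulKf ?gt_eqF // /cesk mulrA.
rewrite ler_wpM2r ?sumr_ge0 // => [l _|]; first exact: pw_ge0.
rewrite -[2 in leRHS]invrK -invfM lef_pV2 ?posrE ?mulr_gt0 ?invr_gt0 //.
rewrite mulrC ler_pdivrMr // -natrM ler_nat; lia.
Qed.

(* T T* argument for the linearised maximal operator: Ces_n Ces_m <= 2 Ces_2n when
   m <= n, so the norm A satisfies A^2 <= 4 A; iterating this removes the crude
   initial bound. *)
Lemma cesaro_maximal (f : T -> R) (N : T -> nat) : (forall x, 0 <= f x) ->
  \sum_x (kapp (cesk (N x)) f x) ^+ 2 <= 16 * \sum_x f x ^+ 2.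
Proof.
move=> f0.
pose Q (f : T -> R) (N : T -> nat) : R := \sum_x (kapp (cesk (N x)) f x) ^+ 2.
pose F (f : T -> R) : R := \sum_x f x ^+ 2.
have F0 g : 0 <= F g by apply: sumr_ge0 => x _; exact: sqr_ge0.
have Q0 g N' : 0 <= Q g N' by apply: sumr_ge0 => x _; exact: sqr_ge0.
have app0 (g : T -> R) n x : (forall x, 0 <= g x) -> 0 <= kapp (cesk n) g x.
  by move=> g0; apply: sumr_ge0 => y _; rewrite mulr_ge0 ?cesk_ge0.
pose c : R := #|T|%:R.
pose b : R := c ^+ 2.
(* A crude bound from entries at most 1; its factor [#|T| ^+ 2] disappears at the end through
   [le_of_exp_pow2]. *)
have base (g : T -> R) N' : (forall x, 0 <= g x) -> Q g N' <= b * F g.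
  move=> g0; apply: le_trans (_ : \sum_(x : T) c * F g <= _); last first.
    by rewrite sumr_const -[_ *+ _]mulr_natl /b expr2 mulrA.
  apply: ler_sum => x _; apply: le_trans (_ : (\sum_y 1 * g y) ^+ 2 <= _).
    rewrite lerXn2r ?nnegrE ?app0 ?sumr_ge0 // => [y _|]; first by rewrite mul1r.
    by apply: ler_sum => y _; rewrite ler_wpM2r ?cesk_le1.
  apply: le_trans (cauchy_schwarz_sum (fun=> 1) g) _.
  by rewrite (eq_bigr (fun=> 1)) ?sumr_const // => y _; rewrite expr1n.
(* With [h] the linearised maximal function of [g], [Q g N'] is the pairing of [g] with [w], the
   adjoint applied to [h]. The norm of [w] leads back to averages of [h] at the doubled times, so
   the bootstrap passes from [(g, N')] to [(h, N2)] without naming an operator norm. *)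
have step (g : T -> R) N' : (forall x, 0 <= g x) -> exists h N2, (forall x, 0 <= h x) /\
    F h = Q g N' /\ Q g N' ^+ 4 <= 16 * F g ^+ 2 * (Q g N' * Q h N2).
  move=> g0; pose h x := kapp (cesk (N' x)) g x.
  have h0 x : 0 <= h x by exact: app0.
  exists h, (fun x => 2 * N' x)%N; split => //; split => //.
  pose w y := \sum_x h x * cesk (N' x) x y.
  have QE : Q g N' = \sum_y g y * w y.
    rewrite /Q; under eq_bigr do rewrite expr2 {2}/kapp mulr_sumr.
    rewrite exchange_big /=; apply: eq_bigr => y _.
    by rewrite /w mulr_sumr; apply: eq_bigr => x _; rewrite /h; ring.
  pose E := \sum_x h x * kapp (cesk (2 * N' x)) h x.
  have E0 : 0 <= E by apply: sumr_ge0 => x _; rewrite mulr_ge0 ?app0.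
  have wE : \sum_y w y ^+ 2 <= 4 * E.
    pose G x x' := \sum_y cesk (N' x) x y * cesk (N' x') y x'.
    have G0 x x' : 0 <= G x x' by apply: sumr_ge0 => y _; rewrite mulr_ge0 ?cesk_ge0.
    have Gs x x' : G x x' = G x' x.
      apply: eq_bigr => y _; by rewrite mulrC cesk_sym (cesk_sym (N' x)).
    have -> : \sum_y w y ^+ 2 = \sum_x \sum_x' h x * h x' * G x x'.
      rewrite /w; under eq_bigr do rewrite expr2 mulr_suml.
      rewrite exchange_big /=; apply: eq_bigr => x _.
      under eq_bigr do rewrite mulr_sumr.
      rewrite exchange_big /=; apply: eq_bigr => x' _.
      rewrite /G mulr_sumr; apply: eq_bigr => y _; rewrite (cesk_sym (N' x') y); ring.
    (* Each pair is charged to the point with the larger time, where [cesk_comp] applies; both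
       halves are bounded by [2 * E]. *)
    pose le1 x x' : R := (N' x' <= N' x)%N%:R.
    apply: le_trans (_ : \sum_x \sum_x' (le1 x x' * (h x * h x' * G x x') +
        le1 x' x * (h x' * h x * G x' x)) <= _).
      apply: ler_sum => x _; apply: ler_sum => x' _.
      rewrite (Gs x') (mulrC (h x')) -mulrDl ler_peMl ?mulr_ge0 //.
      by rewrite /le1 -natrD ler1n addn_gt0 !lt0b leq_total.
    under eq_bigr do rewrite big_split /=.
    rewrite big_split /= [X in _ + X]exchange_big /=.
    have half : \sum_x \sum_x' le1 x x' * (h x * h x' * G x x') <= 2 * E.
      rewrite /E mulr_sumr; apply: ler_sum => x _.
      rewrite /kapp mulr_sumr mulr_sumr; apply: ler_sum => x' _.
      rewrite /le1; case: leqP => hN; last first.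
        by rewrite mul0r mulr_ge0 // mulr_ge0 // mulr_ge0 // cesk_ge0.
      rewrite mul1r [leRHS](_ : _ = h x * h x' * (2 * cesk (2 * N' x) x x')); last by ring.
      by rewrite ler_wpM2l ?mulr_ge0 // cesk_comp.
    apply: le_trans (lerD half half) _; lra.
  have c1 : Q g N' ^+ 2 <= F g * (4 * E).
    by rewrite QE; apply: le_trans (cauchy_schwarz_sum g w) _; apply: ler_wpM2l wE; exact: F0.
  have c2 : E ^+ 2 <= F h * Q h (fun x => 2 * N' x)%N := cauchy_schwarz_sum _ _.
  have -> : Q g N' ^+ 4 = (Q g N' ^+ 2) ^+ 2 by rewrite -exprM.
  apply: le_trans (_ : (F g * (4 * E)) ^+ 2 <= _).
    by rewrite lerXn2r ?nnegrE ?sqr_ge0 // mulr_ge0 // mulr_ge0.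
  have -> : (F g * (4 * E)) ^+ 2 = 16 * F g ^+ 2 * E ^+ 2 by ring.
  by rewrite ler_wpM2l // mulr_ge0 // sqr_ge0.
(* Induction for all [g] and [N'] at once: the hypothesis is applied to [h], whose squared norm
   [F h] is [Q g N']. *)
have main j (g : T -> R) N' : (forall x, 0 <= g x) -> Q g N' ^+ (2 ^ j) <= b * (16 * F g) ^+ (2 ^ j).
  elim: j g N' => [|j IH] g N' g0.
    rewrite expn0 !expr1; apply: le_trans (base g N' g0) _.
    have b0 : 0 <= b by exact: sqr_ge0.
    by rewrite ler_wpM2l //; have := F0 g; lra.
  have b0 : 0 <= b by exact: sqr_ge0.
  have [Qz|Qn] := eqVneq (Q g N') 0.
    by rewrite Qz expr0n expn_eq0 /= mulr_ge0 // exprn_ge0 // mulr_ge0.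
  have Qp : 0 < Q g N' by rewrite lt_def Qn Q0.
  have [h [N2 [h0 [Fh hQ]]]] := step g N' g0.
  have hQ3 : Q g N' ^+ 3 <= 16 * F g ^+ 2 * Q h N2.
    by rewrite -(ler_pM2l Qp) -exprS; apply: le_trans hQ _; rewrite mulrCA.
  have := IH h N2 h0; rewrite Fh => IHh.
  set n := (2 ^ j)%N in IHh *.
  have -> : (2 ^ j.+1)%N = (n + n)%N by rewrite expnS mul2n addnn.
  have Qn0 : 0 < Q g N' ^+ n by rewrite exprn_gt0.
  rewrite -(ler_pM2r Qn0) -exprD.
  have -> : (n + n + n = 3 * n)%N by lia.
  rewrite exprM; apply: le_trans (_ : (16 * F g ^+ 2 * Q h N2) ^+ n <= _).
    by rewrite lerXn2r ?nnegrE ?exprn_ge0 // !mulr_ge0 ?sqr_ge0.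
  rewrite exprMn; apply: le_trans (_ : (16 * F g ^+ 2) ^+ n * (b * (16 * Q g N') ^+ n) <= _).
    by rewrite ler_wpM2l // exprn_ge0 // mulr_ge0 // sqr_ge0.
  rewrite le_eqVlt; apply/orP; left; apply/eqP.
  have -> : (16 * F g) ^+ (n + n) = (16 * F g ^+ 2) ^+ n * 16 ^+ n.
    by rewrite exprD -!exprMn; congr (_ ^+ n); ring.
  by rewrite [(16 * Q g N') ^+ n]exprMn; ring.
apply: (@le_of_exp_pow2 R b) => [||j]; [exact: Q0 | apply: mulr_ge0 => //; exact: F0 | exact: (main j f N f0)].
Qed.

End MarkovKernel.

Lemma kapp_dominated {R : realType} {T : finType} (p p' : T -> T -> R) :
  (forall x y, `|p' x y| <= p x y) -> forall n f x,
  `|kapp (cesk p' n) f x| <= kapp (cesk p n) (fun y => `|f y|) x.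
Proof.
move=> h n f x.
have pw_le k y : `|pw p' k x y| <= pw p k x y.
  elim: k x => [|k IH] x /=; first by rewrite normr_nat.
  apply: le_trans (ler_norm_sum _ _ _) _; apply: ler_sum => z _.
  by rewrite normrM ler_pM.
apply: le_trans (ler_norm_sum _ _ _) _; apply: ler_sum => y _.
rewrite normrM ler_wpM2r // normrM ger0_norm ?invr_ge0 // ler_wpM2l //.
by apply: le_trans (ler_norm_sum _ _ _) _; apply: ler_sum.
Qed.

(** * Hartley analysis on the torus *)

Section Hartley1.
Context {R : realType} {Q : nat}.
Implicit Types (k x y : 'I_Q.+1) (u v : R).

Definition cas u : R := cos u + sin u.
Definition freq1 k : R := 2 * pi * k%:R / Q.+1%:R.
Definition cs k x : R := cas (x%:R * freq1 k).

Lemma cs_sym k x : cs k x = cs x k.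
Proof. by rewrite /cs /freq1; congr cas; ring. Qed.

Lemma cos_sinD2pin (n : nat) u :
  cos (u + n%:R * (2 * pi)) = cos u /\ sin (u + n%:R * (2 * pi)) = sin u.
Proof.
elim: n => [|n [IH1 IH2]]; first by rewrite mul0r addr0.
have -> : u + n.+1%:R * (2 * pi) = u + n%:R * (2 * pi) + pi *+ 2.
  by rewrite -[n.+1%:R]natr1 -[pi *+ 2]mulr_natl; ring.
by rewrite cosD2pi sinD2pi.
Qed.

Lemma cos_sin_modn (n : nat) k :
  cos ((n %% Q.+1)%N%:R * freq1 k) = cos (n%:R * freq1 k) /\
  sin ((n %% Q.+1)%N%:R * freq1 k) = sin (n%:R * freq1 k).
Proof.
have [<- <-] := cos_sinD2pin (n %/ Q.+1 * k) ((n %% Q.+1)%N%:R * freq1 k).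
suff -> : (n %% Q.+1)%N%:R * freq1 k + (n %/ Q.+1 * k)%N%:R * (2 * pi) = n%:R * freq1 k :> R.
  by [].
rewrite {3}(divn_eq n Q.+1) /freq1 !natrD !natrM; field.
by rewrite addrC natr1.
Qed.

(** This is cas(u + v) + cas(u - v) = 2 cas(u) cos(v). Only addition modulo [Q.+1] is expanded; [x]
    itself is rewritten as the shift of [x - inZp a] by [inZp a]. *)
Lemma cs_shift k x (a : nat) : (cs k (x + inZp a) + cs k (x - inZp a)) / 2 =
  cs k x * cos (a%:R * freq1 k).
Proof.
have plus y : cos ((y + inZp a)%R%:R * freq1 k) =
      cos (y%:R * freq1 k) * cos (a%:R * freq1 k) - sin (y%:R * freq1 k) * sin (a%:R * freq1 k) /\
    sin ((y + inZp a)%R%:R * freq1 k) =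
      sin (y%:R * freq1 k) * cos (a%:R * freq1 k) + cos (y%:R * freq1 k) * sin (a%:R * freq1 k).
  have -> : (y + inZp a)%R = ((y + a) %% Q.+1)%N :> nat by rewrite /= modnDmr.
  have [-> ->] := cos_sin_modn (y + a) k.
  by rewrite natrD mulrDl cosD sinD.
rewrite /cs /cas.
have [-> ->] := plus x; have [] := plus (x - inZp a); rewrite subrK => -> ->.
have := cos2Dsin2 (a%:R * freq1 k).
set C := cos (a%:R * _); set S := sin (a%:R * _); set c := cos _; set s := sin _ => h.
have -> : (c * C - s * S) * C - (s * C + c * S) * S + ((s * C + c * S) * C + (c * C - s * S) * S)
  + (c + s) = (c * C - s * S + (s * C + c * S)) * C * 2 + (c + s) * (1 - (C ^+ 2 + S ^+ 2)) by ring.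
by rewrite h subrr mulr0 addr0 mulfK.
Qed.

(* Rotating by u maps the pair of sums to itself; for cos u <> 1 the only fixed vector
   of the rotation is 0. *)
Lemma sum_cos_sin u (m : nat) : Q.+1%:R * u = m%:R * (2 * pi) -> cos u != 1 ->
  \sum_(k < Q.+1) cos (k%:R * u) = 0 /\ \sum_(k < Q.+1) sin (k%:R * u) = 0.
Proof.
move=> hm c1.
have shift (g : nat -> R) : g Q.+1 = g 0%N -> \sum_(k < Q.+1) g k.+1 = \sum_(k < Q.+1) g k.
  by move=> g0; rewrite big_ord_recr [RHS]big_ord_recl /= g0 addrC.
have [cm sm] := cos_sinD2pin m 0; rewrite add0r in cm sm.
set C := \sum_k cos _; set S := \sum_k sin _.
have eC : C = C * cos u - S * sin u.
  rewrite {1}/C -(shift (fun k : nat => cos (k%:R * u))); last by rewrite hm cm mul0r.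
  rewrite mulr_suml mulr_suml -sumrB; apply: eq_bigr => k _.
  by rewrite -[k.+1%:R]natr1 mulrDl mul1r cosD.
have eS : S = S * cos u + C * sin u.
  rewrite {1}/S -(shift (fun k : nat => sin (k%:R * u))); last by rewrite hm sm mul0r.
  rewrite mulr_suml mulr_suml -big_split; apply: eq_bigr => k _.
  by rewrite -[k.+1%:R]natr1 mulrDl mul1r sinD.
have cs1 := cos2Dsin2 u.
have nz : 2 * (1 - cos u) != 0 by rewrite mulf_neq0 // subr_eq0 eq_sym.
have e1 : C * (1 - cos u) + S * sin u = 0 by rewrite mulrBr mulr1 {1}eC; ring.
have e2 : S * (1 - cos u) - C * sin u = 0 by rewrite mulrBr mulr1 {1}eS; ring.
have f : (1 - cos u) ^+ 2 + sin u ^+ 2 = 2 * (1 - cos u).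
  have -> : (1 - cos u) ^+ 2 + sin u ^+ 2 = (cos u ^+ 2 + sin u ^+ 2) + 1 - 2 * cos u by ring.
  by rewrite cs1; ring.
split; apply: (mulIf nz); rewrite mul0r -f.
  transitivity ((C * (1 - cos u) + S * sin u) * (1 - cos u) -
    (S * (1 - cos u) - C * sin u) * sin u); first by ring.
  by rewrite e1 e2; ring.
transitivity ((C * (1 - cos u) + S * sin u) * sin u +
    (S * (1 - cos u) - C * sin u) * (1 - cos u)); first by ring.
by rewrite e1 e2; ring.
Qed.

Lemma cos_eq1 u : 0 < u < 2 * pi -> cos u != 1.
Proof.
move=> /andP[u0 u2]; have s0 : 0 < sin (u / 2) by apply: sin_gt0_pi; apply/andP; split; lra.
have -> : u = u / 2 + u / 2 by field.
have := cos2Dsin2 (u / 2); rewrite cosD => h; apply/eqP => e.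
have : 0 < sin (u / 2) * sin (u / 2) by rewrite mulr_gt0.
rewrite !expr2 in h; lra.
Qed.

(** One has cas(u) cas(v) = cos(u - v) + sin(u + v). The sine sum vanishes for every pair, and the
    cosine sum is the usual orthogonality of roots of unity. *)
Lemma cs_orth x y : \sum_k cs k x * cs k y = Q.+1%:R * (x == y)%:R.
Proof.
pose al (n : nat) : R := 2 * pi * n%:R / Q.+1%:R.
have n0 : Q.+1%:R != 0 :> R by rewrite pnatr_eq0.
have N0 : 0 < Q.+1%:R :> R by rewrite ltr0n.
have alN n : Q.+1%:R * al n = n%:R * (2 * pi) by rewrite /al mulrC divfK // mulrC.
have split : \sum_k cs k x * cs k y =
   \sum_(k < Q.+1) cos (k%:R * (al x - al y)) + \sum_(k < Q.+1) sin (k%:R * al (x + y)%N).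
  rewrite -big_split; apply: eq_bigr => k _.
  have -> : cs k x = cas (k%:R * al x) by rewrite cs_sym.
  have -> : cs k y = cas (k%:R * al y) by rewrite cs_sym.
  have -> : al (x + y)%N = al x + al y by rewrite /al natrD; field.
  by rewrite /= mulrBr (mulrDr k%:R) cosB sinD /cas; ring.
have S0 : \sum_(k < Q.+1) sin (k%:R * al (x + y)%N) = 0.
  have [c1|c1] := eqVneq (cos (al (x + y)%N)) 1; last first.
    by have [] := sum_cos_sin (alN _) c1.
  have s1 : sin (al (x + y)%N) = 0.
    have := cos2Dsin2 (al (x + y)%N); rewrite c1 expr1n => h.
    by apply/eqP; rewrite -sqrf_eq0 -(inj_eq (addrI 1)) h addr0.
  have cs1 (k : nat) : cos (k%:R * al (x + y)%N) = 1 /\ sin (k%:R * al (x + y)%N) = 0.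
    elim: k => [|k [IH1 IH2]]; first by rewrite mul0r cos0 sin0.
    rewrite -[k.+1%:R]natr1 mulrDl mul1r cosD sinD IH1 IH2 c1 s1.
    by rewrite !mulr0 !mul0r mulr1 subr0 addr0.
  by apply: big1 => k _; have [] := cs1 k.
rewrite split S0 addr0; have [->|xy] := eqVneq x y.
  rewrite mulr1 (eq_bigr (fun=> 1)) ?sumr_const ?card_ord // => k _.
  by rewrite subrr mulr0 cos0.
rewrite mulr0.
wlog yx : x y xy {split S0} / (y < x)%N.
  move=> W; have [yx|xy'] := ltnP y x; first exact: W.
  have yx : (x < y)%N by rewrite ltn_neqAle xy' andbT; apply: contraNneq xy => /val_inj ->.
  rewrite eq_sym in xy; apply: etrans (W y x xy yx).
  by apply: eq_bigr => k _; rewrite -cosN -mulrN opprB.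
have alB : al x - al y = al (x - y)%N by rewrite /al natrB 1?ltnW //; field.
rewrite alB; apply: (sum_cos_sin (alN _) _).1; apply: cos_eq1; apply/andP; split.
  by rewrite /al divr_gt0 // mulr_gt0 ?ltr0n ?subn_gt0 // mulr_gt0 // pi_gt0.
rewrite /al ltr_pdivrMr // ltr_pM2l; last by rewrite mulr_gt0 // pi_gt0.
by rewrite ltr_nat (leq_ltn_trans (leq_subr _ _)).
Qed.

End Hartley1.

Definition torus (d Q : nat) := {ffun 'I_d -> 'I_Q.+1}.

Section Hartley.
Context {R : realType} {d Q : nat}.
Notation T := (torus d Q).
Implicit Types (k x y : T) (f : T -> R) (K : T -> T -> R).

Definition chi k x : R := \prod_i cs (k i) (x i).
Definition freq k : 'I_d -> R := fun i => freq1 (k i).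
Definition hart f k : R := \sum_x f x * chi k x.
Definition vol : R := Q.+1%:R ^+ d.

Lemma vol_gt0 : 0 < vol. Proof. by rewrite exprn_gt0. Qed.

Lemma chi_sym k x : chi k x = chi x k.
Proof. by apply: eq_bigr => i _; exact: cs_sym. Qed.

Lemma chi_orth x y : \sum_k chi k x * chi k y = vol * (x == y)%:R.
Proof.
transitivity (\prod_i \sum_(j : 'I_Q.+1) cs j (x i) * cs j (y i) : R).
  by rewrite bigA_distr_bigA /=; apply: eq_bigr => k _; rewrite -big_split.
under eq_bigr do rewrite cs_orth.
rewrite big_split /= prodr_const card_ord; congr (_ * _).
have [->|xy] := eqVneq x y; first by rewrite big1 // => i _; rewrite eqxx.
have [i hi] : exists i, x i != y i.
  by apply/existsP; apply: contraNT xy; rewrite negb_exists => /forallP h;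
    apply/eqP/ffunP => i; apply/eqP; rewrite -[_ == _]negbK h.
by rewrite (bigD1 i) //= (negbTE hi) mul0r.
Qed.

Lemma parseval f : \sum_k hart f k ^+ 2 = vol * \sum_x f x ^+ 2.
Proof.
transitivity (\sum_k \sum_x \sum_y f x * f y * (chi k x * chi k y)).
  apply: eq_bigr => k _; rewrite expr2 mulr_suml; apply: eq_bigr => x _.
  by rewrite mulr_sumr; apply: eq_bigr => y _; ring.
rewrite exchange_big mulr_sumr; apply: eq_bigr => x _.
rewrite exchange_big /= (bigD1 x) //= -mulr_sumr chi_orth eqxx mulr1.
rewrite big1 ?addr0 => [|y yx]; first by ring.
by rewrite -mulr_sumr chi_orth eq_sym (negbTE yx) !mulr0.
Qed.

Lemma hartB f g k : hart (fun x => f x - g x) k = hart f k - hart g k.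
Proof. by rewrite /hart -sumrB; apply: eq_bigr => x _; rewrite mulrBl. Qed.

(** [chi] is symmetric in its two arguments, so the transform inverts itself up to [vol] and
    frequencies can be cut off freely. *)
Lemma hart_split (B : pred T) f : exists f1 f2, (forall x, f x = f1 x + f2 x) /\
  (forall k, hart f1 k = (B k)%:R * hart f k) /\
  (forall k, hart f2 k = (~~ B k)%:R * hart f k).
Proof.
pose inv (g : T -> R) x := vol^-1 * \sum_k g k * chi k x.
have hinv g k : hart (inv g) k = g k.
  rewrite /hart /inv.
  transitivity (vol^-1 * \sum_l \sum_x g l * (chi x l * chi x k)).
    rewrite exchange_big mulr_sumr; apply: eq_bigr => x _.
    rewrite -mulrA mulr_suml; congr (_ * _); apply: eq_bigr => l _.
    by rewrite -mulrA (chi_sym l) (chi_sym k).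
  rewrite (bigD1 k) //= -mulr_sumr chi_orth eqxx mulr1 big1 => [|l lk].
    by rewrite addr0 mulrCA mulVf ?mulr1 // gt_eqF // vol_gt0.
  by rewrite -mulr_sumr chi_orth (negbTE lk) !mulr0.
pose f1 := inv (fun k => (B k)%:R * hart f k).
exists f1, (fun x => f x - f1 x); split; first by move=> x; rewrite addrC subrK.
split=> k; first exact: hinv.
by rewrite hartB hinv; case: (B k); rewrite /= ?mul0r ?mul1r ?subrr ?subr0.
Qed.

(** Stated through the transform rather than through eigenfunctions, so that it passes at once to
    compositions, sums and powers. *)
Definition multK K (m : T -> R) := forall f k, hart (kapp K f) k = m k * hart f k.

Lemma multK_sym K m : (forall x y, K x y = K y x) ->
  (forall k x, \sum_y K x y * chi k y = m k * chi k x) -> multK K m.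
Proof.
move=> sK eK f k; rewrite /hart /kapp.
under eq_bigr do rewrite mulr_suml.
rewrite exchange_big mulr_sumr; apply: eq_bigr => y _ /=.
rewrite [RHS]mulrCA -eK mulr_sumr; apply: eq_bigr => x _.
by rewrite sK; ring.
Qed.

Lemma multK_pw K m j : multK K m -> multK (pw K j) (fun k => m k ^+ j).
Proof.
move=> h; elim: j => [|j IH] f k.
  rewrite mul1r /hart /kapp; apply: eq_bigr => x _; congr (_ * _).
  rewrite /= (bigD1 x) //= eqxx mul1r big1 ?addr0 // => z zx.
  by rewrite eq_sym (negbTE zx) mul0r.
transitivity (hart (kapp K (kapp (pw K j) f)) k); last by rewrite h IH exprS mulrA.
apply: eq_bigr => x _; congr (_ * _); rewrite /kapp /=.
under eq_bigr do rewrite mulr_suml.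
rewrite exchange_big /=; apply: eq_bigr => z _; rewrite mulr_sumr.
by apply: eq_bigr => y _; rewrite mulrA.
Qed.

Lemma multK_sum (I : finType) (c : I -> R) (K : I -> T -> T -> R) (m : I -> T -> R) :
  (forall i, multK (K i) (m i)) ->
  multK (fun x y => \sum_i c i * K i x y) (fun k => \sum_i c i * m i k).
Proof.
move=> h f k; rewrite mulr_suml.
transitivity (\sum_i c i * hart (kapp (K i) f) k); last first.
  by apply: eq_bigr => i _; rewrite h mulrA.
rewrite /hart /kapp; under [RHS]eq_bigr do rewrite mulr_sumr.
rewrite [RHS]exchange_big; apply: eq_bigr => x _ /=.
under eq_bigr do rewrite mulr_suml.
rewrite exchange_big mulr_suml; apply: eq_bigr => i _ /=.
by rewrite mulrA mulr_sumr; congr (_ * _); apply: eq_bigr => y _; rewrite mulrA.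
Qed.

Lemma multKB K K' m m' : multK K m -> multK K' m' ->
  multK (fun x y => K x y - K' x y) (fun k => m k - m' k).
Proof.
move=> h h' f k; rewrite mulrBl -h -h' -hartB; apply: eq_bigr => x _.
by congr (_ * _); rewrite /kapp -sumrB; apply: eq_bigr => y _; rewrite mulrBl.
Qed.

Lemma eq_multK K K' m m' : (forall x y, K x y = K' x y) -> (forall k, m k = m' k) ->
  multK K m -> multK K' m'.
Proof.
move=> hK hm h f k; rewrite -hm -h; apply: eq_bigr => x _; congr (_ * _).
by apply: eq_bigr => y _; rewrite hK.
Qed.

Lemma multK_cesk K m n : multK K m -> multK (cesk K n) (fun k => ces n (m k)).
Proof.
move=> h; have := multK_sum (fun=> n.+1%:R^-1) (fun j : 'I_n.+1 => multK_pw j h).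
by apply: eq_multK => [x y|k]; rewrite -mulr_sumr.
Qed.

End Hartley.

(** * Averages over sign changes, and the lazy walk *)

Section Shifts.
Context {R : realType} {d Q M : nat}.
Notation T := (torus d Q).
Implicit Types (k x y : T) (a : nvec d M) (e : {ffun 'I_d -> bool}).

Definition sshift a e x : T :=
  [ffun i => if e i then x i + inZp (a i) else x i - inZp (a i)].
Definition flipe e : {ffun 'I_d -> bool} := [ffun i => ~~ e i].

Lemma flipeK : involutive flipe.
Proof. by move=> e; apply/ffunP => i; rewrite !ffunE negbK. Qed.

Lemma sshiftK a e : cancel (sshift a e) (sshift a (flipe e)).
Proof.
by move=> x; apply/ffunP => i; rewrite !ffunE; case: (e i); rewrite /= ?addrK ?subrK.
Qed.

(** All [2 ^ d] sign patterns count, with repetition where [a i = 0]. *)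
Definition uker a x y : R := 2^-1 ^+ d * \sum_e (sshift a e x == y)%:R.

Lemma uker_ge0 a x y : 0 <= uker a x y.
Proof. by rewrite mulr_ge0 ?exprn_ge0 ?invr_ge0 // sumr_ge0. Qed.

Lemma uker_sym a x y : uker a x y = uker a y x.
Proof.
rewrite /uker; congr (_ * _); rewrite (reindex_inj (inv_inj flipeK)) /=.
apply: eq_bigr => e _; congr ((nat_of_bool _)%:R); apply/idP/idP => /eqP <-; apply/eqP; last exact: sshiftK.
by rewrite -{1}(flipeK e) sshiftK.
Qed.

Lemma uker_app a (f : T -> R) x :
  kapp (uker a) f x = 2^-1 ^+ d * \sum_e f (sshift a e x).
Proof.
rewrite /kapp /uker; under eq_bigr do rewrite -mulrA mulr_suml.
rewrite -mulr_sumr exchange_big /=; congr (_ * _); apply: eq_bigr => e _.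
rewrite (bigD1 (sshift a e x)) //= eqxx mul1r big1 ?addr0 // => y yx.
by rewrite eq_sym (negbTE yx) mul0r.
Qed.

Lemma uker_sum a x : \sum_y uker a x y = 1.
Proof.
transitivity (kapp (uker a) (fun=> 1) x); first by apply: eq_bigr => y _; rewrite mulr1.
rewrite uker_app sumr_const card_ffun card_bool card_ord natrX -exprMn mulVf ?expr1n //.
Qed.

Lemma multK_uker a : multK (uker a) (fun k => cosmult (freq k) a : R).
Proof.
apply: multK_sym => [x y|k x]; first exact: uker_sym.
transitivity (kapp (uker a) (chi k) x) => //; rewrite uker_app /cosmult /chi.
transitivity (\prod_i \sum_(b : bool) 2^-1 *
    cs (k i) (if b then x i + inZp (a i) else x i - inZp (a i)) : R).
  rewrite bigA_distr_bigA /= mulr_sumr; apply: eq_bigr => e _.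
  rewrite big_split prodr_const card_ord /=; congr (_ * _).
  by apply: eq_bigr => i _; rewrite ffunE.
rewrite -big_split; apply: eq_bigr => i _ /=.
rewrite (bigD1 true) //= (bigD1 false) //= big1 ?addr0 => [|[] //].
by rewrite -mulrDr mulrC cs_shift mulrC.
Qed.

End Shifts.

Section Walk.
Context {R : realType} {d Q : nat}.
Notation T := (torus d Q).
Implicit Types (k x y : T) (i : 'I_d).

Definition unitv i : nvec d 1 := [ffun j => inord (j == i)].

Definition pker x y : R := d%:R^-1 * \sum_i 2^-1 * ((x == y)%:R + uker (unitv i) x y).
(* 1 - pker, in a form that shows its domination by pker *)
Definition tker x y : R := d%:R^-1 * \sum_i 2^-1 * ((x == y)%:R - uker (unitv i) x y).

Lemma pker_ge0 x y : 0 <= pker x y.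
Proof.
rewrite mulr_ge0 // sumr_ge0 // => i _.
by rewrite mulr_ge0 ?invr_ge0 // addr_ge0 // uker_ge0.
Qed.

Lemma pker_sym x y : pker x y = pker y x.
Proof.
rewrite /pker; congr (_ * _); apply: eq_bigr => i _.
by rewrite eq_sym uker_sym.
Qed.

Lemma tker_dominated x y : `|tker x y| <= pker x y.
Proof.
rewrite normrM ger0_norm ?invr_ge0 // ler_wpM2l ?invr_ge0 //.
apply: le_trans (ler_norm_sum _ _ _) _; apply: ler_sum => i _.
rewrite normrM ger0_norm ?invr_ge0 // ler_wpM2l ?invr_ge0 //.
apply: le_trans (ler_normB _ _) _.
by rewrite normr_nat (ger0_norm (uker_ge0 _ _ _)).
Qed.

Lemma cosmult_unitv (t : 'I_d -> R) i : cosmult t (unitv i) = cos (t i).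
Proof.
rewrite /cosmult (bigD1 i) //= big1 => [|j ji]; rewrite ffunE.
  by rewrite eqxx inordK // mul1r mulr1.
by rewrite (negbTE ji) inordK // mul0r cos0.
Qed.

Hypothesis d_gt0 : (0 < d)%N.

Lemma pker_sum x : \sum_y pker x y = 1.
Proof.
rewrite -mulr_sumr exchange_big /= (eq_bigr (fun=> 1)) => [|i _].
  by rewrite sumr_const card_ord mulVf // pnatr_eq0 -lt0n.
rewrite -mulr_sumr big_split /= uker_sum (bigD1 x) //= eqxx big1 ?addr0 => [|y yx].
  by rewrite mulVf.
by rewrite eq_sym (negbTE yx).
Qed.

(** [sg = 1] gives [pker] and [sg = -1] gives [tker]; the identity kernel enters as a zeroth
    power. *)
Lemma multK_walk (sg : R) :
  multK (fun x y => d%:R^-1 * \sum_i 2^-1 * ((x == y)%:R + sg * uker (unitv i) x y))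
   (fun k => d%:R^-1 * \sum_i 2^-1 * (1 + sg * cos (freq k i))).
Proof.
pose c (ib : 'I_d * bool) : R := d%:R^-1 * 2^-1 * (if ib.2 then 1 else sg).
pose K (ib : 'I_d * bool) (x y : T) : R := if ib.2 then (x == y)%:R else uker (unitv ib.1) x y.
pose m (ib : 'I_d * bool) (k : T) : R := if ib.2 then 1 else cos (freq k ib.1).
have hm ib : multK (K ib) (m ib).
  have U := @multK_uker R d Q 1 (unitv ib.1).
  case: ib U => i [] /= U; first exact: (eq_multK _ _ (multK_pw 0 U)).
  by apply: eq_multK U => // k; exact: cosmult_unitv.
have sumE (F : 'I_d * bool -> R) (G : 'I_d -> R) : (forall i, F (i, true) + F (i, false) = d%:R^-1 * G i) ->
   \sum_ib F ib = d%:R^-1 * \sum_i G i.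
  move=> h; rewrite mulr_sumr.
  transitivity (\sum_i \sum_b F (i, b)).
    by rewrite pair_bigA; apply: eq_bigr => -[].
  apply: eq_bigr => i _; rewrite (bigD1 true) //= (bigD1 false) //= big1 ?addr0 => [|[] //].
  exact: h.
by apply: eq_multK (multK_sum c hm) => [x y|k]; apply: sumE => i; rewrite /c /K /m /=; ring.
Qed.

Lemma mean_onesub (h : 'I_d -> R) :
  d%:R^-1 * (\sum_i (1 - h i)) = 1 - (\sum_i h i) / d%:R.
Proof.
by rewrite sumrB sumr_const card_ord mulrBr mulVf ?pnatr_eq0 -?lt0n // [_^-1 * _]mulrC.
Qed.

Lemma multK_pker : multK pker (fun k => 1 - (\sum_i hsin2 (freq k i)) / d%:R).
Proof.
apply: eq_multK (multK_walk 1) => [x y|k].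
  by congr (_ * _); apply: eq_bigr => i _; rewrite mul1r.
rewrite -mean_onesub; congr (_ * _).
by apply: eq_bigr => i _; rewrite /hsin2; field.
Qed.

Lemma multK_tker :
  multK tker (fun k => 1 - (\sum_i hsin2 (freq k i + pi)) / d%:R).
Proof.
apply: eq_multK (multK_walk (-1)) => [x y|k].
  by congr (_ * _); apply: eq_bigr => i _; rewrite mulN1r.
rewrite -mean_onesub; congr (_ * _).
by apply: eq_bigr => i _; rewrite hsin2Dpi /hsin2; field.
Qed.

End Walk.

(** * The maximal inequality on the torus *)

Section PsiSums.
Context {R : realType}.

(** The square of [psi u] is min(z, 1/z) with z = u^(1/4), and doubling [u] multiplies z by this
    fourth root of 2. *)
Definition qpsi : R := Num.sqrt (Num.sqrt 2).
Definition Kpsi : R := 2 * qpsi / (qpsi - 1).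

Lemma qpsi_gt1 : 1 < qpsi.
Proof.
have h (x : R) : 1 < x -> 1 < Num.sqrt x by move=> x1; rewrite -{1}sqrtr1 ltr_sqrt // (lt_trans _ x1).
by apply: (h _); apply: (h _); rewrite ltr1n.
Qed.

Lemma Kpsi_ge0 : 0 <= Kpsi.
Proof.
have q1 := qpsi_gt1; rewrite /Kpsi divr_ge0 //; first by rewrite mulr_ge0 // ltW // (lt_trans _ q1).
by rewrite subr_ge0 ltW.
Qed.

Lemma sum_psi_sqr (u : nat -> R) (I : nat) : (forall n, 0 <= u n) ->
  (forall n, (n.+1 < I)%N -> 2 * u n <= u n.+1) -> \sum_(n < I) psi (u n) ^+ 2 <= Kpsi.
Proof.
move=> u0 hu; pose z n : R := Num.sqrt (Num.sqrt (u n)).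
have zE n : root8 (u n) ^+ 2 = z n by rewrite /root8 sqr_sqrtr // sqrtr_ge0.
apply: le_trans (_ : \sum_(n < I) Num.min (z n) (z n)^-1 <= _); last first.
  apply: lacunary_sum => [|n|n nI]; rewrite ?qpsi_gt1 ?sqrtr_ge0 //.
  by rewrite /qpsi /z -!sqrtrM ?sqrtr_ge0 // !ler_wsqrtr ?hu.
apply: ler_sum => n _; rewrite le_min -zE -exprVn.
by rewrite !lerXn2r ?nnegrE ?psi_ge0 ?invr_ge0 ?root8_ge0 // /psi ge_min lexx ?orbT.
Qed.

Lemma sqrD6_le (a b c d e f : R) : (a + b + c + d + e + f) ^+ 2 <=
  8 * (a ^+ 2 + b ^+ 2 + c ^+ 2 + d ^+ 2 + e ^+ 2 + f ^+ 2).
Proof.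
have h (x y : R) : (x + y) ^+ 2 <= 2 * (x ^+ 2 + y ^+ 2).
  rewrite -subr_ge0 [leRHS](_ : _ = (x - y) ^+ 2) ?sqr_ge0 //; ring.
have -> : a + b + c + d + e + f = (a + b) + (c + d) + (e + f) by ring.
have h1 := h (a + b + (c + d)) (e + f); have h2 := h (a + b) (c + d).
have h3 := h a b; have h4 := h c d; have h5 := h e f.
have := sqr_ge0 e; have := sqr_ge0 f; lra.
Qed.

End PsiSums.

Section Errors.
Context {R : realType} {d M : nat}.
Implicit Types (S : pred (nvec d M)) (a : nvec d M) (t : 'I_d -> R).

Definition CE : R := locked (160 + 64 * (500 + 8 * Kres)).

Lemma CE_ge : 294 <= CE.
Proof. have := @Kres_ge0 R; rewrite /CE -lock; lra. Qed.

(** Collects the terms of all ranges and of both halves of the frequencies, so that one lacunary sum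
    serves every case. *)
Definition errB (N Ss Ss' s0 : R) : R :=
  psi N + psi (N / d%:R) + psi (N / d%:R * Ss) + psi (N / d%:R * Ss') +
  psi ((N / d%:R) ^+ 2 * Ss) + psi ((N / d%:R) ^+ 2 * s0).

Lemma errB_ge0 N Ss Ss' s0 : 0 <= errB N Ss Ss' s0.
Proof. by rewrite /errB !addr_ge0 // psi_ge0. Qed.

Lemma low_error S t i0 Ss' : (0 < d)%N -> downsym S ->
  (forall i, hsin2 (t i) <= hsin2 (t i0)) ->
  (16 * nmax S <= d)%N ==> low_frequency t ->
  `|\sum_a om S a * (cosmult t a - cmp t (nsum a))| <=
  CE * errB (nmax S)%:R (\sum_i hsin2 (t i)) Ss' (hsin2 (t i0)) * \sum_a om S a.
Proof.
move=> d0 dS hi0 hlow; have ce := CE_ge.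
have O0 : 0 <= \sum_a om S a :> R by apply: sumr_ge0 => a _; exact: om_ge0.
set N := nmax S in hlow *; set Ss := \sum_i hsin2 (t i).
have [p1 p2 p3] := And3 (psi_ge0 (N%:R : R)) (psi_ge0 (N%:R / d%:R : R)) (psi_ge0 (N%:R / d%:R * Ss)).
have [p4 p5 p6] := And3 (psi_ge0 (N%:R / d%:R * Ss')) (psi_ge0 ((N%:R / d%:R) ^+ 2 * Ss))
  (psi_ge0 ((N%:R / d%:R) ^+ 2 * hsin2 (t i0))).
have fin (c x : R) : 0 <= x -> 0 <= c <= CE -> x <= errB N%:R Ss Ss' (hsin2 (t i0)) ->
    c * x * \sum_a om S a <= CE * errB N%:R Ss Ss' (hsin2 (t i0)) * \sum_a om S a.
  by move=> x0 /andP[c0 cC] xe; rewrite ler_wpM2r // ler_pM.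
have [sp|nsp] := leqP (16 * N) d.
  have low : low_frequency t by move: hlow; rewrite sp.
  have e1 (D : nat) : `|1 : R| <= 1 by rewrite normr1.
  have h := sparse_error d0 dS (erefl _) e1 sp low.
  rewrite [X in `|X|](eq_bigr (fun a => om S a * (1 * (cosmult t a - cmp t (nsum a))))); last first.
    by move=> a _; rewrite mul1r.
  apply: le_trans h _.
  apply: fin; [by rewrite !addr_ge0 | clear -ce; lra | rewrite /errB; clear -p1 p2 p3 p4 p5 p6; lra].
have [la|nla] := leqP (16 * d) N.
  apply: le_trans (large_error d0 dS (erefl _) hi0 la) _.
  apply: fin; [by rewrite !addr_ge0 | rewrite /CE -lock in ce *; clear -ce; lra | rewrite /errB; clear -p1 p2 p3 p4 p5 p6; lra].
apply: le_trans (mid_error t d0 dS (erefl _) nsp nla) _.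
apply: fin; [by [] | clear -ce; lra | rewrite /errB; clear -p1 p2 p3 p4 p5 p6; lra].
Qed.

(** The shift turns [hsin2] into [1 - hsin2], which exchanges frequencies near 0 and near pi, up to
    ties. *)
Lemma low_frequency_pi t : ~~ low_frequency t -> low_frequency (fun i => t i + pi).
Proof.
rewrite /low_frequency -ltnNge => h.
apply: leq_trans (_ : #|[pred i | (hsin2 (t i) <= 2^-1)%R]| <= _)%N.
  apply/subset_leq_card/fintype.subsetP => i; rewrite !inE hsin2Dpi; lra.
apply: leq_trans (ltnW h) _.
by apply/subset_leq_card/fintype.subsetP => i; rewrite !inE hsin2Dpi; lra.
Qed.

Lemma cosmult_pi t a : cosmult (fun i => t i + pi) a = (-1) ^+ nsum a * cosmult t a.
Proof.
rewrite /cosmult /nsum expr_sum -big_split; apply: eq_bigr => i _.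
exact: cos_natmul_pi.
Qed.

Lemma high_error S t Ss s0 : (0 < d)%N -> downsym S -> (16 * nmax S <= d)%N ->
  ~~ low_frequency t ->
  `|\sum_a om S a * (cosmult t a - (-1) ^+ nsum a * cmp (fun i => t i + pi) (nsum a))| <=
  CE * errB (nmax S)%:R Ss (\sum_i hsin2 (t i + pi)) s0 * \sum_a om S a.
Proof.
move=> d0 dS sp /low_frequency_pi low; have ce := CE_ge.
have O0 : 0 <= \sum_a om S a :> R by apply: sumr_ge0 => a _; exact: om_ge0.
have e1 (D : nat) : `|(-1) ^+ D : R| <= 1 by rewrite normrX normrN1 expr1n.
have h := sparse_error d0 dS (erefl _) e1 sp low.
set Ss' := \sum_i hsin2 (t i + pi) in h *; set N := nmax S in h *.
rewrite [X in `|X|](eq_bigr (fun a => om S a * ((-1) ^+ nsum a *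
   (cosmult (fun i => t i + pi) a - cmp (fun i => t i + pi) (nsum a))))); last first.
  by move=> a _; congr (_ * _); rewrite cosmult_pi mulrBr signrMK.
apply: le_trans h _.
apply: ler_wpM2r O0 _ _ _; apply: ler_pM; [exact: ler0n | by rewrite !addr_ge0 ?psi_ge0 | exact: ce | ].
have := psi_ge0 (N%:R / d%:R * Ss); have := psi_ge0 ((N%:R / d%:R) ^+ 2 * Ss).
have := psi_ge0 ((N%:R / d%:R) ^+ 2 * s0); rewrite /errB; lra.
Qed.

Lemma sum_errB (N : nat -> nat) (I : nat) (Ss Ss' s0 : R) : (0 < d)%N ->
  0 <= Ss -> 0 <= Ss' -> 0 <= s0 ->
  (forall n, (n.+1 < I)%N -> 2 * N n <= N n.+1)%N ->
  \sum_(n < I) errB (N n)%:R Ss Ss' s0 ^+ 2 <= 48 * Kpsi.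
Proof.
move=> d0 S0 S0' s00 hN.
have e0 n : 0 <= (N n)%:R / d%:R :> R by rewrite divr_ge0.
have hN1 n : (n.+1 < I)%N -> 2 * (N n)%:R <= (N n.+1)%:R :> R.
  by move=> nI; rewrite -natrM ler_nat hN.
have he n : (n.+1 < I)%N -> 2 * ((N n)%:R / d%:R) <= (N n.+1)%:R / d%:R :> R.
  by move=> nI; rewrite mulrA ler_wpM2r ?invr_ge0 ?hN1.
have he2 n : (n.+1 < I)%N -> 2 * ((N n)%:R / d%:R) ^+ 2 <= ((N n.+1)%:R / d%:R) ^+ 2 :> R.
  move=> nI; apply: le_trans (_ : (2 * ((N n)%:R / d%:R)) ^+ 2 <= _).
    by rewrite [leRHS]exprMn; apply: ler_wpM2r; [exact: sqr_ge0 | lra].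
  by rewrite lerXn2r ?nnegrE ?mulr_ge0 ?he //.
have lin (c : R) : 0 <= c -> \sum_(n < I) psi ((N n)%:R / d%:R * c) ^+ 2 <= Kpsi.
  move=> c0; apply: (sum_psi_sqr (u := fun n => (N n)%:R / d%:R * c)) => [n|n nI].
    exact: mulr_ge0.
  by rewrite mulrA ler_wpM2r ?he.
have quad (c : R) : 0 <= c -> \sum_(n < I) psi (((N n)%:R / d%:R) ^+ 2 * c) ^+ 2 <= Kpsi.
  move=> c0; apply: (sum_psi_sqr (u := fun n => ((N n)%:R / d%:R) ^+ 2 * c)) => [n|n nI].
    by rewrite mulr_ge0 ?sqr_ge0.
  by rewrite mulrA ler_wpM2r ?he2.
have z1 : \sum_(n < I) psi (N n)%:R ^+ 2 <= Kpsi :> R.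
  by apply: (sum_psi_sqr (u := fun n => (N n)%:R)).
have z2 : \sum_(n < I) psi ((N n)%:R / d%:R) ^+ 2 <= Kpsi :> R.
  by apply: (sum_psi_sqr (u := fun n => (N n)%:R / d%:R)).
have z3 := lin Ss S0; have z4 := lin Ss' S0'; have z5 := quad Ss S0; have z6 := quad s0 s00.
apply: le_trans (_ : \sum_(n < I) 8 * (psi (N n)%:R ^+ 2 + psi ((N n)%:R / d%:R) ^+ 2 +
   psi ((N n)%:R / d%:R * Ss) ^+ 2 + psi ((N n)%:R / d%:R * Ss') ^+ 2 +
   psi (((N n)%:R / d%:R) ^+ 2 * Ss) ^+ 2 + psi (((N n)%:R / d%:R) ^+ 2 * s0) ^+ 2) <= _).
  by apply: ler_sum => n _; exact: sqrD6_le.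
rewrite -mulr_sumr !big_split /=; clear -z1 z2 z3 z4 z5 z6; lra.
Qed.

End Errors.

(** * Square function of the differences and selection of a time *)

Section SquareFunction.
Context {R : realType} {d Q M : nat}.
Notation T := (torus d Q).
Implicit Types (k x y : T) (f : T -> R) (S : pred (nvec d M)) (a : nvec d M).

(** By Parseval only the frequencies present in [f] matter; this permits a different comparison
    kernel for each half of the frequencies. *)
Lemma multK_square (I : finType) (K : I -> T -> T -> R) (m : I -> T -> R) f (c : R) :
  (forall i, multK (K i) (m i)) ->
  (forall k, hart f k != 0 -> \sum_i m i k ^+ 2 <= c) ->
  \sum_x \sum_i kapp (K i) f x ^+ 2 <= c * \sum_x f x ^+ 2.
Proof.
move=> h hc; rewrite exchange_big -(ler_pM2l (@vol_gt0 R d Q)) mulrCA -parseval !mulr_sumr.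
under eq_bigr do rewrite -parseval.
rewrite exchange_big; apply: ler_sum => k _ /=.
under eq_bigr do rewrite h exprMn.
rewrite -mulr_suml; have [->|fk] := eqVneq (hart f k) 0; first by rewrite expr0n !mulr0.
by rewrite ler_wpM2r ?sqr_ge0 ?hc.
Qed.

Definition avgk S x y : R := (\sum_a om S a)^-1 * \sum_a om S a * uker a x y.

(* (K, eps) is (pker, 1), or (tker, (-1)^D) to compare with at high frequencies. *)
Definition cmpk (K : T -> T -> R) (eps : nat -> R) S x y : R :=
  (\sum_a om S a)^-1 * \sum_a om S a * (eps (nsum a) * cesk K (@ctime d (nsum a)) x y).

Lemma multK_err K eps S (rho : T -> R) : multK K rho ->
  multK (fun x y => avgk S x y - cmpk K eps S x y) (fun k => (\sum_a om S a)^-1 *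
    \sum_a om S a * (cosmult (freq k) a - eps (nsum a) * ces (@ctime d (nsum a)) (rho k))).
Proof.
move=> hK.
have h1 := multK_sum (fun a => (\sum_a om S a)^-1 * om S a) (@multK_uker R d Q M).
have h2 := multK_sum (fun a : nvec d M => (\sum_a om S a)^-1 * om S a * eps (nsum a))
  (fun a => multK_cesk (@ctime d (nsum a)) hK).
apply: eq_multK (multKB h1 h2) => [x y|k].
  by rewrite /avgk /cmpk !mulr_sumr; congr (_ - _); apply: eq_bigr => a _; rewrite !mulrA.
rewrite -sumrB mulr_sumr; apply: eq_bigr => a _; ring.
Qed.

Lemma om_sum_gt0 S : (exists a, S a) -> 0 < \sum_a om S a :> R.
Proof.
move=> [a Sa]; rewrite (bigD1 a) //= ltr_pwDl ?sumr_ge0 // => [|b _]; last exact: om_ge0.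
by rewrite /om Sa mul1r; apply: prodr_gt0 => i _; exact: lt_le_trans (sgnw_ge1 _).
Qed.

(** A mixture is at most its largest member, so the maximal function of mixtures reduces to that of
    single Cesaro means. *)
Lemma cmpk_selection K eps S f x : (exists a, S a) ->
  (forall x y, `|K x y| <= pker x y) -> (forall D, `|eps D| <= 1) ->
  exists n, `|kapp (cmpk K eps S) f x| <= kapp (cesk pker n) (fun y => `|f y|) x.
Proof.
move=> exS hK heps; have O0 := om_sum_gt0 exS; have [a0 Sa0] := exS.
pose F (a : nvec d M) := kapp (cesk pker (@ctime d (nsum a))) (fun y => `|f y|) x : R.
have [a _ ha] := @arg_maxP _ _ _ a0 xpredT F isT.
exists (@ctime d (nsum a)); rewrite -/(F a).
have -> : kapp (cmpk K eps S) f x = (\sum_a om S a)^-1 *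
    \sum_a om S a * (eps (nsum a) * kapp (cesk K (@ctime d (nsum a))) f x).
  rewrite /kapp /cmpk; under eq_bigr do rewrite -mulrA mulr_suml.
  rewrite -mulr_sumr exchange_big /=; congr (_ * _); apply: eq_bigr => b _.
  rewrite !mulr_sumr; apply: eq_bigr => y _; ring.
rewrite normrM ger0_norm ?invr_ge0 ?(ltW O0) // mulrC ler_pdivrMr // mulr_sumr.
apply: le_trans (ler_norm_sum _ _ _) _; apply: ler_sum => b _.
rewrite normrM (ger0_norm (om_ge0 S b)) [ `|eps _ * _|]normrM mulrC ler_wpM2r ?om_ge0 //.
apply: le_trans (_ : 1 * F b <= _); last by rewrite mul1r; exact: ha.
by rewrite ler_pM // kapp_dominated.
Qed.

End SquareFunction.

Section TorusMaximal.
Context {R : realType} {d Q M I : nat}.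
Notation T := (torus d Q).
Variable S : nat -> pred (nvec d M).
Hypotheses (d_gt0 : (0 < d)%N) (dS : forall n, (n < I)%N -> downsym (S n)).
Hypothesis lac : forall n, (n.+1 < I)%N -> (2 * nmax (S n) <= nmax (S n.+1))%N.
Implicit Types (f : T -> R) (n : 'I_I).

Let sparse (n : nat) : bool := (16 * nmax (S n) <= d)%N.

Let exS n : exists a, S n a.
Proof. exact: ds_ex (dS (ltn_ord n)). Qed.

Lemma square_bound (K : nat -> T -> T -> R) (eps : nat -> nat -> R) (rho : nat -> T -> R) f :
  (forall n, multK (K n) (rho n)) ->
  (forall k, hart f k != 0 -> exists Ss Ss' s0 : R, [/\ 0 <= Ss, 0 <= Ss', 0 <= s0 &
     forall n : 'I_I, `|\sum_a om (S n) a *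
        (cosmult (freq k) a - eps n (nsum a) * ces (@ctime d (nsum a)) (rho n k))| <=
      CE * @errB R d (nmax (S n))%:R Ss Ss' s0 * \sum_a om (S n) a]) ->
  \sum_x \sum_(n < I) kapp (fun x y => avgk (S n) x y - cmpk (K n) (eps n) (S n) x y) f x ^+ 2
   <= 48 * CE ^+ 2 * Kpsi * \sum_x f x ^+ 2.
Proof.
move=> hK h; have ce := @CE_ge R.
apply: multK_square => [n|k fk]; first by apply: multK_err; exact: hK.
have [Ss [Ss' [s0 [S0 S0' s00 hk]]]] := h k fk.
apply: le_trans (_ : \sum_(n < I) CE ^+ 2 * @errB R d (nmax (S n))%:R Ss Ss' s0 ^+ 2 <= _).
  apply: ler_sum => n _; rewrite -exprMn -[leLHS]real_normK ?num_real //.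
  have O0 := om_sum_gt0 (R := R) (exS n).
  have e0 := @errB_ge0 R d (nmax (S n))%:R Ss Ss' s0.
  rewrite lerXn2r ?nnegrE //; first by rewrite mulr_ge0 //; lra.
  by rewrite normrM ger0_norm ?invr_ge0 ?(ltW O0) // mulrC ler_pdivrMr.
rewrite -mulr_sumr [48 * _]mulrC -[leRHS]mulrA ler_wpM2l ?sqr_ge0 //.
exact: (sum_errB (N := fun m : nat => nmax (S m))).
Qed.

Lemma comparison_bound (K : nat -> T -> T -> R) (eps : nat -> nat -> R) f (n : T -> 'I_I) :
  (forall n x y, `|K n x y| <= pker x y) -> (forall n D, `|eps n D| <= 1) ->
  \sum_x kapp (cmpk (K (n x)) (eps (n x)) (S (n x))) f x ^+ 2 <= 16 * \sum_x f x ^+ 2.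
Proof.
move=> hK heps.
have /choice[N hN] : forall x, exists N, `|kapp (cmpk (K (n x)) (eps (n x)) (S (n x))) f x| <=
    kapp (cesk pker N) (fun y => `|f y|) x.
  by move=> x; exact: cmpk_selection (exS _) (hK _) (heps _).
apply: le_trans (_ : \sum_x kapp (cesk pker (N x)) (fun y => `|f y|) x ^+ 2 <= _).
  apply: ler_sum => x _; rewrite -[leLHS]real_normK ?num_real // lerXn2r ?nnegrE ?hN //.
  exact: le_trans (hN x).
apply: le_trans (cesaro_maximal pker_ge0 pker_sym (pker_sum d_gt0) N _) _ => [y|].
  exact: normr_ge0.
by under eq_bigr do rewrite real_normK ?num_real //.
Qed.

Definition Ctorus : R := locked (4 * (48 * CE ^+ 2 * Kpsi + 16)).

(** The supremum is linearised by a choice [n x] of the scale at each point. The two halves of [f]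
    are orthogonal, and each contributes a square function of differences and a Cesaro maximal
    function; the 4 in [Ctorus] counts these four terms. *)
Lemma torus_maximal f (n : T -> 'I_I) :
  \sum_x kapp (avgk (S (n x))) f x ^+ 2 <= Ctorus * \sum_x f x ^+ 2.
Proof.
have [f1 [f2 [fE [h1 h2]]]] := hart_split (fun k => low_frequency (@freq R d Q k)) f.
have fsum : \sum_x f1 x ^+ 2 + \sum_x f2 x ^+ 2 = \sum_x f x ^+ 2.
  apply: (mulfI (lt0r_neq0 (@vol_gt0 R d Q))); rewrite mulrDr -!parseval -big_split /=.
  by apply: eq_bigr => k _; rewrite h1 h2; case: low_frequency; rewrite /= ?mul0r ?mul1r ?expr0n ?addr0 ?add0r.
pose K1 (n : nat) : T -> T -> R := pker; pose eps1 (n : nat) (D : nat) : R := 1.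
(* Near (pi, ..., pi) the kernel changes only at sparse scales; at the others [low_error] holds for
   all frequencies. *)
pose K2 (n : nat) : T -> T -> R := if sparse n then tker else pker.
pose eps2 (n : nat) (D : nat) : R := if sparse n then (-1) ^+ D else 1.
have imax k : exists i0, forall i, hsin2 (@freq R d Q k i) <= hsin2 (freq k i0).
  have [i0 _ hi] := @arg_maxP _ _ _ (Ordinal d_gt0) xpredT (fun i => hsin2 (@freq R d Q k i)) isT.
  by exists i0 => i; exact: hi.
have Ss0 (t : 'I_d -> R) : 0 <= \sum_i hsin2 (t i) by apply: sumr_ge0 => i _; exact: hsin2_ge0.
have E1 := @square_bound K1 eps1 (fun (_ : nat) k => 1 - (\sum_i hsin2 (freq k i)) / d%:R) f1
  (fun=> multK_pker d_gt0).
have E2 := @square_bound K2 eps2 (fun (n : nat) k => if sparse n then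
    1 - (\sum_i hsin2 (freq k i + pi)) / d%:R else 1 - (\sum_i hsin2 (freq k i)) / d%:R) f2.
have {}E1 := E1 _; have {}E2 := E2 _ _.
have {}E1 : \sum_x \sum_(n < I) kapp (fun x y => avgk (S n) x y - cmpk (K1 n) (eps1 n) (S n) x y) f1 x ^+ 2
   <= 48 * CE ^+ 2 * Kpsi * \sum_x f1 x ^+ 2.
  apply: E1 => k fk; have [i0 hi0] := imax k.
  exists (\sum_i hsin2 (freq k i)), 0, (hsin2 (freq k i0)); split; rewrite ?hsin2_ge0 //.
  move=> m; under eq_bigr do rewrite mul1r.
  apply: low_error => //; first exact: dS.
  apply/implyP => _; apply: contraNT fk => nl; by rewrite h1 (negbTE nl) mul0r.
have {}E2 : \sum_x \sum_(n < I) kapp (fun x y => avgk (S n) x y - cmpk (K2 n) (eps2 n) (S n) x y) f2 x ^+ 2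
   <= 48 * CE ^+ 2 * Kpsi * \sum_x f2 x ^+ 2.
  apply: E2 => [m|k fk].
    by rewrite /K2; case: (sparse m); [exact: multK_tker | exact: multK_pker].
  have [i0 hi0] := imax k.
  exists (\sum_i hsin2 (freq k i)), (\sum_i hsin2 (freq k i + pi)), (hsin2 (freq k i0)).
  split; [exact: Ss0 | exact: (Ss0 (fun i => freq k i + pi)) | exact: hsin2_ge0 | ].
  move=> m; rewrite /eps2; case: ifPn => sp.
    apply: high_error => //; first exact: dS.
    by apply: contraNN fk => lo; rewrite h2 lo mul0r.
  under eq_bigr do rewrite mul1r.
  by apply: low_error => //; [exact: dS | rewrite -/(sparse m) (negbTE sp)].
have C1 := @comparison_bound K1 eps1 f1 n; have C2 := @comparison_bound K2 eps2 f2 n.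
have {}C1 : \sum_x kapp (cmpk (K1 (n x)) (eps1 (n x)) (S (n x))) f1 x ^+ 2 <= 16 * \sum_x f1 x ^+ 2.
  apply: C1 => [m x y|m D]; last by rewrite normr1.
  by rewrite ger0_norm // pker_ge0.
have {}C2 : \sum_x kapp (cmpk (K2 (n x)) (eps2 (n x)) (S (n x))) f2 x ^+ 2 <= 16 * \sum_x f2 x ^+ 2.
  apply: C2 => [m x y|m D].
    rewrite /K2; case: ifP => _; first exact: tker_dominated.
    by rewrite ger0_norm // pker_ge0.
  by rewrite /eps2; case: ifP => _; rewrite ?normr1 // normrX normrN1 expr1n.
pose D1 m := kapp (fun x y => avgk (S m) x y - cmpk (K1 m) (eps1 m) (S m) x y) f1.
pose D2 m := kapp (fun x y => avgk (S m) x y - cmpk (K2 m) (eps2 m) (S m) x y) f2.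
have pt x : kapp (avgk (S (n x))) f x ^+ 2 <= 4 * (\sum_(m < I) D1 m x ^+ 2 +
   \sum_(m < I) D2 m x ^+ 2 + kapp (cmpk (K1 (n x)) (eps1 (n x)) (S (n x))) f1 x ^+ 2 +
   kapp (cmpk (K2 (n x)) (eps2 (n x)) (S (n x))) f2 x ^+ 2).
  have sel (G : 'I_I -> R) : (forall m, 0 <= G m) -> G (n x) <= \sum_m G m.
    by move=> G0; rewrite (bigD1 (n x)) //= lerDl sumr_ge0.
  have g1 : D1 (n x) x ^+ 2 <= \sum_(m < I) D1 m x ^+ 2 := sel (fun m => D1 m x ^+ 2) (fun m => sqr_ge0 _).
  have g2 : D2 (n x) x ^+ 2 <= \sum_(m < I) D2 m x ^+ 2 := sel (fun m => D2 m x ^+ 2) (fun m => sqr_ge0 _).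
  have -> : kapp (avgk (S (n x))) f x = D1 (n x) x + D2 (n x) x +
     kapp (cmpk (K1 (n x)) (eps1 (n x)) (S (n x))) f1 x +
     kapp (cmpk (K2 (n x)) (eps2 (n x)) (S (n x))) f2 x.
    rewrite /D1 /D2 /kapp -!big_split /=; apply: eq_bigr => y _; rewrite fE; ring.
  move: g1 g2 => /=; set a := D1 _ _; set b := D2 _ _; set c := kapp _ _ _; set e := kapp _ _ _.
  move=> g1 g2; apply: le_trans (_ : 4 * (a ^+ 2 + b ^+ 2 + c ^+ 2 + e ^+ 2) <= _); last lra.
  have := sqr_ge0 (a - b); have := sqr_ge0 (a - c); have := sqr_ge0 (a - e).
  have := sqr_ge0 (b - c); have := sqr_ge0 (b - e); have := sqr_ge0 (c - e).
  rewrite !expr2; lra.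
apply: le_trans (ler_sum _ (fun x _ => pt x)) _.
rewrite -mulr_sumr !big_split /= /Ctorus -lock -mulrA ler_wpM2l // -fsum.
set c0 := 48 * _ * _ in E1 E2 *; rewrite [leRHS](_ : _ =
  c0 * (\sum_x f1 x ^+ 2) + c0 * (\sum_x f2 x ^+ 2) +
  16 * (\sum_x f1 x ^+ 2) + 16 * (\sum_x f2 x ^+ 2)); last by ring.
by do 3!apply: lerD => //.
Qed.

End TorusMaximal.

(** * Transference to the lattice *)

Section LatticeSums.
Context {R : realType} {d M : nat}.
Notation V := 'rV[int]_d.
Implicit Types (a : nvec d M) (e : {ffun 'I_d -> bool}) (A s : seq V) (x y : V).

Definition svec a e : V := \row_i (if e i then - (a i)%:Z else (a i)%:Z).
Definition posvec a : V := \row_i (a i)%:Z.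

Definition lat_avg A (H : V -> R) x : R := (size A)%:R^-1 * \sum_(y <- A) H (x - y).

Lemma sum_eq_seq A (g : V -> R) z : uniq A ->
  \sum_(y <- A) (z == y)%:R * g y = (z \in A)%:R * g z.
Proof.
move=> uA; have [zA|zA] := boolP (z \in A).
  rewrite (bigD1_seq z) //= eqxx big1 ?addr0 // => y yz.
  by rewrite eq_sym (negbTE yz) mul0r.
rewrite mul0r big1_seq // => y /= yA; have [zy|] := eqVneq z y; last by rewrite mul0r.
by rewrite zy yA in zA.
Qed.

(** A vector with [z] zero coordinates is [svec a e] for one [a] and [2 ^ z] patterns [e], while
    [signs a = 2 ^ (d - z)]. The sum factors over the coordinates. *)
Lemma svec_weight y : (forall i, `|y ord0 i|%N <= M)%N ->
  \sum_a \sum_e (svec a e == y)%:R * (signs a * 2^-1 ^+ d) = 1 :> R.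
Proof.
move=> yM.
pose h i (p : 'I_M.+1 * bool) : R :=
  ((if p.2 then - (p.1)%:Z else (p.1)%:Z) == y ord0 i)%:R * (sgnw p.1 * 2^-1).
transitivity (\prod_i \sum_(k : 'I_M.+1) \sum_b h i (k, b)).
  rewrite bigA_distr_bigA /=; apply: eq_bigr => a _.
  rewrite bigA_distr_bigA /=; apply: eq_bigr => e _.
  rewrite /h big_split /= /signs big_split /= prodr_const card_ord; congr (_ * _).
  have [ey|ey] := eqVneq (svec a e) y.
    by rewrite big1 // => i _; rewrite -ey mxE eqxx.
  have [i hi] : exists i, svec a e ord0 i != y ord0 i.
    apply/existsP; apply: contraNT ey; rewrite negb_exists => /forallP h'.
    by apply/eqP/rowP => i; apply/eqP; rewrite -[_ == _]negbK h'.
  by rewrite (bigD1 i) //=; rewrite mxE in hi; rewrite (negbTE hi) mul0r.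
apply: big1 => i _; pose k0 : 'I_M.+1 := inord `|y ord0 i|%N.
have k0E : k0 = `|y ord0 i|%N :> nat by rewrite inordK // ltnS.
rewrite (bigD1 k0) //= [X in _ + X]big1 => [|k kk0]; last first.
  apply: big1 => b _; rewrite /h /=.
  have nk : k <> `|y ord0 i|%N :> nat by move=> e; case/eqP: kk0; apply: ord_inj; rewrite k0E.
  by case: b; case: eqP => e; rewrite ?mul0r //; lia.
rewrite addr0 (bigD1 true) //= (bigD1 false) //= [X in _ + (_ + X)]big1 ?addr0 => [|[] //].
rewrite /h /= k0E -mulrDl.
have [y0|y0] := eqVneq (y ord0 i) 0; first by rewrite y0 /= /sgnw /=; field.
have sg : sgnw `|y ord0 i|%N = 2 :> R by rewrite /sgnw absz_eq0 (negbTE y0).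
rewrite sg mulfV // mulr1 -natrD.
by have [yp|yp] := lerP 0 (y ord0 i); case: eqP => e1; case: eqP => e2 //=; lia.
Qed.

Section BoxSet.
Variable A : seq V.
Hypotheses (uA : uniq A) (boxA : forall y, y \in A -> forall i, (`|y ord0 i| <= M)%N).
Hypothesis symA : forall a e, (svec a e \in A) = (posvec a \in A).

(** Puts a sum over the lattice set in the form of [avgk]: weights [om] times uniform averages over
    sign changes. *)
Lemma lattice_sum (g : V -> R) : \sum_(y <- A) g y =
  \sum_a om (fun a => posvec a \in A) a * (2^-1 ^+ d * \sum_e g (svec a e)).
Proof.
transitivity (\sum_(y <- A) \sum_a \sum_e
    (svec a e == y)%:R * (signs a * 2^-1 ^+ d) * g y).
  rewrite big_seq [RHS]big_seq; apply: eq_bigr => y yA.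
  rewrite -[LHS]mul1r -[X in X * _ = _](svec_weight (boxA yA)) mulr_suml; apply: eq_bigr => a _.
  by rewrite mulr_suml.
rewrite exchange_big; apply: eq_bigr => a _ /=.
rewrite exchange_big !mulr_sumr; apply: eq_bigr => e _ /=.
under eq_bigr => y _ do rewrite mulrAC mulrC.
rewrite -mulr_sumr sum_eq_seq // symA /om; ring.
Qed.

Lemma lattice_size : (size A)%:R = \sum_a om (fun a => posvec a \in A) a :> R.
Proof.
have := lattice_sum (fun=> 1); rewrite big_const_seq iter_addr_0 count_predT => ->.
apply: eq_bigr => a _; rewrite sumr_const card_ffun card_bool card_ord natrX -exprMn.
by rewrite mulVf // expr1n mulr1.
Qed.

End BoxSet.
End LatticeSums.

Section LatticeMaximal.
Context {R : realType} {d M I : nat}.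
Notation V := 'rV[int]_d.
Variable A : nat -> seq V.
Let S (j : nat) : pred (nvec d M) := fun a => posvec a \in A j.
Hypotheses (d_gt0 : (0 < d)%N).
Hypothesis uA : forall j, uniq (A j).
Hypothesis boxA : forall j, (j < I)%N -> forall y, y \in A j -> forall i, (`|y ord0 i| <= M)%N.
Hypothesis symA : forall j (a : nvec d M) e, (svec a e \in A j) = (posvec a \in A j).
Hypothesis dS : forall j, (j < I)%N -> downsym (S j).
Hypothesis lac : forall j, (j.+1 < I)%N -> (2 * nmax (S j) <= nmax (S j.+1))%N.

(* The coordinates of s are at most W in absolute value, so after translation by
   W + M the averages at points of s do not see the periodicity of the torus. *)
Lemma lattice_maximal (H : V -> R) (s : seq V) (n : V -> 'I_I) : uniq s ->
  exists t : seq V, uniq t /\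
    \sum_(x <- s) lat_avg (A (n x)) H x ^+ 2 <= Ctorus * \sum_(y <- t) H y ^+ 2.
Proof.
move=> us.
have [W sW] : exists W, forall (x : V) (i : 'I_d), x \in s -> (`|x ord0 i|%N <= W)%N.
  exists (\max_(x <- s) \max_i `|x ord0 i|)%N => x i xs.
  apply: leq_trans (_ : \max_i `|x ord0 i| <= _)%N.
    exact: (leq_bigmax i (F := fun i => `|x ord0 i|%N)).
  exact: (leq_bigmax_seq (F := fun x : V => (\max_i `|x ord0 i|)%N)).
(* [Q.+1] is the number of integers from [-(W + M)] to [W + M]. *)
have [Q QE] : exists Q, Q = (2 * (W + M))%N by exists (2 * (W + M))%N.
pose lift (z : torus d Q) : V := \row_i ((z i)%:Z - (W + M)%:Z).
pose emb (x : V) : torus d Q := [ffun i => inord (absz (x ord0 i + (W + M)%N%:Z))].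
have liftI : injective lift.
  move=> z z' /rowP h; apply/ffunP => i; apply: val_inj => /=.
  by have := h i; rewrite !mxE => /addIr [].
have embE x i : x \in s -> (emb x i)%:Z = x ord0 i + (W + M)%:Z.
  move=> xs; rewrite ffunE inordK; move: (x ord0 i) (sW x i xs) => u; lia.
have embK x : x \in s -> lift (emb x) = x.
  by move=> xs; apply/rowP => i; rewrite mxE embE // addrK.
have shiftE x a e : x \in s -> lift (sshift (M := M) a e (emb x)) = x - svec a e.
  move=> xs; apply/rowP => i; rewrite !mxE /sshift ffunE.
  have h := embE x i xs; have hW := sW x i xs; have ha := ltn_ord (a i).
  move: (x ord0 i) (emb x i) (a i) h hW ha => u z k h hW ha.
  have hz (w : 'I_Q.+1) : (w + inZp k)%R = ((w + k) %% Q.+1)%N :> nat by rewrite /= modnDmr.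
  case: (e i).
    have -> : (z + inZp k)%R = (z + k)%N :> nat by rewrite hz modn_small //; lia.
    lia.
  have zk : (z - k < Q.+1)%N by lia.
  have -> : (z - inZp k)%R = (z - k)%N :> nat; last by lia.
  have zE : Ordinal zk + inZp k = z by apply: ord_inj; rewrite hz /= subnK ?modn_small //; lia.
  by rewrite -{1}zE addrK.
pose f (z : torus d Q) := H (lift z).
have avgE x : x \in s -> kapp (avgk (S (n x))) f (emb x) = lat_avg (A (n x)) H x.
  move=> xs; have bx := boxA (ltn_ord (n x)); have sx := symA (n x).
  rewrite /lat_avg (lattice_size (uA _) bx sx) (lattice_sum (uA _) bx sx (fun y => H (x - y))).
  rewrite /kapp /avgk; under eq_bigr do rewrite -mulrA mulr_suml.
  rewrite -mulr_sumr exchange_big /=; congr (_ * _); apply: eq_bigr => a _.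
  under eq_bigr do rewrite -mulrA.
  rewrite -mulr_sumr; congr (_ * _); rewrite -[LHS]/(kapp (uker a) f (emb x)) uker_app.
  by congr (_ * _); apply: eq_bigr => e _; rewrite /f shiftE.
have embI : {in s &, injective emb}.
  by move=> x y xs ys /(congr1 lift); rewrite !embK.
exists [seq lift z | z <- enum {: torus d Q}]; split.
  by rewrite map_inj_uniq // enum_uniq.
rewrite big_map big_enum /=.
have tm := torus_maximal d_gt0 dS lac f (fun z => n (lift z)).
apply: le_trans tm; rewrite [leRHS](bigID [in [seq emb x | x <- s]]) /=.
rewrite -[leLHS]addr0; apply: lerD; last by apply: sumr_ge0 => z _; exact: sqr_ge0.
rewrite -big_uniq /=; last by rewrite map_inj_in_uniq.
rewrite big_map big_seq [leRHS]big_seq; apply: ler_sum => x xs.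
by rewrite embK // avgE.
Qed.

End LatticeMaximal.

(** * Lattice points of symmetric convex bodies *)

Section SymmetricConvexSets.
Context {R : realType} {d : nat}.
Notation RV := 'rV[R]_d.

Record sconv (K : set RV) : Prop := Sconv {
  sc_ex : K !=set0;
  sc_perm : forall (s : 'S_d) x, K x -> K (col_perm s x);
  sc_sign : forall (e : 'I_d -> bool) x, K x -> K (\row_i ((-1) ^+ e i * x ord0 i));
  sc_conv : forall (t : R) x y, 0 <= t <= 1 -> K x -> K y -> K (t *: x + (1 - t) *: y) }.

Lemma sconv_body (G : set RV) : convex_body G -> one_symmetric G -> sconv G.
Proof.
move=> [_ _ cG [x0 ix0]] [pG sG]; split.
- by exists x0; exact: interior_subset ix0.
- by move=> s x Gx; rewrite -(pG s); exists x.
- by move=> e x Gx; rewrite -(sG e); exists x.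
- move=> t x y /andP[t0 t1] Gx Gy.
  have := cG x y (Itv01 t0 t1); rewrite !inE => /(_ Gx Gy).
  by [].
Qed.

Lemma sconv_dilate (G : set RV) t : sconv G -> sconv (dilate t G).
Proof.
move=> [[x0 Gx0] pG sG cG]; split.
- by exists (t *: x0), x0.
- move=> s _ [x Gx <-]; exists (col_perm s x); first exact: pG.
  by apply/rowP => i; rewrite !mxE.
- move=> e _ [x Gx <-]; exists (\row_i ((-1) ^+ e i * x ord0 i)); first exact: sG.
  by apply/rowP => i; rewrite !mxE mulrCA.
- move=> l _ _ l01 [x Gx <-] [y Gy <-]; exists (l *: x + (1 - l) *: y); first exact: cG.
  by rewrite scalerDr !scalerA (mulrC t) (mulrC t).
Qed.

Section Closure.
Variable K : set RV.
Hypothesis cK : sconv K.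

(** The point lies on the segment between [x] and its reflection in coordinate [i], with weight
    [(1 + l) / 2] on [x]. *)
Lemma sconv_scale_coord (x : RV) i (l : R) : K x -> `|l| <= 1 ->
  K (\row_j (if j == i then l * x ord0 j else x ord0 j)).
Proof.
move=> Kx; rewrite ler_norml => /andP[l0 l1].
have Ky := sc_sign cK (fun j => j == i) Kx.
have t01 : 0 <= (1 + l) / 2 <= 1 by lra.
have := sc_conv cK t01 Kx Ky; congr K; apply/rowP => j; rewrite !mxE.
by case: (j == i); rewrite /= ?expr1 ?expr0; field.
Qed.

(** Coordinates are changed one at a time, each by the ratio [y i / x i] in [-1, 1]; where
    [x i = 0], also [y i = 0]. *)
Lemma sconv_solid (x y : RV) : K x -> (forall i, `|y ord0 i| <= `|x ord0 i|) -> K y.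
Proof.
move=> Kx hyx.
have step n : (n <= d)%N -> K (\row_(i < d) (if (i < n)%N then y ord0 i else x ord0 i)).
  elim: n => [|n IH] nd; first by congr K: Kx; apply/rowP => i; rewrite mxE.
  pose i0 := Ordinal nd.
  have hl : `|y ord0 i0 / x ord0 i0| <= 1.
    have [x0|x0] := eqVneq (x ord0 i0) 0; first by rewrite x0 invr0 mulr0 normr0.
    by rewrite normrM normfV ler_pdivrMr ?normr_gt0 // mul1r.
  have := sconv_scale_coord i0 (IH (ltnW nd)) hl; congr K; apply/rowP => i; rewrite !mxE.
  have [->|ii] := eqVneq i i0.
    rewrite /= ltnn ltnSn; have [x0|x0] := eqVneq (x ord0 i0) 0.
      have := hyx i0; rewrite x0 mulr0 normr0 normr_le0 => /eqP -> //.
    by rewrite divfK.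
  by rewrite ltnS [(i <= n)%N]leq_eqVlt (_ : (i == n :> nat) = false) //; exact/negbTE.
by have := step d (leqnn d); congr K; apply/rowP => i; rewrite mxE ltn_ord.
Qed.

Context {M : nat}.
Implicit Types a b : nvec d M.

Lemma lattice_svec a e : lattice_points K (svec a e) <-> lattice_points K (posvec a).
Proof.
split=> h; apply: sconv_solid h _ => i; rewrite !mxE; case: (e i);
  by rewrite ?mulrNz ?normrN.
Qed.

(** Moving [t] units from [j] to [i] is the convex combination of [a] and its swap with weight
    [t / (a j - a i)] on the swap; the other closure properties come from permutations and
    [sconv_solid]. *)
Lemma lattice_downsym (S : pred (nvec d M)) :
  (forall a, S a <-> lattice_points K (posvec a)) -> downsym S.
Proof.
move=> hS; split.
- have [x Kx] := sc_ex cK; exists [ffun => ord0]; apply/hS.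
  by apply: sconv_solid Kx _ => i; rewrite !mxE ffunE normr0.
- move=> s a /hS h; apply/hS; have := sc_perm cK s h; congr K.
  by apply/rowP => i; rewrite !mxE ffunE.
- move=> a b /hS h ba; apply/hS; apply: sconv_solid h _ => i; rewrite !mxE.
  by rewrite !ger0_norm ?ler0z // ler_int lez_nat.
move=> i j t a ij h /hS Ka; apply/hS.
(* Here [t = 0] and [a i = a j], so the weight would have denominator 0. *)
have [aij|aij] := leqP (a j) (a i).
  apply: sconv_solid Ka _ => k; rewrite !mxE !ger0_norm ?ler0z // ler_int lez_nat.
  have [->|ki] := eqVneq k i; first by rewrite xferl //; lia.
  have [->|kj] := eqVneq k j; first by rewrite xferr //; lia.
  by rewrite xfero.
have D0 : 0 < (a j)%:R - (a i)%:R :> R by rewrite subr_gt0 ltr_nat.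
have t01 : 0 <= (t%:R : R) / ((a j)%:R - (a i)%:R) <= 1.
  rewrite divr_ge0 ?(ltW D0) //= ler_pdivrMr // mul1r lerBrDl -natrD ler_nat; lia.
have := sc_conv cK t01 (sc_perm cK (tperm i j) Ka) Ka; congr K.
apply/rowP => k; rewrite !mxE -!pmulrn.
have [->|ki] := eqVneq k i; first by rewrite tpermL xferl // natrD; field; lra.
have [->|kj] := eqVneq k j.
  by rewrite tpermR xferr // natrB; [field; lra | lia].
by rewrite tpermD 1?eq_sym // xfero //; ring.
Qed.

End Closure.
End SymmetricConvexSets.

(** * Lattice points of the dyadic dilates *)

Section Dyadic.
Context {R : realType} {d : nat}.
Notation V := 'rV[int]_d.
Variable G : set 'rV[R]_d.
Hypothesis cG : convex_body G.

Definition dyadic_points (n : int) : seq V :=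
  fset_set (lattice_points (dilate (2 ^ n) G)).

Lemma body_bound : exists B : nat, forall x, G x -> forall i, `|x ord0 i| <= B%:R.
Proof.
case: cG => _ [M0 [_ hM]] _ _.
have hB := hM (`|M0| + 1) _; exists (Num.truncn (`|M0| + 1)).+1 => x Gx i.
have {}hB : `|x| <= `|M0| + 1 by apply: hB => //; have := ler_norm M0; lra.
apply: le_trans (_ : `|x| <= _); last first.
  apply: le_trans hB _; apply: ltW; have h0 : 0 <= `|M0| + 1 by rewrite addr_ge0.
  by have := @Num.Theory.truncn_itv R _ h0 => /andP[].
by rewrite [leRHS]mx_normrE; exact: (le_bigmax _ (fun ij => `|x ij.1 ij.2|) (ord0, i)).
Qed.

Lemma dyadic_box (b : nat) : exists M : nat, forall n : int, n <= b%:Z ->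
  forall y, lattice_points (dilate (2 ^ n) G) y -> forall i, (`|y ord0 i| <= M)%N.
Proof.
have [B hB] := body_bound; exists (2 ^ b * B)%N => n nb y [x Gx hx] i.
have : `|(y ord0 i)%:~R| <= (2 ^ b * B)%:R :> R.
  have -> : (y ord0 i)%:~R = 2 ^ n * x ord0 i :> R.
    by have /rowP/(_ i) := hx; rewrite !mxE.
  rewrite normrM natrM ler_pM // ?hB // ger0_norm ?exprz_ge0 //.
  by rewrite natrX -[leRHS]/(2 ^ b%:Z) ler_eXz2l // ltr1n.
by rewrite -intr_norm pmulrn ler_int -abszE lez_nat.
Qed.

Lemma dyadic_finite n : finite_set (lattice_points (dilate (2 ^ n) G)).
Proof.
have [M hM] := dyadic_box `|n|%N.
apply: (@sub_finite_set _ _ [set \row_i ((f i)%:Z - M%:Z) | f in [set: {ffun 'I_d -> 'I_(2 * M).+1}]]).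
  move=> y hy; exists [ffun i => inord (absz (y ord0 i + M%:Z))] => //.
  have nn : n <= `|n|%N by lia.
  apply/rowP => i; rewrite mxE ffunE; move: (y ord0 i) (hM n nn y hy i) => u hu.
  rewrite inordK; lia.
exact: finite_image.
Qed.

Lemma mem_dyadic n y : (y \in dyadic_points n) <-> lattice_points (dilate (2 ^ n) G) y.
Proof.
rewrite /dyadic_points -[_ \in _]/(y \in fset_set _) in_fset_set; last exact: dyadic_finite.
by rewrite inE.
Qed.

Hypotheses (d_gt0 : (0 < d)%N) (sG : one_symmetric G).

(** On the finite set [s] only scales between [-b] and [b] are selected; they are indexed by
    [j = n + b], and one box contains all the lattice points involved. *)
Lemma dyadic_l2 (H : V -> R) (s : seq V) (n : V -> int) : uniq s ->
  exists t : seq V, uniq t /\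
    \sum_(x <- s) lat_avg (dyadic_points (n x)) H x ^+ 2 <= Ctorus * \sum_(y <- t) H y ^+ 2.
Proof.
move=> us.
have [b hb] : exists b : nat, forall x, x \in s -> (`|n x| <= b)%N.
  exists (\max_(x <- s) `|n x|)%N => x xs.
  exact: (leq_bigmax_seq (F := fun x : V => `|n x|%N)).
have [M hM] := dyadic_box b.
pose A (j : nat) := dyadic_points (j%:Z - b%:Z).
have sc j : sconv (dilate (2 ^ j) G) by apply/sconv_dilate/sconv_body.
have memA j y : (y \in A j) <-> lattice_points (dilate (2 ^ (j%:Z - b%:Z)) G) y.
  exact: mem_dyadic.
have boxA j : (j < (2 * b).+1)%N -> forall y, y \in A j -> forall i, (`|y ord0 i| <= M)%N.
  by move=> jb y /memA hy; apply: hM hy; lia.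
have uA j : uniq (A j) by exact: fset_uniq.
have symA j (a : nvec d M) e : (svec a e \in A j) = (posvec a \in A j).
  apply/idP/idP => /memA h; apply/memA; [exact/lattice_svec/h | exact/lattice_svec].
have dS j : (j < (2 * b).+1)%N -> downsym (fun a : nvec d M => posvec a \in A j).
  by move=> _; apply: (lattice_downsym (sc _)) => // a; exact: memA.
(* Doubling a lattice point of one dilate gives a lattice point of the next. *)
have lac j : (j.+1 < (2 * b).+1)%N ->
    (2 * nmax (fun a : nvec d M => posvec a \in A j) <= nmax (fun a : nvec d M => posvec a \in A j.+1))%N.
  move=> jb; have [a0 Sa0] := ds_ex (dS j (ltnW jb)).
  have S0 : (0 < #|[pred a : nvec d M | posvec a \in A j]|)%N by apply/card_gt0P; exists a0.
  have [a Sa aE] := eq_bigmax_cond (@nsum d M) S0; rewrite /nmax [X in (2 * X)%N]aE.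
  pose y : V := \row_i (2 * a i)%N%:Z.
  have yA : y \in A j.+1.
    move/memA: Sa => [x Gx hx]; apply/memA; exists x => //.
    have -> : j.+1%:Z - b%:Z = 1 + (j%:Z - b%:Z) by lia.
    rewrite expfzDr ?pnatr_eq0 // expr1z -scalerA hx.
    by apply/rowP => i; rewrite !mxE PoszM intrM.
  have yM i : (2 * a i <= M)%N by have := boxA _ jb _ yA i; rewrite mxE.
  pose c : nvec d M := [ffun i => inord (2 * a i)].
  have cE i : c i = (2 * a i)%N :> nat by rewrite ffunE inordK // ltnS.
  have -> : (2 * nsum a)%N = nsum c by rewrite /nsum big_distrr; apply: eq_bigr => i _; rewrite cE.
  apply: (leq_bigmax_cond (F := @nsum d M)); rewrite (_ : posvec c = y) //.
  by apply/rowP => i; rewrite !mxE cE.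
pose n' x : 'I_(2 * b).+1 := inord (absz (n x + b%:Z)).
have [t [ut ht]] := lattice_maximal d_gt0 uA boxA symA dS lac H n' us.
exists t; split => //; apply: le_trans ht; rewrite big_seq [leRHS]big_seq.
apply: ler_sum => x xs; rewrite /A (_ : (n' x)%:Z - b%:Z = n x) //.
by rewrite /n'; move: (n x) (hb x xs) => u hu; rewrite inordK; lia.
Qed.

End Dyadic.

(** * From l^2 to l^p *)

Section CountingMeasure.
Context {R : realType} {d : nat}.
Notation V := 'rV[int]_d.
Implicit Types (g : V -> \bar R) (s : seq V).
Local Notation mu := (@counting V R).
Local Open Scope ereal_scope.

Lemma measurable_lattice (A : set V) : measurable A.
Proof. by []. Qed.

Lemma counting_set1 (x : V) : mu [set x] = 1.
Proof. by rewrite /counting asboolT ?fset_set1 ?cardfs1 //; exact: finite_set1. Qed.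

Lemma integral_lattice_set1 g x : \int[mu]_(y in [set x]) g y = g x.
Proof.
rewrite (eq_integral (cst (g x))) => [|y]; last by rewrite inE => /= ->.
by rewrite (integral_cst mu (measurable_lattice _)) -[X in _ * X]/(mu [set x]) counting_set1 mule1.
Qed.

Lemma sum_le_integral g s : (forall x, 0 <= g x) -> uniq s ->
  \sum_(x <- s) g x <= \int[mu]_x g x.
Proof.
move=> g0 us; pose D := \big[setU/set0]_(x <- s) [set x].
apply: le_trans (_ : \int[mu]_(x in D) g x <= _); last exact: ge0_subset_integral.
rewrite ge0_integral_bigsetU //; last by move=> i j _ _ [z [/= -> ->]].
by under [leRHS]eq_bigr do rewrite integral_lattice_set1.
Qed.

(** [choice.pickle] enumerates the lattice, so the integral is a series of nonnegative terms whose
    partial sums run over distinct points. *)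
Lemma integral_le_sum g (B : \bar R) : (forall x, 0 <= g x) ->
  (forall s, uniq s -> \sum_(x <- s) g x <= B) -> \int[mu]_x g x <= B.
Proof.
move=> g0 hB; pose F (n : nat) : set V := [set x : V | choice.pickle x = n].
have -> : [set: V] = \bigcup_n F n.
  by apply/seteqP; split=> x _ //; exists (choice.pickle x).
rewrite ge0_integral_bigcup //; last first.
  by move=> i j _ _ [z [/= <- <-]].
have term n : \int[mu]_(x in F n) g x = oapp g 0 (@choice.pickle_inv V n).
  case Ex: (@choice.pickle_inv V n) => [x|] /=.
    rewrite -[RHS](integral_lattice_set1 g); congr (integral _ _ _).
    have xn : choice.pickle x = n by have := @choice.pickle_invK V n; rewrite Ex.
    apply/seteqP; split=> y /=; last by move=> ->.
    by rewrite /F /= -xn; exact: (pcan_inj (@choice.pickleK_inv V)).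
  rewrite (_ : F n = set0) ?integral_set0 //; apply/seteqP; split=> // x /= xn.
  by have := @choice.pickleK_inv V x; rewrite xn Ex.
apply: lime_le; first by apply: is_cvg_nneseries => n _ _; exact: integral_ge0.
apply: nearW => n; under eq_bigr do rewrite term.
have -> : \sum_(0 <= i < n) oapp g 0 (@choice.pickle_inv V i) =
    \sum_(x <- pmap (@choice.pickle_inv V) (index_iota 0 n)) g x.
  elim: (index_iota 0 n) => [|i l IH]; first by rewrite !big_nil.
  rewrite big_cons IH /=; case: (@choice.pickle_inv V i) => [x|] /=; last by rewrite add0e.
  by rewrite big_cons.
by apply: hB; rewrite (pmap_uniq (@choice.pickle_invK V)) ?iota_uniq.
Qed.

(** Undoes the linearisation: suprema at different points are chosen independently, so a bound for
    every selection bounds the sum of the suprema. *)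
Lemma sum_ereal_sup (J : Type) (u : V -> J -> \bar R) (B : \bar R) s : J -> uniq s ->
  (forall x j, 0 <= u x j) ->
  (forall n : V -> J, \sum_(x <- s) u x (n x) <= B) ->
  \sum_(x <- s) ereal_sup (range (u x)) <= B.
Proof.
move=> j0 us u0.
have sup0 x : 0 <= ereal_sup (range (u x)).
  by apply: le_trans (u0 x j0) _; apply: ereal_sup_ubound; exists j0.
have [By|] := eqVneq B +oo; first by rewrite By leey.
move=> Bn h.
(* Points of [s1] already carry the supremum, those of [s2] still a selected value. One point moves
   at a time, with the remaining sum [c] finite so that it can be subtracted. *)
suff main s1 s2 : uniq (s1 ++ s2) -> (forall n : V -> J,
   \sum_(x <- s1 ++ s2) u x (n x) <= B) -> forall n : V -> J,
   \sum_(x <- s1) ereal_sup (range (u x)) + \sum_(x <- s2) u x (n x) <= B.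
  have := main s [::]; rewrite cats0 => /(_ us h (fun=> j0)).
  by rewrite big_nil adde0.
elim: s1 s2 => [|x s1 IH] s2 us12 h12 n; first by rewrite big_nil add0e h12.
have {}IH := IH (x :: s2).
have pe : perm_eq (s1 ++ x :: s2) ((x :: s1) ++ s2) by rewrite perm_catC /= perm_cons perm_catC.
have {}IH : forall n, \sum_(x <- s1) ereal_sup (range (u x)) + \sum_(x <- x :: s2) u x (n x) <= B.
  apply: IH => [|n']; first by rewrite (perm_uniq pe).
  by rewrite (perm_big _ pe).
have xs2 : x \notin s2 by move: us12; rewrite /= mem_cat negb_or => /andP[/andP[]].
set c := \sum_(y <- s1) ereal_sup (range (u y)) + \sum_(y <- s2) u y (n y).
have c0 : 0 <= c by rewrite adde_ge0 ?sume_ge0.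
have hj j : u x j + c <= B.
  have := IH (fun y => if y == x then j else n y); rewrite big_cons eqxx addeCA.
  congr (_ + (_ + _) <= _); rewrite big_seq [RHS]big_seq; apply: eq_bigr => y ys.
  by case: eqVneq => // yx; rewrite -yx ys in xs2.
have cB : c <= B by apply: le_trans (hj j0); rewrite leeDr.
have cf : c \is a fin_num.
  by rewrite ge0_fin_numE // (le_lt_trans cB) // lt_neqAle Bn leey.
rewrite big_cons -addeA -/c -leeBrDr //; apply: ge_ereal_sup => _ [j _ <-].
by rewrite leeBrDr.
Qed.

End CountingMeasure.

Section Averages.
Context {R : realType} {d : nat}.
Notation V := 'rV[int]_d.

(** Jensen's inequality by induction, the head having weight [1 / (size s + 1)]; the empty mean is 0
    since [0^-1 = 0]. *)
Lemma mean_powR (T : Type) (s : seq T) (F : T -> R) (q : R) : 1 <= q ->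
  (forall y, 0 <= F y) ->
  ((size s)%:R^-1 * \sum_(y <- s) F y) `^ q <= (size s)%:R^-1 * \sum_(y <- s) F y `^ q.
Proof.
move=> q1 F0; have q0 : q != 0 by rewrite gt_eqF // (lt_le_trans _ q1).
elim: s => [|x s IH]; first by rewrite !big_nil !mulr0 powR0.
have [s0|s0] := posnP (size s).
  by rewrite (size0nil s0) /= !big_seq1 invr1 !mul1r.
have n0 : 0 < (size s)%:R :> R by rewrite ltr0n.
have n1 : 0 < (size s).+1%:R :> R by rewrite ltr0n.
have t0 : 0 <= (size s).+1%:R^-1 :> R by rewrite invr_ge0.
have t1 : (size s).+1%:R^-1 <= 1 :> R by rewrite invf_le1 // ler1n.
have spl (G : T -> R) : (size s).+1%:R^-1 * \sum_(y <- x :: s) G y =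
    (size s).+1%:R^-1 * G x + (1 - (size s).+1%:R^-1) * ((size s)%:R^-1 * \sum_(y <- s) G y).
  by rewrite big_cons -[(size s).+1%:R]natr1; field; rewrite natr1 !gt_eqF.
rewrite [size (x :: s)]/= !spl.
have m0 : 0 <= (size s)%:R^-1 * \sum_(y <- s) F y by rewrite mulr_ge0 ?invr_ge0 ?sumr_ge0.
have := @convex_powR R q q1 (Itv01 t0 t1) (F x) ((size s)%:R^-1 * \sum_(y <- s) F y).
rewrite !inE /= !in_itv /= !andbT => /(_ (F0 x) m0).
rewrite !convRE /= => h; apply: le_trans h _.
by rewrite lerD2l ler_wpM2l // subr_ge0.
Qed.

Lemma normc_sum (s : seq V) (f : V -> R[i]) :
  Normc.normc (\sum_(y <- s) f y) <= \sum_(y <- s) Normc.normc (f y).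
Proof.
elim: s => [|y s IH]; first by rewrite !big_nil Normc.normc0.
by rewrite !big_cons; apply: le_trans (le_normcD _ _) _; rewrite lerD2l.
Qed.

Lemma normc_ge0 (z : R[i]) : 0 <= Normc.normc z.
Proof. by case: z => a b; exact: sqrtr_ge0. Qed.

Lemma normc_natr (n : nat) : Normc.normc n%:R = n%:R :> R.
Proof. by rewrite -mulr_natl mulr1 normcMn Normc.normc1. Qed.

Lemma normc_average (G : set 'rV[R]_d) (f : V -> R[i]) (n : int) x : convex_body G ->
  Normc.normc (discrete_average G (2 ^ n) f x) <=
  lat_avg (dyadic_points G n) (fun y => Normc.normc (f y)) x.
Proof.
move=> cG; rewrite /discrete_average fsbig_finite; last exact: dyadic_finite.
rewrite Normc.normcM Normc.normcV normc_natr.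
by rewrite ler_wpM2l ?invr_ge0 //; exact: normc_sum.
Qed.

Lemma lat_avg_ge0 (A : seq V) (H : V -> R) x : (forall y, 0 <= H y) -> 0 <= lat_avg A H x.
Proof. by move=> H0; rewrite /lat_avg mulr_ge0 ?invr_ge0 // sumr_ge0. Qed.

Lemma lat_avg_powR (A : seq V) (F : V -> R) x (q : R) : 1 <= q -> (forall y, 0 <= F y) ->
  lat_avg A F x `^ q <= lat_avg A (fun y => F y `^ q) x.
Proof. by move=> q1 F0; exact: (@mean_powR V A (fun y => F (x - y))  q q1). Qed.

Lemma lat_avg_le (A : seq V) (F : V -> R) x (c : R) : 0 <= c -> (forall y, F y <= c) ->
  lat_avg A F x <= c.
Proof.
move=> c0 hF; rewrite /lat_avg; have [->|A0] := posnP (size A).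
  by rewrite invr0 mul0r.
rewrite mulrC ler_pdivrMr ?ltr0n //; apply: le_trans (ler_sum _ (fun y _ => hF (x - y))) _.
by rewrite big_const_seq iter_addr_0 count_predT mulr_natr.
Qed.

End Averages.

Section LpBounds.
Context {R : realType} {d : nat}.
Notation V := 'rV[int]_d.
Variable G : set 'rV[R]_d.
Hypotheses (d_gt0 : (0 < d)%N) (cG : convex_body G) (sG : one_symmetric G).
Variable f : V -> R[i].
Let F (y : V) : R := Normc.normc (f y).
Let b (n : int) (x : V) : R := Normc.normc (discrete_average G (2 ^ n) f x).

Let F0 y : 0 <= F y. Proof. exact: normc_ge0. Qed.
Let bF n x : b n x <= lat_avg (dyadic_points G n) F x.
Proof. exact: normc_average. Qed.

Lemma Ctorus_ge0 : 0 <= Ctorus :> R.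
Proof.
have := @Kpsi_ge0 R; have := sqr_ge0 (@CE R) => h1 h2.
by rewrite /Ctorus -lock mulr_ge0 // addr_ge0 // mulr_ge0 // mulr_ge0.
Qed.

Local Open Scope ereal_scope.

Lemma ge0_le_poweR (r : R) (x y : \bar R) : (0 <= r)%R -> 0 <= x -> x <= y ->
  x `^ r <= y `^ r.
Proof.
move=> r0 x0 xy; apply: (gt0_ler_poweR r0) => //; rewrite in_itv /=.
  by rewrite x0 leey.
by rewrite (le_trans x0 xy) leey.
Qed.

Lemma dyadic_maximal_ge0 x : 0 <= dyadic_maximal G f x.
Proof.
apply: le_trans (_ : (b 0 x)%:E <= _); first by rewrite lee_fin normc_ge0.
by apply: ereal_sup_ubound; exists 0%R.
Qed.

Lemma maximal_Linfty : lp_norm +oo (modulus f) < +oo ->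
  lp_norm +oo (dyadic_maximal G f) <= lp_norm +oo (modulus f).
Proof.
rewrite /lp_norm unlock; case: ifPn => // mu0.
set c := ess_sup _ _ => cy.
(* Singletons have counting measure 1, so almost everywhere means everywhere. *)
have all_ae (P : V -> Prop) : (\forall x \ae (@counting V R), P x) -> forall x, P x.
  move=> [N [_ N0 hN]] x; apply: contrapT => nP.
  have xN : [set x] `<=` N by move=> y ->; exact: hN.
  have : counting [set x] <= counting N :> \bar R.
    by apply: (le_measure (@counting V R)); rewrite ?inE //; exact: measurable_lattice.
  by rewrite N0 counting_set1 lee_fin ler10.
have Fc y : (F y)%:E <= c.
  have := all_ae _ (ess_sup_ge (@counting V R) (abse \o modulus f)) y.
  by rewrite /= ger0_norm ?normc_ge0.
have c0 : 0 <= c by apply: le_trans (Fc 0%R); rewrite lee_fin normc_ge0.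
have cf : c \is a fin_num by rewrite ge0_fin_numE.
apply/ess_supP/nearW => x /=; rewrite gee0_abs ?dyadic_maximal_ge0 //.
apply: ge_ereal_sup => _ [n _ <-]; rewrite -(fineK cf) lee_fin.
apply: le_trans (bF n x) _; apply: lat_avg_le; first exact: fine_ge0.
by move=> y; rewrite -lee_fin fineK.
Qed.

(** The l^2 bound is applied to [H], the power [r / 2] of [F]. By Jensen the r-th power of an
    average of [F] is at most the square of the average of [H], and the squares of [H] sum to the
    r-th powers of [F]. *)
Lemma maximal_Lp (r : R) : (2 <= r)%R ->
  lp_norm r%:E (dyadic_maximal G f) <= (1 + Ctorus)%:E * lp_norm r%:E (modulus f).
Proof.
move=> r2; have r0 : (0 < r)%R by apply: lt_le_trans r2.
have rn : r != 0%R by rewrite gt_eqF.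
have ri0 : (0 <= r^-1)%R by rewrite invr_ge0 ltW.
rewrite /lp_norm unlock.
have [B EB] : exists B, B = \int[counting]_x (`|modulus f x| `^ r) by eexists.
rewrite -EB; have BE : B = \int[counting]_x ((F x `^ r)%R)%:E.
  rewrite EB; apply: eq_integral => x _; rewrite /modulus gee0_abs ?lee_fin ?normc_ge0 // poweR_EFin.
have B0 : 0 <= B by rewrite EB; apply: integral_ge0 => x _; exact: poweR_ge0.
clear EB; have q1 : (1 <= r / 2)%R by lra.
pose H (y : V) : R := (F y `^ (r / 2))%R.
have H0 y : (0 <= H y)%R by exact: powR_ge0.
have sqrE (x : R) : (0 <= x)%R -> ((x `^ (r / 2)) ^+ 2 = x `^ r)%R.
  by move=> x0; rewrite -powR_mulrn ?powR_ge0 // -powRrM; congr (_ `^ _)%R; field.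
pose u x n : \bar R := ((lat_avg (dyadic_points G n) H x) ^+ 2)%:E.
have u0 x n : 0 <= u x n by rewrite lee_fin sqr_ge0.
have bu x n : (b n x)%:E `^ r <= u x n.
  rewrite poweR_EFin lee_fin -sqrE ?normc_ge0 // lerXn2r ?nnegrE ?powR_ge0 ?lat_avg_ge0 //.
  apply: le_trans (lat_avg_powR _ _ q1 F0).
  by rewrite ge0_ler_powR ?nnegrE ?normc_ge0 ?lat_avg_ge0 //; lra.
have Mu x : `|dyadic_maximal G f x| `^ r <= ereal_sup (range (u x)).
  rewrite gee0_abs ?dyadic_maximal_ge0 //; set U := ereal_sup _.
  have U0 : 0 <= U by apply: le_trans (u0 x 0%R) _; apply: ereal_sup_ubound; exists 0%R.
  have -> : U = (U `^ r^-1) `^ r by rewrite -poweRrM mulVf // poweRe1.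
  apply: ge0_le_poweR; [exact: ltW | exact: dyadic_maximal_ge0 | ].
  apply: ge_ereal_sup => _ [n _ <-].
  have -> : (b n x)%:E = ((b n x)%:E `^ r) `^ r^-1.
    by rewrite -poweRrM mulfV // poweRe1 // lee_fin normc_ge0.
  apply: ge0_le_poweR; [exact: ri0 | exact: poweR_ge0 | ].
  by apply: le_trans (bu x n) _; apply: ereal_sup_ubound; exists n.
have key : \int[counting]_x (`|dyadic_maximal G f x| `^ r) <= Ctorus%:E * B.
  apply: integral_le_sum => [x|s us]; first exact: poweR_ge0.
  apply: le_trans (_ : \sum_(x <- s) ereal_sup (range (u x)) <= _).
    by apply: lee_sum => x _; exact: Mu.
  apply: sum_ereal_sup => // [|n]; first exact: 0%R.
  have [t [ut ht]] := dyadic_l2 cG d_gt0 sG H n us.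
  rewrite sumEFin; apply: le_trans (_ : (Ctorus * \sum_(y <- t) H y ^+ 2)%:E <= _).
    by rewrite lee_fin.
  rewrite EFinM lee_wpmul2l ?lee_fin ?Ctorus_ge0 // BE -sumEFin.
  under eq_bigr do rewrite sqrE //.
  by apply: sum_le_integral => // x; rewrite lee_fin powR_ge0.
have C0 := Ctorus_ge0.
apply: le_trans (_ : (Ctorus%:E * B) `^ r^-1 <= _).
  apply: ge0_le_poweR => //.
  by apply: integral_ge0 => x _; exact: poweR_ge0.
rewrite poweRM // lee_wpmul2r ?poweR_ge0 // poweR_EFin lee_fin.
(* Adding 1 makes the base at least 1, so the root is bounded by the base itself, uniformly in
   [r]. *)
apply: le_trans (_ : (1 + Ctorus) `^ r^-1 <= _)%R.
  by rewrite ge0_ler_powR ?nnegrE //; lra.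
apply: le_trans (_ : (1 + Ctorus) `^ 1 <= _)%R; last by rewrite powRr1 //; lra.
by rewrite ler_powR //; [lra | rewrite invf_le1 //; lra].
Qed.

End LpBounds.

Theorem theorem1p4 (R : realType) :
  exists C : R,
    forall (p : \bar R) (hp : (2%:E <= p)%E)
      (d : nat) (hd : (0 < d)%N)
      (G : set 'rV[R]_d) (hG : convex_body G) (symG : one_symmetric G)
      (f : 'rV[int]_d -> R[i]) (hf : in_lp p f),
      (lp_norm p (dyadic_maximal G f) <= C%:E * lp_norm p (modulus f))%E.
Proof.
exists (1 + Ctorus) => -[r| |] hp d d0 G cG sG f hf //.
  exact: maximal_Lp.
apply: le_trans (maximal_Linfty cG hf) _.
apply: lee_pemull; first exact: Lnorm_ge0.
by rewrite lee_fin lerDl Ctorus_ge0.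
Qed.
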